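(* Let $G$ be a finite, compact metric graph with edges $I_1,\dots,I_r$ and vertices $v_1,\dots,v_s$, let $q_j\in L^1(I_j)$ be real-valued for $j=1,\dots,r$, and let $B$ be a set of vertices of $G$ which contains all boundary vertices and all proper core vertices of $G$. Moreover, let $\alpha\in\mathbb{R}^s$, let $A_\alpha$ be the selfadjoint Schrödinger operator in $L^2(G)$ with $\delta$-type vertex conditions of strength $\alpha$, and let $M_{B,\alpha}$ be the corresponding Titchmarsh--Weyl function. Then for each $\lambda\in\mathbb{R}$ which is not a resonance the following assertions hold. (i) $\lambda$ is an eigenvalue of $A_\alpha$ if and only if $\lambda$ is a pole of $M_{B,\alpha}$. (ii) $\dim\ker(A_\alpha-\lambda)=\operatorname{rank}\operatorname{Res}_\lambda M_{B,\alpha}$.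
   Context: A finite, compact metric graph $G$ is a collection of finitely many compact intervals $I_j=[0,L_j]$, $L_j>0$, $j=1,\dots,r$ (the edges), together with an equivalence relation on the set of endpoints of these intervals; the equivalence classes $v_1,\dots,v_s$ are the vertices. Write $o(I_j)$ for the vertex containing the endpoint $0$ of $I_j$ and $t(I_j)$ for the vertex containing the endpoint $L_j$. Loops and multiple edges are allowed. The degree of a vertex is the cardinality of the equivalence class (a loop counts twice). A boundary vertex is a vertex of degree one. The core of $G$ is the largest subgraph of $G$ (consisting of a set of edges together with their endpoints) which does not have vertices of degree one (degrees being taken in the subgraph); it is empty if and only if every connected component of $G$ is a tree. A vertex $v$ of $G$ is called a proper core vertex if all edges attached to $v$ belong to the core of $G$. A cycle in $G$ is a closed path in $G$ without repeated edges or vertices (apart from the coinciding start and end vertex); a loop is a cycle with one edge and two parallel edges form a cycle with two edges. A number $\lambda\in\mathbb{R}$ is a Dirichlet eigenvalue of an edge $I_j$ if $\lambda$ is an eigenvalue of the selfadjoint operator $-\frac{d^2}{dx^2}+q_j$ in $L^2(I_j)$ subject to the Dirichlet boundary conditions $f_j(0)=f_j(L_j)=0$. A number $\lambda\in\mathbb{R}$ is a resonance if there exists a cycle in $G$ such that $\lambda$ is a Dirichlet eigenvalue of each edge in this cycle. A function $f:G\to\mathbb{C}$ is a collection of functions $f_j:I_j\to\mathbb{C}$, $j=1,\dots,r$, and $L^2(G)=\bigoplus_{j=1}^r L^2(I_j)$. The function $f$ is continuous on $G$ if each $f_j$ is continuous on $I_j$ and, at each vertex, the values of all components at the endpoints belonging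 to this vertex coincide; $f(v_i)$ denotes this common value. $AC^2(G)$ is the set of $f:G\to\mathbb{C}$ such that $f_j$ and $f_j'$ are absolutely continuous on $(0,L_j)$ for all $j$ (so that the values of $f_j,f_j'$ at $0$ and $L_j$ are defined). The differential expression $\mathcal{L}$ acts as $(\mathcal{L}f)_j=-f_j''+q_jf_j$ on $I_j$, $j=1,\dots,r$. For a vertex $v_i$, $$\partial_\nu f(v_i)=\sum_{t(I_j)=v_i}f_j'(L_j)-\sum_{o(I_j)=v_i}f_j'(0).$$ The operator $A_\alpha$ in $L^2(G)$ is given by $A_\alpha f=\mathcal{L}f$ with domain consisting of all $f\in L^2(G)\cap AC^2(G)$ such that $\mathcal{L}f\in L^2(G)$, $f$ is continuous on $G$, and $\partial_\nu f(v_i)-\alpha_if(v_i)=0$ for $i=1,\dots,s$. It is selfadjoint, semibounded below, and has compact resolvent; $\sigma(A_\alpha)$ denotes its spectrum, which consists of isolated eigenvalues of finite multiplicity. Titchmarsh--Weyl function: let $B=\{v_{i_1},\dots,v_{i_m}\}$ be a nonempty set of (distinct) vertices and $\mu\in\mathbb{C}\setminus\sigma(A_\alpha)$. For $l=1,\dots,m$ let $f^{(l)}\in L^2(G)\cap AC^2(G)$ be the unique function that is continuous on $G$, satisfies $\mathcal{L}f^{(l)}=\mu f^{(l)}$, $\partial_\nu f^{(l)}(v_{i_l})-\alpha_{i_l}f^{(l)}(v_{i_l})=1$, and $\partial_\nu f^{(l)}(v_i)-\alpha_if^{(l)}(v_i)=0$ for all $i\in\{1,\dots,s\}$ with $i\neq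 i_l$. Then $M_{B,\alpha}(\mu)\in\mathbb{C}^{m\times m}$ is the matrix with entries $(M_{B,\alpha}(\mu))_{k,l}=f^{(l)}(v_{i_k})$, $k,l=1,\dots,m$. Equivalently, $M_{B,\alpha}(\mu)$ maps $(\partial_\nu f(v_{i_k})-\alpha_{i_k}f(v_{i_k}))_{k=1}^m$ to $(f(v_{i_k}))_{k=1}^m$ for every continuous $f\in L^2(G)\cap AC^2(G)$ with $\mathcal{L}f=\mu f$ and $\partial_\nu f(v_i)-\alpha_if(v_i)=0$ for all $i\notin\{i_1,\dots,i_m\}$. (A set $B$ containing all boundary vertices and all proper core vertices is automatically nonempty.) The function $M_{B,\alpha}$ is analytic on $\mathbb{C}\setminus\sigma(A_\alpha)$ and meromorphic on $\mathbb{C}$; ''pole'' means a non-removable singularity. $\operatorname{Res}_\lambda M_{B,\alpha}$ is the residue (an $m\times m$ matrix) of $M_{B,\alpha}$ at $\lambda$, with the convention $\operatorname{Res}_\lambda M_{B,\alpha}=0$ if $M_{B,\alpha}$ is analytic at $\lambda$ or can be continued analytically into $\lambda$. *)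

(* Defs.v *)
From mathcomp Require Export all_boot all_order all_algebra.
From mathcomp Require Export complex.
From mathcomp Require Export all_classical all_reals all_analysis.

Set Implicit Arguments.
Unset Strict Implicit.
Unset Printing Implicit Defensive.

Export Order.TTheory GRing.Theory Num.Theory.
Export numFieldNormedType.Exports.

Local Open Scope classical_set_scope.
Local Open Scope ring_scope.
Local Open Scope complex_scope.

(* An endpoint is a pair (j, b): b = false is the endpoint 0 of [0, L_j] and
   b = true is the endpoint L_j. An equivalence relation on the endpoints with
   classes v_0, ..., v_(s-1) is the same as a surjection onto 'I_s; surjectivity
   excludes isolated vertices. *)
Record metric_graph (R : realType) := MetricGraph {
  nedges : nat;
  nverts : nat;
  len : 'I_nedges -> R;
  vtx : 'I_nedges * bool -> 'I_nverts;
  nedges_gt0 : (0 < nedges)%N;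
  len_gt0 : forall j, 0 < len j;
  vtx_surj : forall v, exists e, vtx e == v
}.

Section Combinatorics.
Context {R : realType} (G : metric_graph R).

Definition edge := 'I_(nedges G).
Definition vertex := 'I_(nverts G).
Definition endpoint := (edge * bool)%type.

Definition degree_in (E : {set edge}) (v : vertex) : nat :=
  #|[set e : endpoint | (e.1 \in E) && (vtx e == v)]|.

Definition degree (v : vertex) : nat := degree_in [set: edge] v.

Definition boundary_vertex (v : vertex) : bool := degree v == 1%N.

Definition no_degree_one (E : {set edge}) : bool :=
  [forall v : vertex, degree_in E v != 1%N].

(* The edge set of the core: by [no_degree_one_core] and [sub_core] below it is
   the largest edge set without vertices of degree one. *)
Definition core : {set edge} :=
  (\bigcup_(E : {set edge} | no_degree_one E) E)%SET.

Lemma sub_core (E : {set edge}) : no_degree_one E -> E \subset core.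
Proof. by move=> hE; apply: (finset.bigcup_sup E). Qed.

Lemma no_degree_one_core : no_degree_one core.
Proof.
apply/forallP => v; apply/negP => /eqP h1.
have /card_gt0P[[j b]] : (0 < degree_in core v)%N by rewrite h1.
rewrite inE /= => /andP[/finset.bigcupP[E hE jE] vj].
have le1 : (degree_in E v <= 1)%N.
  rewrite -h1; apply: subset_leq_card; apply/fintype.subsetP => e.
  rewrite !inE => /andP[eE ev]; apply/andP; split => //.
  exact: (fintype.subsetP (sub_core hE)).
have gt0 : (0 < degree_in E v)%N.
  by apply/card_gt0P; exists (j, b); rewrite inE /= jE.
by move/forallP : hE => /(_ v); rewrite eqn_leq le1 gt0.
Qed.

Definition proper_core_vertex (v : vertex) : bool :=
  [forall e : endpoint, (vtx e == v) ==> (e.1 \in core)].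

(* An endpoint (j, b) also stands for the edge j traversed from this endpoint
   to the opposite one. *)
Definition dart_source (d : endpoint) : vertex := vtx d.
Definition dart_target (d : endpoint) : vertex := vtx (d.1, ~~ d.2).

Definition graph_cycle (c : seq endpoint) : bool :=
  [&& c != [::],
      cycle (fun d d' => dart_target d == dart_source d') c,
      uniq [seq d.1 | d <- c] & uniq [seq dart_source d | d <- c]].

End Combinatorics.

Arguments edge {R} G.
Arguments vertex {R} G.
Arguments endpoint {R} G.

(* For functions from the real line to R[i], measurability, continuity, absolute
   continuity, derivatives and one-sided limits are taken componentwise. A
   function on [0, L] is the restriction of a function on R, whose values
   outside [0, L] play no role. *)
Section OneEdge.
Context {R : realType}.
Local Notation mu := (@lebesgue_measure R).
Implicit Types (f g : R -> R[i]) (L : R).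

Definition Rabs_cont (I : interval R) (f : R -> R) : Prop :=
  forall eps : R, 0 < eps -> exists2 delta : R, 0 < delta &
  forall (n : nat) (a b : 'I_n -> R),
    (forall k, [/\ a k \in I, b k \in I & a k <= b k]) ->
    trivIset setT (fun k => `]a k, b k[%classic) ->
    \sum_(k < n) (b k - a k) < delta ->
    \sum_(k < n) `|f (b k) - f (a k)| < eps.

Definition abs_cont (I : interval R) f : Prop :=
  Rabs_cont I (fun x => complex.Re (f x)) /\
  Rabs_cont I (fun x => complex.Im (f x)).

Definition cderivable f (x : R) : Prop :=
  derivable (fun t => complex.Re (f t)) x 1 /\
  derivable (fun t => complex.Im (f t)) x 1.

Definition cderiv f (x : R) : R[i] :=
  derive1 (fun t => complex.Re (f t)) x +i* derive1 (fun t => complex.Im (f t)) x.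

Definition clim (F : set_system R) f : R[i] :=
  lim ((fun x => complex.Re (f x)) @ F) +i* lim ((fun x => complex.Im (f x)) @ F).

Definition ccontinuous L f : Prop :=
  {within `[0, L], continuous (fun x => complex.Re (f x))} /\
  {within `[0, L], continuous (fun x => complex.Im (f x))}.

(* Absolute continuity on the closed interval means absolute continuity on
   the open one together with f(0) and f(L) being the one-sided limits of f;
   the boundary values of f' are [cderiv_start] and [cderiv_end]. *)
Definition edge_AC2 L f : Prop :=
  [/\ abs_cont `[0, L] f,
      forall x, x \in `]0, L[ -> cderivable f x &
      abs_cont `]0, L[ (cderiv f)].

Definition cderiv_start f : R[i] := clim 0^'+ (cderiv f).
Definition cderiv_end L f : R[i] := clim L^'- (cderiv f).

Definition edge_sqnorm L f : \bar R :=
  (\int[mu]_(x in `[0%R, L]) (complex.Re (f x) ^+ 2 + complex.Im (f x) ^+ 2)%:E)%E.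

Definition edge_L2 L f : Prop :=
  [/\ measurable_fun `[0, L] (fun x => complex.Re (f x)),
      measurable_fun `[0, L] (fun x => complex.Im (f x)) &
      (edge_sqnorm L f < +oo)%E].

Definition edge_eq L f g : Prop := ae_eq mu `[0, L]%classic f g.

Definition edge_expr (q : R -> R) f : R -> R[i] :=
  fun x => - cderiv (cderiv f) x + (q x)%:C * f x.

Definition dirichlet_eigenvalue L (q : R -> R) (lam : R) : Prop :=
  exists f, [/\ edge_L2 L f, edge_AC2 L f, f 0 = 0 /\ f L = 0,
    edge_eq L (edge_expr q f) (fun x => lam%:C * f x) &
    ~ edge_eq L f (fun=> 0)].

End OneEdge.

Section SchrodingerOperator.
Context {R : realType} {G : metric_graph R}.
Variable q : edge G -> R -> R.

Definition gfun := edge G -> R -> R[i].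
Implicit Types (f g h : gfun) (v : vertex G) (e : endpoint G) (z : R[i]).

Definition resonance (lam : R) : Prop :=
  exists2 c : seq (endpoint G), graph_cycle c &
    forall d, d \in c -> dirichlet_eigenvalue (len d.1) (q d.1) lam.

Definition endpoint_value f e : R[i] := f e.1 (if e.2 then len e.1 else 0).

Definition continuous_on_graph f : Prop :=
  (forall j, ccontinuous (len j) (f j)) /\
  (forall e e', vtx e = vtx e' -> endpoint_value f e = endpoint_value f e').

(* The value at an arbitrarily chosen endpoint belonging to v. *)
Definition vertex_value f v : R[i] := endpoint_value f (xchoose (vtx_surj v)).

Definition AC2 f : Prop := forall j, edge_AC2 (len j) (f j).

(* The elements of L^2(G) are the functions satisfying [L2] modulo [geq]. *)
Definition L2 f : Prop := forall j, edge_L2 (len j) (f j).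
Definition geq f g : Prop := forall j, edge_eq (len j) (f j) (g j).
Definition sqnorm f : \bar R := (\sum_j edge_sqnorm (len j) (f j))%E.

Definition diff_expr f : gfun := fun j => edge_expr (q j) (f j).

Definition normal_derivative f v : R[i] :=
  \sum_(j | vtx (j, true) == v) cderiv_end (len j) (f j)
  - \sum_(j | vtx (j, false) == v) cderiv_start (f j).

Section Delta.
Variable alpha : vertex G -> R.

Definition delta_defect f v : R[i] :=
  normal_derivative f v - (alpha v)%:C * vertex_value f v.

(* The graph of A_alpha: [A_delta f g] means that f belongs to the domain and
   A_alpha f = g in L^2(G). *)
Definition A_delta f g : Prop :=
  [/\ L2 f /\ AC2 f, L2 g, geq (diff_expr f) g,
      continuous_on_graph f & forall v, delta_defect f v = 0].

Definition kernel z : set gfun := [set f | A_delta f (fun j x => z * f j x)].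

Definition eigenvalue z : Prop :=
  exists2 f, kernel z f & ~ geq f (fun=> fun=> 0).

Definition resolvent_set : set R[i] := [set z |
  (forall h, L2 h -> exists f g, A_delta f g /\ geq (fun j x => g j x - z * f j x) h) /\
  (exists K : R, forall f g, A_delta f g ->
    (sqnorm f <= K%:E * sqnorm (fun j x => g j x - z * f j x)%R)%E)].

Definition spectrum : set R[i] := ~` resolvent_set.

Definition weyl_solution z v f : Prop :=
  [/\ L2 f /\ AC2 f, continuous_on_graph f,
      geq (diff_expr f) (fun j x => z * f j x) &
      forall w, delta_defect f w = (w == v)%:R].

(* The Titchmarsh--Weyl matrix; it is meaningful for z outside [spectrum],
   where [weyl_solution z v] has exactly one element up to [geq]. The vertices
   in B are listed by [enum_val]. *)
Definition titchmarsh_weyl (B : {set vertex G}) z : 'M[R[i]]_#|B| :=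
  \matrix_(k, l)
    vertex_value (xget (fun=> fun=> 0) (weyl_solution z (enum_val l))) (enum_val k).

End Delta.

(* Dimension of a space of functions in L^2(G). *)
Definition has_dimension (V : set gfun) (n : nat) : Prop :=
  exists b : 'I_n -> gfun,
  [/\ forall i, V (b i),
      forall c : 'I_n -> R[i],
        geq (fun j x => \sum_i c i * b i j x) (fun=> fun=> 0) -> forall i, c i = 0 &
      forall f, V f ->
        exists c : 'I_n -> R[i], geq f (fun j x => \sum_i c i * b i j x)].

End SchrodingerOperator.

(* Singularities of a matrix-valued function F defined on a set D. *)
Section Singularities.
Context {R : realType} {m : nat}.
Implicit Types (D : set R[i]) (F H : R[i] -> 'M[R[i]]_m) (z : R[i]).

Definition complex_differentiable F z : Prop :=
  forall k l, derivable (fun w : R[i]^o => F w k l : R[i]^o) z 1.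

Definition analytic_at F z : Prop :=
  \forall w \near (z : R[i]^o), complex_differentiable F w.

Definition isolated_singularity D F z : Prop :=
  \forall w \near (z : R[i]^o)^', D w /\ complex_differentiable F w.

Definition removable D F z : Prop :=
  exists2 H, analytic_at H z & \forall w \near (z : R[i]^o)^', D w /\ F w = H w.

Definition pole D F z : Prop := isolated_singularity D F z /\ ~ removable D F z.

(* Res is the coefficient of (w - z)^(-1) in the Laurent expansion of F at z,
   whose principal part has to be finite; leading coefficients may vanish, so
   that Res = 0 if the singularity is removable. *)
Definition is_residue D F z (Res : 'M[R[i]]_m) : Prop :=
  exists (n : nat) (P : 'I_n.+1 -> 'M[R[i]]_m) (H : R[i] -> 'M[R[i]]_m),
  [/\ P ord0 = Res, analytic_at H z &
      \forall w \near (z : R[i]^o)^',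
        D w /\ F w = \sum_(k < n.+1) (w - z) ^- k.+1 *: P k + H w].

End Singularities.

(* Main.v *)
From HB Require Import structures.
From mathcomp Require Import measurable_realfun ring lra zify.
Require Import Defs.

Set Implicit Arguments.
Unset Strict Implicit.
Unset Printing Implicit Defensive.

(** The continuity and delta conditions for a solution of the differential equation with
    parameter [z] are linear equations in its data: the initial value and slope on every
    edge and the value at every vertex. Let [T(z)] be the square matrix of this linear
    system ([charmx], acting on row vectors). The kernel of [A - lam] is isomorphic to the
    left kernel of [T(lam)] ([kernel_dimension]), [T(z)] invertible implies that [z] is in
    the resolvent set ([unit_resolvent]), and the Titchmarsh--Weyl matrix is then the
    transpose of a submatrix [S T(z)^-1 S^T] of the inverse ([titchmarsh_weyl_unit]). As [T]
    is entire, everything reduces to the singularity of [T^-1] at [lam].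

    Write [T(z) = T0 + (z - lam) T1 + (z - lam)^2 T2(z)] ([charmx_taylor]). By Green's
    formula a kernel function which is in the range of [A - lam] is zero; for the matrices
    this says that [x T0 = 0] and [x T1 = y T0] force [x = 0] ([no_jordan_chain]). Linear
    algebra then yields [T(z)^-1 = (z - lam)^-1 Rs + H(z)] with [H] analytic at [lam],
    [Rs T0 = 0] and [Rs T1 + K T0 = 1] for some matrix [K] ([simple_pole_inverse]). So the
    residue of the Titchmarsh--Weyl matrix is the transpose of [S Rs S^T], and it remains to
    see that the rank of this matrix is the dimension of the kernel of [T0]; both assertions
    follow from this equality and [pole_simple].

    The rank is at most this dimension since the rows of [Rs] lie in the kernel. The
    opposite inequality ([rank_compression]) rests on unique continuation: if [lam] is not a
    resonance, a kernel function that vanishes at all vertices in [B] is zero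
    ([unique_continuation]). Indeed the edges on which it is not zero form a subgraph
    without vertices of degree one, because at such a vertex the function and then its
    derivative would vanish; this subgraph lies in the core, the function vanishes at all
    its vertices, and unless it is empty it contains a cycle ([exists_cycle]), every edge of
    which has the Dirichlet eigenvalue [lam]. Unique continuation is used twice: to see that
    the left kernel of [S Rs S^T] consists of vectors [b] for which [b S] is in the range of
    [T0], and, since Green's formula makes these [b] orthogonal to the boundary values of
    all kernel functions ([select_orthogonal]), to see that these boundary values form a
    space of the full dimension.

    The potentials are merely integrable, so the equation is used in integrated form.
    Absolute continuity in the sense of small increments is turned into being a primitive
    ([abs_cont_primitive]) by reduction to nondecreasing functions, whose Stieltjes measures
    have a density. Solutions exist by Picard iteration ([system_solution]); Gronwall's
    inequality ([gronwall]) gives their uniqueness and the bounds from which the analyticity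
    of [T] ([derivable_source]) and the boundedness of the resolvent follow. *)

(** * Cycles in finite graphs *)

Section Cycle.
Context {R : realType} (G : metric_graph R).
Implicit Types (E : {set edge G}) (d e : endpoint G).

Lemma second_endpoint E d : no_degree_one E -> d.1 \in E ->
  exists e, [&& e.1 \in E, vtx e == vtx d & e != d].
Proof.
move=> /forallP /(_ (vtx d)) h dE.
pose A := [set e : endpoint G | (e.1 \in E) && (vtx e == vtx d)].
have dA : d \in A by rewrite inE dE eqxx.
have : 0 < #|A :\ d|.
  have := cardsD1 d A; rewrite dA => cA; move: h; rewrite /degree_in.
  rewrite [X in X != 1](_ : _ = #|A|); first by rewrite cA; case: #|_ :\ _|.
  by apply: eq_card => e; apply/idP/idP; rewrite !inE.
case/card_gt0P => e; rewrite !inE => /andP[ed /andP[eE ev]].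
by exists e; rewrite eE ev ed.
Qed.

(** A walk that never turns back can always be continued when no vertex has degree one; from
    its first return to a vertex one reads off a closed walk without repeated vertices, and an
    edge repeated in it would be traversed in both directions, one immediately after the
    other. *)
Lemma exists_cycle E : no_degree_one E -> E != finset.set0 ->
  exists2 c : seq (endpoint G), graph_cycle c & forall d, d \in c -> d.1 \in E.
Proof.
move=> nd1 /finset.set0Pn[j0 j0E].
(* [ok d e]: the walk may leave along [e] after having traversed [d]. *)
pose rev d : endpoint G := (d.1, ~~ d.2).
pose ok d e := [&& e.1 \in E, vtx e == vtx (rev d) & e != rev d].
pose f d := odflt d [pick e | ok d e].
have fP d : d.1 \in E -> ok d (f d).
  move=> dE; rewrite /f; case: pickP => [e //|none].
  have [e he] := @second_endpoint E (rev d) nd1 dE.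
  by have := none e; rewrite /ok he.
pose w k := iter k f (j0, false).
have wE k : (w k).1 \in E.
  by elim: k => [//|k ih]; have /and3P[] := fP _ ih.
have wS k : vtx (w k.+1) = vtx (rev (w k)).
  by have /and3P[_ /eqP] := fP _ (wE k).
have w_nb k : w k.+1 != rev (w k) by have /and3P[] := fP _ (wE k).
pose s k := vtx (w k).
pose repeated k := [exists i : 'I_k, s i == s k].
have rep : exists k, repeated k.
  apply: contrapT => none.
  have inj : injective (fun i : 'I_(nverts G).+1 => s i).
    have lt a b : (a < b)%N -> s a <> s b.
      by move=> ab sab; apply: none; exists b; apply/existsP; exists (Ordinal ab); rewrite /= sab.
    move=> a b sab; apply/val_inj; case: (ltngtP a b) => // /lt; last by rewrite sab.
    by move=> /(_ sab).
  by have := leq_card _ inj; rewrite !card_ord ltnn.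
have [k /existsP[i /eqP sik] kmin] := ex_minnP rep.
have s_inj a b : a < k -> b < k -> s a = s b -> a = b.
  have lt x y : x < y -> y < k -> s x <> s y.
    move=> xy yk sxy; have : repeated y by apply/existsP; exists (Ordinal xy); rewrite /= sxy.
    by move=> /kmin; rewrite leqNgt yk.
  by move=> ak bk sab; case: (ltngtP a b) => // h; [have := lt _ _ h bk|have := lt _ _ h ak];
    rewrite sab.
have ik := ltn_ord i.
exists [seq w a | a <- iota i (k - i)]; last by move=> d /mapP[a _ ->].
apply/and4P; split.
- by rewrite -size_eq0 size_map size_iota subn_eq0 -ltnNge.
- have -> : (k - i = (k - i.+1).+1)%N by lia.
  rewrite /= rcons_path; apply/andP; split.
    have wpath : forall m a, path (fun d d' => dart_target d == dart_source d')
        (w a) [seq w b | b <- iota a.+1 m].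
      elim=> [//|m ih] a; apply/andP; split; last exact: ih.
      by rewrite /dart_target /dart_source -/(rev _) -wS.
    exact: wpath.
  have -> : last (w i) [seq w a | a <- iota i.+1 (k - i.+1)] = w k.-1.
    rewrite last_map; congr w.
    have : forall m a, last a (iota a.+1 m) = (a + m)%N.
      by elim=> [|m ih] a /=; rewrite ?addn0// ih addSnnS.
    by move=> ->; lia.
  rewrite /dart_target /dart_source -/(rev _) -wS prednK ?(leq_ltn_trans _ ik)//.
  by rewrite -/(s k) -sik.
- rewrite -map_comp map_inj_in_uniq ?iota_uniq// => a b.
  rewrite !mem_iota subnKC ?(ltnW ik)// => /andP[ia ak] /andP[ib bk] /= wab.
  have lt x y : x < y -> y < k -> (w x).1 = (w y).1 -> False.
    move=> xy yk wxy.
    have wyE : w y = rev (w x).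
      have : w x <> w y.
        move=> h; have sxy : s x = s y by rewrite /s h.
        by have := s_inj x y (ltn_trans xy yk) yk sxy; lia.
      rewrite /rev; move: wxy; case: (w x) (w y) => [x1 x2] [y1 y2] /= ->.
      by case: x2 y2 => [] [] //= h; case: h.
    have : s x.+1 = s y by rewrite /s wS wyE.
    move=> /(s_inj _ _ (leq_ltn_trans xy yk) yk) xyE.
    by have := w_nb x; rewrite xyE wyE eqxx.
  by case: (ltngtP a b) => // h; [case: (lt _ _ h bk)|case: (lt _ _ h ak)].
- rewrite -map_comp map_inj_in_uniq ?iota_uniq// => a b.
  rewrite !mem_iota subnKC ?(ltnW ik)// => /andP[ia ak] /andP[ib bk].
  exact: s_inj.
Qed.

End Cycle.

Local Open Scope classical_set_scope.
Local Open Scope ring_scope.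
Local Open Scope complex_scope.

Local Notation Re := (@complex.Re _).
Local Notation Im := (@complex.Im _).

(** * Absolutely continuous functions are primitives *)

Section Primitive.
Context {R : realType}.
Local Notation mu := (@lebesgue_measure R).
Implicit Types (L x y : R) (F G f g : R -> R).

Definition primitive_on L F f : Prop :=
  mu.-integrable `[0, L] (EFin \o f) /\
  forall x, 0 <= x <= L -> F x = F 0 + \int[mu]_(t in `[0, x]) f t.

Lemma integrable_patch L f : mu.-integrable `[0, L] (EFin \o f) ->
  mu.-integrable setT (EFin \o (f \_ `[0, L])).
Proof.
by rewrite -restrict_EFin => fi; apply: (integrable_mkcond _ _).1.
Qed.

Lemma primitive_sub L F f x y : primitive_on L F f ->
  0 <= x -> x <= y -> y <= L -> F y - F x = \int[mu]_(t in `[x, y]) f t.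
Proof.
move=> [fi Ff] x0 xy yL.
rewrite (Ff x) ?x0 ?(le_trans xy)// (Ff y) ?yL ?(le_trans x0)//.
rewrite opprD addrACA subrr add0r.
have fi' a b : 0 <= a -> b <= L -> mu.-integrable `[a, b] (EFin \o f).
  move=> a0 bL; apply: integrableS fi => //; apply: subset_itv; rewrite bnd_simp//.
rewrite Rintegral_itvB ?bnd_simp//; last by apply: fi'.
by rewrite Rintegral_itv_obnd_cbnd//; apply: integrableS (fi' _ _ x0 yL) => //;
  apply: subset_itvr; rewrite bnd_simp.
Qed.

Lemma derive1_add_cst (F G : R -> R) (c x : R) : derivable G x 1 ->
  (\forall y \near x, F y = c + G y) -> derivable F x 1 /\ derive1 F x = derive1 G x.
Proof.
move=> dG FG; have dc : derivable (cst c) x (1 : R) by exact: derivable_cst.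
have dE := @deriveD _ _ _ (cst c) G x 1 dc dG.
split.
  apply: near_eq_derivable (derivableD dc dG).
  by apply: filterS FG => y ->.
rewrite !derive1E (near_eq_derive (g := cst c + G))//.
by rewrite dE derive_cst add0r.
Qed.

(** Lebesgue's differentiation theorem, applied to the extension of [f] by zero. *)
Lemma primitive_ae_derive L F f : primitive_on L F f ->
  {ae mu, forall x, x \in `]0, L[ -> derivable F x 1 /\ derive1 F x = f x}.
Proof.
move=> [fi Ff].
have gi : mu.-integrable setT (EFin \o (f \_ `[0, L])).
  exact: integrable_patch.
have /= := @FTC1 R (f \_ `[0, L]) (BLeft 0).
have gy y : mu.-integrable `[0, y] (EFin \o (f \_ `[0, L])).
  by apply: integrableS gi.
move=> /(_ gy).
move=> /(_ (integrable_locally (measurable_itv _) fi)).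
apply: filterS; first exact: (ae_filter_ringOfSetsType mu).
move=> x H x0L.
have /andP[x0 xL] : (0 < x) && (x < L) by move: x0L; rewrite in_itv.
have [] := H; first by rewrite lte_fin.
set G := (fun _ => _) => dG G'.
have FG : \forall y \near x, F y = F 0 + G y.
  near=> y.
  have y0 : 0 < y by near: y; exact: lt_nbhsr.
  have yL : y < L by near: y; exact: lt_nbhsl.
  rewrite Ff ?ltW//; congr (_ + _); rewrite /G.
  apply: eq_Rintegral => t; rewrite inE/= in_itv/= => /andP[t0 ty].
  by rewrite patchE mem_set//= in_itv/= t0 (le_trans ty)// ltW.
have [dF ->] := derive1_add_cst dG FG; split => //.
rewrite G' patchE mem_set//=.
by rewrite in_itv/= !ltW.
Unshelve. all: by end_near. Qed.

Lemma primitive_abs_cont L F f : primitive_on L F f -> Rabs_cont `[0, L] F.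
Proof.
move=> Ff; have [fi _] := Ff.
have gi := integrable_patch fi.
move=> e e0; have [d [d0 H]] := integral_normr_continuous gi e0.
exists d => // n a b abI tI sd.
pose I (k : 'I_n) : set R := `]a k, b k[%classic.
have mI k : measurable (I k) by exact: measurable_itv.
have ab k : a k <= b k by have [] := abI k.
pose U := \big[setU/set0]_(k < n) I k.
have mU : measurable U by exact: bigsetU_measurable.
have muI k : mu (I k) = (b k - a k)%:E.
  rewrite lebesgue_measure_itv/= lte_fin -EFinB; case: ltP => // ba.
  by rewrite (@le_anti _ _ (a k) (b k)) ?subrr// ab.
have muU : (mu U < d%:E)%E.
  rewrite measure_bigsetU_ord//.
  rewrite [ltLHS](_ : _ = \sum_(k < n) (b k - a k)%:E)%E.
    by rewrite sumEFin lte_fin.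
  by apply: eq_bigr => k _; exact: muI.
apply: le_lt_trans (H _ mU muU).
set g := f \_ `[0, L] in gi H *.
have ngi : mu.-integrable setT (EFin \o (fun x => `|g x|)).
  exact: integrable_norm.
have -> : \int[mu]_(x in U) `|g x| = \sum_(k < n) \int[mu]_(x in I k) `|g x|.
  have E : (\int[mu]_(x in U) (`|g x|)%:E =
      \sum_(k < n) \int[mu]_(x in I k) (`|g x|)%:E)%E.
    apply: (@integral_bigsetU_EFin _ _ _ mu _ I) => //.
    - exact: index_enum_uniq.
    - exact: sub_trivIset tI.
    - by apply: measurable_funS (measurable_int _ ngi).
  rewrite /Rintegral E -sum_fine// => k _; apply: integrable_fin_num; first exact: mI.
  by apply: (integrableS _ _ _ ngi) => //; exact: mI.
apply: ler_sum => k _.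
have [ak bk _] := abI k.
move: ak bk; rewrite !in_itv/= => /andP[a0 aL] /andP[b0 bL].
rewrite (primitive_sub Ff)//.
have -> : \int[mu]_(t in `[a k, b k]) f t = \int[mu]_(t in I k) g t.
  rewrite /I Rintegral_itv_bndo_bndc; last by apply: (integrableS _ _ _ gi).
  rewrite Rintegral_itv_obnd_cbnd; last by apply: (integrableS _ _ _ gi).
  apply: eq_Rintegral => t; rewrite inE/= in_itv/= => /andP[t0 ty].
  by rewrite /g patchE mem_set//= in_itv/= (le_trans a0)// (le_trans ty).
apply: le_normr_Rintegral; first exact: mI.
by apply: (integrableS _ _ _ gi) => //; exact: mI.
Qed.

Lemma disjoint_itv_separated (a b c d : R) : a < b -> c < d ->
  `]a, b[ `&` `]c, d[ = set0 -> (b <= c) || (d <= a).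
Proof.
move=> ab cd; rewrite -subset0 => H; case: leP => //= h1; case: leP => //= h2.
have lohi : Num.max a c < Num.min b d by rewrite gt_max !lt_min ab cd h1 h2.
have := midf_lt lohi; set m := (_ / _) => -[].
rewrite gt_max lt_min => /andP[m1 m2] /andP[m3 m4].
by case: (H m); split; rewrite /= in_itv/= ?m1 ?m2.
Qed.

Definition clamp (a b x : R) : R := Num.min (Num.max a x) b.

Lemma clamp_id a b x : a <= x <= b -> clamp a b x = x.
Proof. by move=> /andP[ax xb]; rewrite /clamp max_r// min_l. Qed.

Lemma clamp_in a b x : a <= b -> a <= clamp a b x <= b.
Proof. by move=> ab; rewrite /clamp le_min le_max lexx ab/= ge_min lexx orbT. Qed.

Lemma clamp_homo a b : {homo clamp a b : x y / x <= y}.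
Proof.
move=> x y xy; rewrite /clamp le_min ge_min ge_min lexx orbT andbT.
by rewrite ge_max le_max le_max lexx xy/= orbT.
Qed.

Lemma clamp_lip a b x y : x <= y -> clamp a b y - clamp a b x <= y - x.
Proof.
move=> xy; rewrite /clamp; case: (leP a x) => x0; case: (leP a y) => y0;
  case: (leP x b) => xL; case: (leP y b) => yL; case: (leP a b) => l0; lra.
Qed.

Lemma Rabs_cont_comp (I J : interval R) F (c : R -> R) : Rabs_cont I F ->
  {homo c : x y / x <= y} -> (forall x y, x <= y -> c y - c x <= y - x) ->
  (forall x, x \in J -> c x \in I) -> Rabs_cont J (F \o c).
Proof.
move=> acF c_homo c_lip cIJ e e0; have [d d0 H] := acF e e0.
exists d => // n a b ab tI sd.
apply: (H n (fun k => c (a k)) (fun k => c (b k))).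
- by move=> k; have [ak bk abk] := ab k; rewrite !cIJ//; split=> //; exact: c_homo.
- apply/trivIsetP => i j _ _ ij; rewrite -subset0 => t [/=].
  rewrite !in_itv/= => /andP[ti it_] /andP[tj jt].
  have lt_of_c u v : c u < c v -> u < v.
    by move=> cuv; rewrite ltNge; apply/negP => /c_homo; rewrite leNgt cuv.
  have abi := lt_of_c _ _ (lt_trans ti it_).
  have abj := lt_of_c _ _ (lt_trans tj jt).
  move/trivIsetP : tI => /(_ i j Logic.I Logic.I ij).
  move=> /(disjoint_itv_separated abi abj) /orP[] /c_homo h.
    by have := lt_trans (lt_le_trans it_ h) tj; rewrite ltxx.
  by have := lt_trans (lt_le_trans jt h) ti; rewrite ltxx.
- apply: le_lt_trans sd; apply: ler_sum => k _; apply: c_lip.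
  by have [] := ab k.
Qed.

(** Finite families of intervals are encoded as sequences of pairs of endpoints, in which an
    interval can be replaced by the intervals of a partition of it. *)
Definition separated (I J : R * R) := (I.2 <= J.1) || (J.2 <= I.1).

Definition seq_abs_cont F := forall e : R, 0 < e -> exists2 d : R, 0 < d &
  forall l : seq (R * R), all (fun I => I.1 <= I.2) l -> pairwise separated l ->
    \sum_(I <- l) (I.2 - I.1) < d -> \sum_(I <- l) `|F I.2 - F I.1| < e.

Lemma Rabs_cont_seq F : Rabs_cont `]-oo, +oo[ F -> seq_abs_cont F.
Proof.
move=> acF e e0; have [d d0 H] := acF e e0; exists d => // l /allP hl pl sd.
pose a (k : 'I_(size l)) := (nth (0, 0) l k).1.
pose b (k : 'I_(size l)) := (nth (0, 0) l k).2.
have := H (size l) a b; rewrite (big_nth (0, 0)) big_mkord; apply => //.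
- by move=> k; rewrite !in_itv; split=> //; apply: hl; rewrite mem_nth.
- apply/trivIsetP => i j _ _ ij; rewrite -subset0 => x [].
  have sep (u v : 'I_(size l)) : (u < v)%N -> separated (a u, b u) (a v, b v).
    move=> uv; move/(pairwiseP (0, 0)): pl.
    by move=> /(_ u v); rewrite !inE !ltn_ord => /(_ isT isT uv).
  have key (u v : 'I_(size l)) : separated (a u, b u) (a v, b v) ->
      x \in `]a u, b u[ -> x \in `]a v, b v[ -> False.
    rewrite /separated/= !in_itv/= => /orP[]h /andP[h1 h2] /andP[h3 h4].
      by have := lt_trans h3 (lt_le_trans h2 h); rewrite ltxx.
    by have := lt_trans h4 (le_lt_trans h h1); rewrite ltxx.
  move=> xi xj; have : (i != j :> nat) by [].
  rewrite neq_ltn => /orP[/sep|/sep] h; first exact: (key i j).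
  exact: (key j i).
- by move: sd; rewrite (big_nth (0, 0)) big_mkord.
Qed.

Lemma itv_partition_pairs a b s : itv_partition a b s ->
  let l := zip (a :: s) s in
  [/\ all (fun I => I.1 <= I.2) l, pairwise separated l,
    {in l, forall I, a <= I.1 /\ I.2 <= b} &
    \sum_(I <- l) (I.2 - I.1) = b - a].
Proof.
elim: s a => [|c s ih] a.
  by move=> /itv_partition_nil ->; rewrite /= big_nil subrr.
move=> abs; have := itv_partition_cons abs => /[dup] cbs /ih /= [h1 h2 h3 h4].
have /andP[ac _] : path <%R a (c :: s) by case: abs.
have cb := itv_partition_le cbs.
split => /=.
- by rewrite (ltW ac).
- rewrite h2 andbT; apply/allP => I /h3 [h _].
  by rewrite /separated/= h.
- move=> I; rewrite inE => /predU1P[-> //|/h3[? ?]]; split => //.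
  exact: le_trans (ltW ac) _.
- by rewrite big_cons/= h4 addrC addrA subrK.
Qed.

Lemma variation_pairs a b s F : itv_partition a b s ->
  variation a b F s = \sum_(I <- zip (a :: s) s) `|F I.2 - F I.1|.
Proof.
move=> abs; rewrite variation_zip//.
have : forall t t' : seq R, \sum_(x <- zip t t') `|F x.1 - F x.2| =
    \sum_(I <- zip t' t) `|F I.2 - F I.1|.
  by elim=> [|x t ih] [|y t']; rewrite /= ?big_nil// !big_cons ih.
by move=> ->.
Qed.

Lemma pairwise_separated_refine (l1 l2 m : seq (R * R)) a b :
  pairwise separated (l1 ++ (a, b) :: l2) -> pairwise separated m ->
  {in m, forall I, a <= I.1 /\ I.2 <= b} ->
  pairwise separated (l1 ++ m ++ l2).
Proof.
have sepC : symmetric separated by move=> I J; rewrite /separated orbC.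
have sub I J : a <= J.1 /\ J.2 <= b -> separated I (a, b) -> separated I J.
  move=> [aJ Jb]; rewrite /separated/= => /orP[h|h].
    by rewrite (le_trans h aJ).
  by rewrite (le_trans Jb h) orbT.
rewrite !pairwise_cat !pairwise_cons allrel_consr !allrel_catr.
move=> /and3P[/andP[/allP l1ab l1l2] pl1 /andP[/allP abl2 pl2]] pm mab.
rewrite l1l2 pl1 pl2 pm !andbT/= ; apply/andP; split.
  by apply/allrelP => I J Il1 Jm; apply: sub (l1ab _ Il1); exact: mab.
apply/allrelP => I J Im Jl2; rewrite sepC; apply: (sub _ _ (mab _ Im)).
by rewrite sepC abl2.
Qed.

(** Passing from increments to total variations: refine the intervals of the family one after
    another and take suprema. *)
Lemma seq_abs_cont_variation F (e d : R) :
  (forall l : seq (R * R), all (fun I => I.1 <= I.2) l ->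
    pairwise separated l -> \sum_(I <- l) (I.2 - I.1) < d ->
    \sum_(I <- l) `|F I.2 - F I.1| <= e) ->
  forall l : seq (R * R), all (fun I => I.1 <= I.2) l ->
    pairwise separated l -> \sum_(I <- l) (I.2 - I.1) < d ->
    (\sum_(I <- l) total_variation I.1 I.2 F <= e%:E)%E.
Proof.
move=> H.
suff K : forall l2 l1 : seq (R * R), all (fun I => I.1 <= I.2) (l1 ++ l2) ->
    pairwise separated (l1 ++ l2) -> \sum_(I <- l1 ++ l2) (I.2 - I.1) < d ->
    (\sum_(I <- l2) total_variation I.1 I.2 F
      <= (e - \sum_(I <- l1) `|F I.2 - F I.1|)%:E)%E.
  by move=> l al pl sl; have := K l [::] al pl sl; rewrite big_nil subr0.
elim=> [|[a b] l2 ih] l1.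
  by rewrite cats0 big_nil lee_fin subr_ge0; exact: H.
rewrite all_cat/= => /and3P[al1 ab al2] pl sl.
rewrite big_cons/=.
set S := (\sum_(I <- l2) _)%E.
have step s : itv_partition a b s ->
    ((variation a b F s)%:E + S <= (e - \sum_(I <- l1) `|F I.2 - F I.1|)%:E)%E.
  move=> abs; have [h1 h2 h3 h4] := itv_partition_pairs abs.
  have := ih (l1 ++ zip (a :: s) s).
  rewrite -catA !all_cat al1 h1 al2 (pairwise_separated_refine pl h2 h3).
  move: sl; rewrite !big_cat/= big_cons/= h4 => sl /(_ isT isT sl).
  rewrite -(variation_pairs _ abs) -/S opprD addrA.
  rewrite [X in (_ <= X)%E -> _]EFinB leeBrDr//.
  by rewrite addeC.
have S_fin : S \is a fin_num.
  have S0 : (0 <= S)%E.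
    rewrite /S big_seq; apply: sume_ge0 => I Il2; apply: total_variation_ge0.
    exact: (allP al2).
  rewrite ge0_fin_numE//.
  have /step : itv_partition a b (if a < b then [:: b] else [::]).
    case: ifPn => [|/negP ba]; first exact: itv_partition1.
    by split => //=; rewrite eq_le ab leNgt; apply/negP.
  move=> /(le_trans (leeDr _ _))/le_lt_trans; apply; rewrite ?ltry//.
  by rewrite lee_fin variation_ge0.
rewrite -leeBrDr//; apply: ge_ereal_sup => _ [_ [s abs <-] <-].
by rewrite leeBrDr//; exact: step.
Qed.

End Primitive.

Section Stieltjes.
Context {R : realType}.
Local Notation mu := (@lebesgue_measure R).
Implicit Types (L x y : R) (F G f g : R -> R).

Lemma open_finite_interval (I : set R) : open I -> is_interval I ->
  (mu I < +oo)%E -> exists p : R * R, I = `]p.1, p.2[%classic.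
Proof.
move=> oI iI Ifin; have IE : [set` Rhull I] = I := RhullK (mem_set iI).
have {oI}IE' : I = interior [set` Rhull I] by rewrite IE (interior_id I).1.
have [I0|/set0P I0] := eqVneq I set0.
  by exists (0, 0); rewrite I0 set_itvoo0.
move: I0 Ifin; rewrite {3}IE' -{1 2}IE lebesgue_measure_itv {IE IE' iI}.
case: (Rhull I) => [[b1 a|[]] [b2 b|[]]]/=.
- by rewrite interior_itv_bnd; exists (a, b).
all: try by move=> [x] /=; rewrite in_itv/= ?andbF.
all: by rewrite ?ltry ?ltNyr ?ltNyy /= ?addye ?addeNy ?oppeE/= ?ltxx.
Qed.

Lemma seq_abs_cont_right_continuous V x : seq_abs_cont V -> V y @[y --> x^'+] --> V x.
Proof.
move=> acV; apply/cvgrPdist_lt => e e0; have [d d0 H] := acV e e0.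
near=> y.
have xy : x < y by near: y; exact: nbhs_right_gt.
have := H [:: (x, y)]; rewrite /= !big_seq1/= distrC; apply => //.
  by rewrite (ltW xy).
by rewrite ltrBlDl; near: y; apply: nbhs_right_lt; rewrite ltrDl.
Unshelve. all: by end_near. Qed.

Section Nondecreasing.
Variables (L : R) (V : R -> R).
Hypotheses (L0 : 0 <= L) (ndV : {homo V : x y / x <= y}) (acV : seq_abs_cont V).

Let C : cumulative R R := HB.pack V (@isCumulative.Build R _ R V ndV
  (fun x => @seq_abs_cont_right_continuous V x acV)).

Let nu : {measure set (measurableTypeR R) -> \bar R} :=
  lebesgue_stieltjes_measure C.

Let nu_itv a b : a <= b -> nu `]a, b]%classic = (V b - V a)%:E.
Proof.
move=> ab; transitivity (wlength C `]a, b]%classic).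
  apply: (measurable_mu_extE (wlength C)); exact: is_ocitv.
by rewrite wlength_itv_bnd.
Qed.

Let D : set R := `]0, L]%classic.

Let mD : measurable (D : set (measurableTypeR R)). Proof. exact: measurable_itv. Qed.

Let nuD : (nu D < +oo)%E. Proof. by rewrite nu_itv// ltry. Qed.

(** The components of an open set of small length form a family of intervals of small total
    length, on which the increments of [V] add up to little. *)
Let nu_open (e d : R) (U : set R) : 0 < e ->
  (forall l : seq (R * R), all (fun I => I.1 <= I.2) l ->
    pairwise separated l -> \sum_(I <- l) (I.2 - I.1) < d ->
    \sum_(I <- l) `|V I.2 - V I.1| < e) ->
  open U -> (mu U < d%:E)%E -> (nu U <= e%:E)%E.
Proof.
move=> e0 H oU Ud.
pose I := open_disjoint_itv oU.
have mI i : measurable (I i : set (measurableTypeR R)).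
  by apply: open_measurable; exact: open_disjoint_itv_open.
have tI : trivIset setT I by exact: open_disjoint_itv_trivIset.
have UI : U = \bigcup_i I i by exact: open_disjoint_itv_bigcup.
have IU i : I i `<=` U by rewrite UI; exact: bigcup_sup.
have mU : measurable (U : set (measurableTypeR R)) by exact: open_measurable.
have /choice[p Ip] : forall i, exists p : R * R, I i = `]p.1, p.2[%classic.
  move=> i; apply: open_finite_interval.
  - exact: open_disjoint_itv_open.
  - exact: open_disjoint_itv_is_interval.
  - apply: (@le_lt_trans _ _ (mu U)); last by rewrite (lt_trans Ud)// ltry.
    by apply: le_measure; rewrite ?inE.
have sumI (m : {measure set (measurableTypeR R) -> \bar R}) :
    m U = (\sum_(i <oo) m (I i))%E.
  by rewrite {1}UI measure_semi_bigcup// -UI.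
have -> : nu U = (\sum_(i <oo) nu (I i))%E.
  exact: (sumI nu).
apply: lime_le; first by apply: is_cvg_nneseries => *; exact: measure_ge0.
apply: nearW => n.
have index_iotaE : index_iota 0 n = iota 0 n by rewrite /index_iota subn0.
pose l := [seq p i | i <- [seq i <- iota 0 n | (p i).1 < (p i).2]].
have nuI i : (nu (I i) <= (V (p i).2 - V (p i).1)%:E)%E \/ I i = set0.
  case: (ltP (p i).1 (p i).2) => pi; last first.
    by right; rewrite Ip set_itv_ge// bnd_simp -leNgt.
  left; rewrite -(nu_itv (ltW pi)); apply: (le_measure nu); rewrite ?inE//.
  by rewrite Ip; apply: subset_itvl; rewrite bnd_simp.
apply: (@le_trans _ _ (\sum_(J <- l) `|V J.2 - V J.1|)%:E).
  rewrite /l big_map big_filter -sumEFin -index_iotaE.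
  rewrite [leRHS]big_mkcond/= !big_mkord; apply: lee_sum => i _.
  case: ifPn => pi.
    have [|] := nuI i; last by move=> ->; rewrite measure0 lee_fin.
    move=> h; apply: (le_trans h); rewrite lee_fin; exact: ler_norm.
  by rewrite [I _]Ip set_itv_ge ?measure0// bnd_simp.
rewrite lee_fin ltW//; apply: H.
- by rewrite all_map; apply/allP => i; rewrite mem_filter => /andP[/ltW].
- rewrite pairwise_map; apply: (@sub_in_pairwise _ (fun i => (p i).1 < (p i).2)
      (fun i j => i != j)).
  + move=> i j; rewrite !unfold_in /separated => pi pj ij /=.
    apply: (disjoint_itv_separated pi pj); rewrite -!Ip.
    by have /trivIsetP := tI; apply.
  + by apply: filter_all.
  + by rewrite -uniq_pairwise filter_uniq// iota_uniq.
- rewrite -lte_fin; apply: le_lt_trans Ud.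
  have -> : mu U = (\sum_(i <oo) mu (I i))%E by exact: (sumI mu).
  apply: le_trans (@nneseries_lim_ge _ _ xpredT 0%N n _) => //.
  rewrite /l big_map big_filter -sumEFin -index_iotaE.
  rewrite [leLHS]big_mkcond/= !big_mkord; apply: lee_sum => i _.
  rewrite Ip; case: ifPn => pi //=.
  by rewrite lebesgue_measure_itv/= lte_fin pi EFinB.
Qed.

Let nuf : {finite_measure set (measurableTypeR R) -> \bar R} := mfrestr mD nuD.

Let nu_dom : charge_of_finite_measure nuf `<< mu.
Proof.
apply/null_content_dominatesP => A mA A0.
apply/eqP; rewrite eq_le; apply/andP; split; last exact: measure_ge0.
apply/lee_addgt0Pr => e e0; rewrite add0e.
have [d d0 H] := acV e0.
have [|U [oU AU Ud]] := @lebesgue_regularity_outer R A d mA _ d0.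
  by rewrite A0 ltry.
have mU : measurable (U : set (measurableTypeR R)) by exact: open_measurable.
apply: (@le_trans _ _ (nu U)).
  apply: (le_measure nu); rewrite ?inE//; first exact: measurableI.
  by move=> x [/AU].
apply: (nu_open e0 H) => //.
apply: le_lt_trans Ud.
rewrite (_ : mu U = mu (U `\` A) + mu A)%E; last first.
  by rewrite -{1}(setDKU AU) measureU//; [exact: measurableD | exact: setDKI].
by rewrite A0 adde0.
Qed.

(** A null set lies in open sets of small length, so the Stieltjes measure of [V] does not
    charge it; the primitive is that of the Radon--Nikodym density. *)
Lemma nondecreasing_ac_primitive : exists f, primitive_on L V f.
Proof.
pose f := Radon_Nikodym (charge_of_finite_measure nuf) mu.
have fi : mu.-integrable setT f by exact: Radon_Nikodym_integrable.
have ff x : f x \is a fin_num by exact: Radon_Nikodym_fin_num.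
have fE : EFin \o (fine \o f) = f by apply/funext => x /=; rewrite fineK.
exists (fine \o f); split.
  by rewrite fE; apply: (integrableS _ _ _ fi).
move=> x /andP[x0 xL].
have : nu (`]0, x]%classic `&` D) = (\int[mu]_(t in `]0%R, x]) f t)%E.
  by rewrite -Radon_Nikodym_integral//; exact: measurable_itv.
rewrite setIidl; last by apply: subset_itvl; rewrite bnd_simp.
rewrite nu_itv// => Vf.
rewrite -Rintegral_itv_obnd_cbnd/= ?fE; last by apply: (integrableS _ _ _ fi).
rewrite /Rintegral.
rewrite [X in fine X](_ : _ = \int[mu]_(t in `]0%R, x]) f t)%E; last by rewrite -fE.
by rewrite -Vf/= addrC subrK.
Qed.

End Nondecreasing.
End Stieltjes.

Section LebesgueFTC.
Context {R : realType}.
Local Notation mu := (@lebesgue_measure R).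
Implicit Types (L x y : R) (F G f g : R -> R).

Lemma integrable_lin L f g (a b : R) : mu.-integrable `[0, L] (EFin \o f) ->
  mu.-integrable `[0, L] (EFin \o g) ->
  mu.-integrable `[0, L] (EFin \o (fun x => a * f x + b * g x)).
Proof.
move=> fi gi.
apply: (@integrableD _ _ _ mu `[0, L] _ (fun x => (a * f x)%:E)
  (fun x => (b * g x)%:E)) => //.
- by apply: (@integrableZl _ _ _ mu `[0, L] _ a (EFin \o f)).
- by apply: (@integrableZl _ _ _ mu `[0, L] _ b (EFin \o g)).
Qed.

Lemma integrable_sub0 L x f : x <= L -> mu.-integrable `[0, L] (EFin \o f) ->
  mu.-integrable `[0, x] (EFin \o f).
Proof.
move=> xL fi; apply: (integrableS _ _ _ fi) => //.
by apply: subset_itvl; rewrite bnd_simp.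
Qed.

Lemma primitive_lin L F G f g (a b : R) : primitive_on L F f ->
  primitive_on L G g ->
  primitive_on L (fun x => a * F x + b * G x) (fun x => a * f x + b * g x).
Proof.
move=> [fi Ff] [gi Gg]; split; first exact: integrable_lin.
move=> x /[dup] xL /andP[_ xL'].
rewrite (Ff x xL) (Gg x xL).
have fi' := integrable_sub0 xL' fi; have gi' := integrable_sub0 xL' gi.
rewrite RintegralD//.
- by rewrite !RintegralZl//; ring.
- by apply: (@integrableZl _ _ _ mu `[0, x] _ a (EFin \o f)).
- by apply: (@integrableZl _ _ _ mu `[0, x] _ b (EFin \o g)).
Qed.

Lemma primitive_ext L F G f : 0 <= L -> (forall x, 0 <= x <= L -> F x = G x) ->
  primitive_on L F f -> primitive_on L G f.
Proof.
move=> L0 FG [fi Ff]; split=> // x xL.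
by rewrite -!FG ?lexx// Ff.
Qed.

Lemma primitive_cst L (c : R) : primitive_on L (fun=> c) (fun=> 0).
Proof.
split; first exact: integrable0.
by move=> x _; rewrite /Rintegral integral0 addr0.
Qed.

Lemma primitive_bounded L F f : primitive_on L F f ->
  exists2 M, 0 <= M & forall x, 0 <= x <= L -> `|F x| <= M.
Proof.
move=> [fi Ff]; have nfi : mu.-integrable `[0, L] (EFin \o (fun x => `|f x|)).
  exact: integrable_norm.
exists (`|F 0| + \int[mu]_(t in `[0, L]) `|f t|).
  by apply: addr_ge0 => //; apply: Rintegral_ge0 => t _.
move=> x /[dup] xL /andP[x0 xL']; rewrite Ff//.
apply: (le_trans (ler_normD _ _)); rewrite lerD2l.
have fi' := integrable_sub0 xL' fi; have nfi' := integrable_sub0 xL' nfi.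
apply: (le_trans (le_normr_Rintegral _ _)) => //.
rewrite /Rintegral fine_le ?integrable_fin_num//.
apply: ge0_subset_integral => //.
- exact: measurable_int nfi.
- by apply: subset_itvl; rewrite bnd_simp.
Qed.

Section Extension.
Variables (L : R) (F : R -> R).
Hypotheses (L0 : 0 <= L) (acF : Rabs_cont `[0, L] F).

Let F1 x := F (clamp 0 L x).

Let F1_ac : Rabs_cont `]-oo, +oo[ F1.
Proof.
have in_L x : x \in `]-oo, +oo[ -> clamp 0 L x \in `[0, L].
  by move=> _; rewrite in_itv/= clamp_in.
exact: (Rabs_cont_comp acF (@clamp_homo _ _ _) (@clamp_lip _ _ _) in_L).
Qed.

Let F1_sac : seq_abs_cont F1. Proof. exact: Rabs_cont_seq. Qed.

Let TV_fin b : 0 <= b -> total_variation 0 b F1 \is a fin_num.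
Proof.
(* On intervals shorter than [d] the variation is at most 1, and finitely many of them cover
   [0, b]. *)
move=> b0; have [d d0 H] := F1_sac ltr01.
have H' l h1 h2 h3 := ltW (H l h1 h2 h3).
have step k : (total_variation 0 (d / 2 *+ k) F1 <= k%:R%:E)%E.
  elim: k => [|k ih]; first by rewrite mulr0n total_variationxx.
  have h0 : 0 <= d / 2 by rewrite divr_ge0// ltW.
  rewrite (@total_variationD _ _ _ (d / 2 *+ k)).
  - rewrite [X in (_ <= X)%E](_ : _ = (k%:R%:E + 1%:E)%E); last first.
      by rewrite -EFinD natr1.
    rewrite leeD//.
    have := seq_abs_cont_variation H' (l := [:: (d / 2 *+ k, d / 2 *+ k.+1)]).
    rewrite /= !big_seq1/= (mulrSr (d / 2)) lerDl h0; apply => //.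
    rewrite addrC addKr; lra.
  - by rewrite mulrn_wge0.
  - by rewrite (mulrSr (d / 2)) lerDl.
pose k := Num.bound (b / (d / 2)).
have bk : b <= d / 2 *+ k.
  rewrite -mulr_natr mulrC -ler_pdivrMr; last by rewrite divr_gt0.
  by rewrite ltW// archi_boundP// divr_ge0// divr_ge0// ltW.
rewrite ge0_fin_numE; last exact: total_variation_ge0.
apply: (@le_lt_trans _ _ (total_variation 0 (d / 2 *+ k) F1)).
  by rewrite (total_variationD F1 b0 bk) leeDl// total_variation_ge0.
by apply: (le_lt_trans (step k)); rewrite ltry.
Qed.

Let V x := fine (total_variation 0 (Num.max 0 x) F1).

Let V_sub x y : 0 <= x -> x <= y -> (V y - V x)%:E = total_variation x y F1.
Proof.
move=> x0 xy; have y0 := le_trans x0 xy.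
have := TV_fin y0; rewrite /V !max_r//.
rewrite (total_variationD F1 x0 xy) fin_numD => /andP[f1 f2].
by rewrite fineD// addrC addKr fineK.
Qed.

Let V_max x : V x = V (Num.max 0 x).
Proof. by rewrite /V [in RHS]max_r// le_max lexx. Qed.

Let F1_max x : F1 x = F1 (Num.max 0 x).
Proof. by rewrite /F1 /clamp [in RHS](max_r (x := 0))// le_max lexx. Qed.

Let max0_homo x y : x <= y -> Num.max 0 x <= Num.max 0 y.
Proof. by move=> xy; rewrite ge_max !le_max lexx xy/= orbT. Qed.

Let dF_dV x y : x <= y -> `|F1 y - F1 x| <= V y - V x.
Proof.
move=> xy; rewrite V_max [V x]V_max F1_max [F1 x]F1_max.
have xy' := max0_homo xy.
rewrite -lee_fin (V_sub _ xy'); last by rewrite le_max lexx.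
exact: total_variation_ge.
Qed.

Let V_homo : {homo V : x y / x <= y}.
Proof. by move=> x y /dF_dV /(le_trans (normr_ge0 _)); rewrite subr_ge0. Qed.

Let V_sac : seq_abs_cont V.
Proof.
move=> e e0; have e2 : 0 < e / 2 by rewrite divr_gt0.
have [d d0 H] := F1_sac e2; exists d => // l al pl sl.
have H' l' h1 h2 h3 := ltW (H l' h1 h2 h3).
pose m (I : R * R) := (Num.max 0 I.1, Num.max 0 I.2).
have al' : all (fun I => I.1 <= I.2) (map m l).
  rewrite all_map; apply/allP => I /(allP al) /=; exact: max0_homo.
have := seq_abs_cont_variation H' al'.
rewrite pairwise_map !big_map => K.
apply: (@le_lt_trans _ _ (e / 2)); last lra.
rewrite -lee_fin; apply: le_trans (K _ _).
- rewrite -sumEFin big_seq [leRHS]big_seq; apply: lee_sum => I /(allP al) /= I12.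
  rewrite -(V_sub _ (max0_homo I12)); last by rewrite le_max lexx.
  by rewrite -!V_max lee_fin ger0_norm// subr_ge0 V_homo.
- apply: sub_pairwise pl => I J; rewrite /separated/= => /orP[] /max0_homo -> //.
  by rewrite orbT.
- apply: le_lt_trans sl; rewrite big_seq [leRHS]big_seq; apply: ler_sum => I.
  move=> /(allP al) /=; case: (leP 0 I.1) => ?; case: (leP 0 I.2) => ? ?; lra.
Qed.

(** Jordan decomposition: [F] is the difference of its variation [V] and of [V - F], which are
    both nondecreasing and absolutely continuous. *)
Lemma abs_cont_primitive : exists f, primitive_on L F f.
Proof.
have W_homo : {homo (fun x => V x - F1 x) : x y / x <= y}.
  by move=> x y /dF_dV /(le_trans (ler_norm _)); lra.
have W_sac : seq_abs_cont (fun x => V x - F1 x).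
  move=> e e0; have e2 : 0 < e / 2 by rewrite divr_gt0.
  have [d1 d10 H1] := V_sac e2; have [d2 d20 H2] := F1_sac e2.
  exists (Num.min d1 d2); first by rewrite lt_min d10.
  move=> l al pl; rewrite lt_min => /andP[/(H1 l al pl) l1 /(H2 l al pl) l2].
  apply: (@le_lt_trans _ _ (\sum_(I <- l) `|V I.2 - V I.1| +
      \sum_(I <- l) `|F1 I.2 - F1 I.1|)); last lra.
  rewrite -big_split/=; apply: ler_sum => I _.
  rewrite [X in `|X|](_ : _ = (V I.2 - V I.1) - (F1 I.2 - F1 I.1)); last by ring.
  exact: ler_normB.
have [f1 Vf] := nondecreasing_ac_primitive L0 V_homo V_sac.
have [f2 Wf] := nondecreasing_ac_primitive L0 W_homo W_sac.
exists (fun x => 1 * f1 x + (-1) * f2 x).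
apply: primitive_ext (primitive_lin 1 (-1) Vf Wf) => //.
by move=> x xL; rewrite /F1 clamp_id//; ring.
Qed.

End Extension.

Lemma primitive_ae_eq L F f g : primitive_on L F f ->
  mu.-integrable `[0, L] (EFin \o g) ->
  {ae mu, forall x, x \in `]0, L[ -> f x = g x} -> primitive_on L F g.
Proof.
move=> [fi Ff] gi fg; split=> // x /[dup] xL /andP[x0 xL']; rewrite Ff//; congr (_ + _).
rewrite -(Rintegral_itv_obnd_cbnd (r := 0)); last first.
  by apply: (integrableS _ _ _ fi) => //; apply: subset_itv; rewrite bnd_simp.
rewrite -[RHS](Rintegral_itv_obnd_cbnd (r := 0)); last first.
  by apply: (integrableS _ _ _ gi) => //; apply: subset_itv; rewrite bnd_simp.
rewrite -Rintegral_itv_bndo_bndc; last first.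
  by apply: (integrableS _ _ _ fi) => //; apply: subset_itv; rewrite bnd_simp.
rewrite -[RHS]Rintegral_itv_bndo_bndc; last first.
  by apply: (integrableS _ _ _ gi) => //; apply: subset_itv; rewrite bnd_simp.
rewrite /Rintegral; congr fine; apply: ae_eq_integral => //.
- by apply: measurable_funS (measurable_int _ fi) => //; apply: subset_itv; rewrite bnd_simp.
- by apply: measurable_funS (measurable_int _ gi) => //; apply: subset_itv; rewrite bnd_simp.
- apply: filterS fg; first exact: (ae_filter_ringOfSetsType mu).
  move=> t h; rewrite /= in_itv/= => /andP[t0 tx].
  by rewrite h// in_itv/= t0 (lt_le_trans tx).
Qed.

(** [F] is the primitive of some function, which is almost everywhere its derivative by
    Lebesgue's differentiation theorem. *)
Lemma abs_cont_ftc L F g : 0 <= L -> Rabs_cont `[0, L] F ->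
  mu.-integrable `[0, L] (EFin \o g) ->
  {ae mu, forall x, x \in `]0, L[ -> derive1 F x = g x} -> primitive_on L F g.
Proof.
move=> L0 acF gi Fg; have [f Ff] := abs_cont_primitive L0 acF.
apply: (primitive_ae_eq Ff gi); move: (primitive_ae_derive Ff) Fg.
apply: filterS2; first exact: (ae_filter_ringOfSetsType mu).
by move=> x h1 h2 xL; rewrite -h2//; have [_ ->] := h1 xL.
Qed.

End LebesgueFTC.

(** * Calculus of primitives and Gronwall's inequality *)

Section Calculus.
Context {R : realType}.
Local Notation mu := (@lebesgue_measure R).
Implicit Types (L x y : R) (F G f g : R -> R).

Lemma Rabs_cont_uniform (I : interval R) F (e : R) : Rabs_cont I F -> 0 < e ->
  exists2 d : R, 0 < d &
    forall x y, x \in I -> y \in I -> `|x - y| < d -> `|F x - F y| < e.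
Proof.
move=> acF e0; have [d d0 H] := acF e e0; exists d => //.
suff K x y : x \in I -> y \in I -> x <= y -> y - x < d -> `|F y - F x| < e.
  move=> x y xI yI; case: (leP x y) => xy.
    by rewrite distrC ger0_norm ?subr_ge0// (distrC (F x)); exact: K.
  by rewrite ger0_norm ?subr_ge0 ?ltW//; apply: K => //; exact: ltW.
move=> xI yI xy yxd; have := H 1%N (fun=> x) (fun=> y); rewrite !big_ord1; apply => //.
by apply/trivIsetP => i j _ _; rewrite !ord1 eqxx.
Qed.

Lemma Rabs_cont_continuous L F : Rabs_cont `[0, L] F ->
  {within `[0, L], continuous F}.
Proof.
move=> acF; apply/subspace_continuousP => x Ax.
apply/cvgrPdist_lt => e e0; have [d d0 H] := Rabs_cont_uniform acF e0.
rewrite near_withinE; near=> y => Ay; apply: H => //.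
Unshelve. all: by end_near. Qed.

Lemma primitive_continuous L F f : primitive_on L F f ->
  {within `[0, L], continuous F}.
Proof. by move/primitive_abs_cont/Rabs_cont_continuous. Qed.

Lemma primitive_measurable L F f : primitive_on L F f ->
  measurable_fun `[0, L] F.
Proof.
move=> /primitive_continuous cF.
by apply: subspace_continuous_measurable_fun => //; exact: measurable_itv.
Qed.

Lemma integrable_mul_bounded L (h g : R -> R) (M : R) :
  measurable_fun `[0, L] h -> (forall x, 0 <= x <= L -> `|h x| <= M) ->
  mu.-integrable `[0, L] (EFin \o g) ->
  mu.-integrable `[0, L] (EFin \o (fun x => h x * g x)).
Proof.
move=> mh hM gi.
apply: (@integrableMr _ _ _ mu _ (measurable_itv _) h (EFin \o g)) => //.
exists M; split; first exact: num_real.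
move=> M' MM' x /=; rewrite in_itv => /hM h'; exact: le_trans h' (ltW MM').
Qed.

Lemma integrable_mul_primitive L F f g : primitive_on L F f ->
  mu.-integrable `[0, L] (EFin \o g) ->
  mu.-integrable `[0, L] (EFin \o (fun x => F x * g x)).
Proof.
move=> Ff gi; have [M _ FM] := primitive_bounded Ff.
exact: integrable_mul_bounded (primitive_measurable Ff) FM gi.
Qed.

Lemma Rabs_cont_mul L F G (M : R) : 0 <= M ->
  (forall x, 0 <= x <= L -> `|F x| <= M) -> (forall x, 0 <= x <= L -> `|G x| <= M) ->
  Rabs_cont `[0, L] F -> Rabs_cont `[0, L] G ->
  Rabs_cont `[0, L] (fun x => F x * G x).
Proof.
move=> M0 FM GM acF acG e e0.
pose e' := e / (2 * (M + 1)).
have e'0 : 0 < e' by rewrite divr_gt0// mulr_gt0// ltr_wpDl.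
have [d1 d10 H1] := acF e' e'0; have [d2 d20 H2] := acG e' e'0.
exists (Num.min d1 d2); first by rewrite lt_min d10.
move=> n a b ab tI; rewrite lt_min => /andP[/(H1 _ _ _ ab tI) l1 /(H2 _ _ _ ab tI) l2].
apply: (@le_lt_trans _ _ ((M + 1) * (\sum_(k < n) `|F (b k) - F (a k)| +
    \sum_(k < n) `|G (b k) - G (a k)|))).
  rewrite -big_split/= mulr_sumr; apply: ler_sum => k _.
  have [+ + _] := ab k; rewrite !in_itv/= => /GM Ga /FM Fb.
  rewrite [X in `|X|](_ : _ = F (b k) * (G (b k) - G (a k)) +
    G (a k) * (F (b k) - F (a k))); last by ring.
  apply: (le_trans (ler_normD _ _)); rewrite !normrM addrC mulrDr.
  by apply: lerD; apply: ler_wpM2r => //; lra.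
have -> : e = (M + 1) * (e' + e') by rewrite /e'; field; lra.
by rewrite ltr_pM2l; [exact: ltrD | lra].
Qed.

(** A product of absolutely continuous functions is absolutely continuous, and the product
    rule holds wherever both factors are differentiable. This is the form in which integration
    by parts is used. *)
Lemma primitive_mul L F G f g : 0 <= L -> primitive_on L F f ->
  primitive_on L G g ->
  primitive_on L (fun x => F x * G x) (fun x => F x * g x + G x * f x).
Proof.
move=> L0 Ff Gg; have [[fi _] [gi _]] := (Ff, Gg).
have [M1 M10 FM] := primitive_bounded Ff; have [M2 M20 GM] := primitive_bounded Gg.
apply: abs_cont_ftc => //.
- apply: (@Rabs_cont_mul _ _ _ (M1 + M2)); rewrite ?addr_ge0//.
  + by move=> x /FM; lra.
  + by move=> x /GM; lra.
  + exact: primitive_abs_cont Ff.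
  + exact: primitive_abs_cont Gg.
- have h1 := integrable_mul_primitive Ff gi; have h2 := integrable_mul_primitive Gg fi.
  have := integrable_lin 1 1 h1 h2.
  by apply: eq_integrable => //= x _; rewrite !mul1r.
- move: (primitive_ae_derive Ff) (primitive_ae_derive Gg).
  apply: filterS2; first exact: (ae_filter_ringOfSetsType mu).
  move=> x h1 h2 xL; have [dF <-] := h1 xL; have [dG <-] := h2 xL.
  rewrite !derive1E (_ : (fun x => F x * G x) = F \* G)//.
  by rewrite deriveM.
Qed.

Lemma expR_lip (M x y : R) : x <= M -> y <= M ->
  `|expR x - expR y| <= expR M * `|x - y|.
Proof.
suff K u v : v <= M -> u <= v -> expR v - expR u <= expR M * (v - u).
  move=> xM yM; case: (leP x y) => xy.
    rewrite distrC ger0_norm ?subr_ge0 ?ler_expR// distrC ger0_norm ?subr_ge0//.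
    exact: K.
  have {}xy := ltW xy.
  by rewrite ger0_norm ?subr_ge0 ?ler_expR// ger0_norm ?subr_ge0//; exact: K.
move=> vM uv; have := expR_ge1Dx (u - v) => h.
have -> : expR v - expR u = expR v * (1 - expR (u - v)).
  by rewrite mulrBr mulr1 -expRD; congr (_ - expR _); ring.
apply: (@le_trans _ _ (expR v * (v - u))).
  by apply: ler_wpM2l; [exact: expR_ge0 | lra].
by apply: ler_wpM2r; [lra | rewrite ler_expR].
Qed.

Lemma primitive_expR L P p : 0 <= L -> primitive_on L P p ->
  primitive_on L (fun x => expR (P x)) (fun x => expR (P x) * p x).
Proof.
move=> L0 Pp; have [pi _] := Pp; have [M M0 PM] := primitive_bounded Pp.
have PM' x : 0 <= x <= L -> P x <= M.
  by move=> /PM; apply: le_trans; exact: ler_norm.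
have acE : Rabs_cont `[0, L] (fun x => expR (P x)).
  move=> e e0; have e'0 : 0 < e / expR M by rewrite divr_gt0// expR_gt0.
  have [d d0 H] := primitive_abs_cont Pp e'0; exists d => // n a b ab tI sd.
  have {H} := H n a b ab tI sd; rewrite ltr_pdivlMr ?expR_gt0//.
  apply: le_lt_trans; rewrite mulrC mulr_sumr; apply: ler_sum => k _.
  by have [+ + _] := ab k; rewrite !in_itv/= => /PM' ? /PM' ?; exact: expR_lip.
apply: abs_cont_ftc => //.
- apply: (@integrable_mul_bounded _ _ _ (expR M)) => //.
  + apply: subspace_continuous_measurable_fun; first exact: measurable_itv.
    exact: Rabs_cont_continuous.
  + by move=> x /PM' h; rewrite ger0_norm ?expR_ge0// ler_expR.
- move: (primitive_ae_derive Pp).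
  apply: filterS; first exact: (ae_filter_ringOfSetsType mu).
  move=> x h xL; have [dP <-] := h xL.
  rewrite (_ : (fun x => expR (P x)) = expR \o P)//.
  by rewrite derive1_comp// (derive1E expR) derive_val.
Qed.

(** The weight of the Bielecki norm: integration of [p] against [E] reproduces [E] with the
    factor [1/2], which turns Volterra integral operators with kernel bounded by [p] into
    contractions. *)
Lemma exp_weight L P p : 0 <= L -> primitive_on L P p -> P 0 = 0 ->
  (forall x, 0 <= p x) ->
  let E x := expR (2 * P x) in
  [/\ primitive_on L E (fun x => E x * (2 * p x)),
    forall x, 0 <= x <= L -> 1 <= E x &
    forall x, 0 <= x <= L -> \int[mu]_(t in `[0, x]) (E t * p t) = (E x - 1) / 2].
Proof.
move=> L0 Pp P0 p0 E; have [pi Pi] := Pp.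
have P_ge0 x : 0 <= x <= L -> 0 <= P x.
  by move=> xL; rewrite Pi// P0 add0r; apply: Rintegral_ge0 => t _.
have P2 : primitive_on L (fun x => 2 * P x) (fun x => 2 * p x).
  have := primitive_lin 2 0 Pp Pp.
  rewrite (_ : (fun x => 2 * P x + 0 * P x) = (fun x => 2 * P x)).
    by rewrite (_ : (fun x => 2 * p x + 0 * p x) = (fun x => 2 * p x))//; apply/funext => x; ring.
  by apply/funext => x; ring.
have EP := primitive_expR L0 P2.
have E1 x : 0 <= x <= L -> 1 <= E x.
  by move=> /P_ge0 h; rewrite /E -expR0 ler_expR mulr_ge0.
split => // x xL; have [Ei EE] := EP.
  have := EE x xL; rewrite {2}/E P0 mulr0 expR0.
  rewrite -/(E x) => ->; rewrite addrC addKr.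
  have xL' : x <= L by case/andP: xL.
  have := integrable_sub0 xL' Ei => Ei'.
  rewrite -[X in _ = X / 2](_ : \int[mu]_(t in `[0, x]) (2 * (E t * p t)) = _).
    rewrite RintegralZl//; first by rewrite mulrAC divff ?mul1r.
    apply: integrable_sub0 xL' _.
    exact: (integrable_mul_primitive EP pi).
  by apply: eq_Rintegral => t _; rewrite -/(E t); ring.
Qed.

(** Let [K] be the supremum of [m / E] for the weight [E] of [exp_weight]. The integral
    inequality improves [m <= K E] to [m <= (c + K / 2) E], whence [K <= 2 c]. *)
Lemma gronwall L P p (m : R -> R) (c : R) : 0 <= L -> primitive_on L P p -> P 0 = 0 ->
  (forall x, 0 <= p x) -> measurable_fun `[0, L] m -> 0 <= c ->
  (exists M, forall x, 0 <= x <= L -> 0 <= m x <= M) ->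
  (forall x, 0 <= x <= L -> m x <= c + \int[mu]_(t in `[0, x]) (m t * p t)) ->
  forall x, 0 <= x <= L -> m x <= 2 * c * expR (2 * P x).
Proof.
move=> L0 Pp P0 p0 mm c0 [M mM] H.
have [pi Pi] := Pp.
have [EP E1 intE] := exp_weight L0 Pp P0 p0; set E := (fun x => expR (2 * P x)) in EP E1 intE.
pose S := [set m x / E x | x in `[0, L]].
have E0 x : 0 < E x by exact: expR_gt0.
have S0 : S !=set0 by exists (m 0 / E 0), 0 => //=; rewrite in_itv/= lexx.
have hS : has_sup S.
  split => //; exists M => _ [x /= xL <-]; move: xL; rewrite in_itv/= => xL.
  have /andP[h1 h2] := mM _ xL; rewrite ler_pdivrMr//.
  by apply: (le_trans h2); rewrite ler_peMr ?E1//; exact: le_trans h1 h2.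
have mK x : 0 <= x <= L -> m x <= sup S * E x.
  move=> xL; rewrite -ler_pdivrMr//; apply: ub_le_sup; first exact: hS.2.
  by exists x => //=; rewrite in_itv.
have K0 : 0 <= sup S.
  have h : (0 : R) <= 0 <= L by rewrite lexx.
  have := mK 0 h; have /andP[m00 _] := mM _ h.
  move=> /(le_trans m00); rewrite pmulr_lge0//.
have key x : 0 <= x <= L -> m x <= c + sup S * ((E x - 1) / 2).
  move=> xL; apply: (le_trans (H x xL)); rewrite lerD2l -intE//.
  have xL' : x <= L by case/andP: xL.
  rewrite -RintegralZl//; last first.
    apply: integrable_sub0 xL' _.
    exact: (integrable_mul_primitive EP pi).
  apply: le_Rintegral => //.
  - apply: integrable_sub0 xL' _; apply: (@integrable_mul_bounded _ _ _ M) => //.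
    by move=> t /mM /andP[h1 h2]; rewrite ger0_norm.
  - apply: (@integrableZl _ _ _ mu `[0, x] _ (sup S) (EFin \o (fun t => E t * p t))) => //.
    apply: integrable_sub0 xL' _.
    exact: (integrable_mul_primitive EP pi).
  - move=> t /=; rewrite in_itv/= => /andP[t0 tx].
    rewrite mulrA; apply: ler_wpM2r => //; apply: mK.
    by rewrite t0 (le_trans tx).
have Kc : sup S <= c + sup S / 2.
  apply: ge_sup => // _ [x /= xL <-]; move: xL; rewrite in_itv/= => xL.
  rewrite ler_pdivrMr//; apply: (le_trans (key x xL)).
  have z1 : 1 <= E x := E1 x xL; move: (sup S) (E x) K0 c0 z1 => K z K0 c0' z1.
  nra.
move=> x xL; apply: (le_trans (mK x xL)); apply: ler_wpM2r; first exact: ltW.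
lra.
Qed.

End Calculus.

(** * Linear systems with integrable coefficients *)

Section System.
Context {R : realType}.
Local Notation mu := (@lebesgue_measure R).
Implicit Types (L x y : R) (F G f g : R -> R).

Lemma integrable_big (I : Type) (s : seq I) L (f : I -> R -> R) :
  (forall i, mu.-integrable `[0, L] (EFin \o f i)) ->
  mu.-integrable `[0, L] (EFin \o (fun x => \sum_(i <- s) f i x)).
Proof.
move=> fi; elim: s => [|i s ih].
  by under [X in EFin \o X]eq_fun do rewrite big_nil; exact: integrable0.
rewrite (_ : (fun x => _) = (fun x => f i x + \sum_(j <- s) f j x)); last first.
  by apply/funext => x; rewrite big_cons.
apply: (@integrableD _ _ _ mu `[0, L] _ (fun x => (f i x)%:E)
  (fun x => (\sum_(j <- s) f j x)%:E)).
- exact: measurable_itv.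
- exact: fi.
- exact: ih.
Qed.

Lemma Rintegral_big (I : Type) (s : seq I) L (f : I -> R -> R) :
  (forall i, mu.-integrable `[0, L] (EFin \o f i)) ->
  \int[mu]_(x in `[0, L]) (\sum_(i <- s) f i x) =
  \sum_(i <- s) \int[mu]_(x in `[0, L]) f i x.
Proof.
move=> fi; elim: s => [|i s ih].
  rewrite big_nil; under eq_Rintegral do rewrite big_nil.
  by rewrite /Rintegral integral0.
rewrite big_cons -ih -RintegralD//; last exact: integrable_big.
by apply: eq_Rintegral => x _; rewrite big_cons.
Qed.

Lemma integrable_normr L f : mu.-integrable `[0, L] (EFin \o f) ->
  mu.-integrable `[0, L] (EFin \o (fun x => `|f x|)).
Proof. by move=> fi; apply: integrable_norm. Qed.

Lemma ge0_Rintegral_sub0 L x f : (forall x, 0 <= f x) -> x <= L ->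
  mu.-integrable `[0, L] (EFin \o f) ->
  \int[mu]_(t in `[0, x]) f t <= \int[mu]_(t in `[0, L]) f t.
Proof.
move=> f0 xL fi; have fi' := integrable_sub0 xL fi.
rewrite /Rintegral fine_le ?integrable_fin_num//.
apply: ge0_subset_integral => //.
- exact: measurable_int fi.
- by move=> t _; rewrite lee_fin.
- by apply: subset_itvl; rewrite bnd_simp.
Qed.

Lemma Rintegral_cst0 x : \int[mu]_(t in `[0, x]) (0 : R) = 0.
Proof. by rewrite /Rintegral integral0. Qed.

Lemma Rintegral_itv00 f : \int[mu]_(t in `[0, 0]) f t = 0.
Proof. by rewrite set_itv1 Rintegral_set1. Qed.

Lemma primitive_indef L f (c : R) : mu.-integrable `[0, L] (EFin \o f) ->
  primitive_on L (fun x => c + \int[mu]_(t in `[0, x]) f t) f.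
Proof. by move=> fi; split => // x _; rewrite Rintegral_itv00 addr0. Qed.

Variables (I : finType) (L : R) (L0 : 0 <= L).

(** Gronwall's inequality for the sum of the moduli of the components, a column sum bound on
    [A] taking the place of the coefficient. *)
Lemma system_bound (A : I -> I -> R -> R) (h y : I -> R -> R) (p0 : R -> R) :
  mu.-integrable `[0, L] (EFin \o p0) -> (forall x, 0 <= p0 x) ->
  (forall i j, mu.-integrable `[0, L] (EFin \o A i j)) ->
  (forall i, mu.-integrable `[0, L] (EFin \o h i)) ->
  (forall j x, \sum_i `|A i j x| <= p0 x) ->
  (forall i, primitive_on L (y i) (fun x => \sum_j A i j x * y j x + h i x)) ->
  forall x, 0 <= x <= L ->
  \sum_i `|y i x| <= 2 * (\sum_i `|y i 0| +
    \sum_i \int[mu]_(t in `[0, L]) `|h i t|) * expR (2 * \int[mu]_(t in `[0, L]) p0 t).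
Proof.
move=> pi p0_ge0 Ai hi Ap yP.
set c := (X in 2 * X * _).
have nhi i := integrable_normr (hi i).
have c0 : 0 <= c.
  apply: addr_ge0; apply: sumr_ge0 => i _ //.
  by apply: Rintegral_ge0 => t _.
have Pp := primitive_indef 0 pi.
set P := (fun x => _) in Pp.
have P0 : P 0 = 0 by rewrite /P Rintegral_itv00 addr0.
have my i := primitive_measurable (yP i).
have mm : measurable_fun `[0, L] (fun x => \sum_i `|y i x|).
  by apply: measurable_sum => i; apply: measurableT_comp.
have /choice[M yM] : forall i, exists M, forall x, 0 <= x <= L -> `|y i x| <= M.
  by move=> i; have [M] := primitive_bounded (yP i); exists M.
have bm : exists M, forall x, 0 <= x <= L -> 0 <= \sum_i `|y i x| <= M.
  exists (\sum_i M i) => x xL; apply/andP; split; first exact: sumr_ge0.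
  by apply: ler_sum => i _; exact: yM.
have Ayi i j : mu.-integrable `[0, L] (EFin \o (fun t => A i j t * y j t)).
  have := integrable_mul_primitive (yP j) (Ai i j).
  by apply: eq_integrable => //= t _; rewrite mulrC.
have mP x : 0 <= x <= L ->
    \sum_i `|y i x| <= c + \int[mu]_(t in `[0, x]) ((\sum_i `|y i t|) * p0 t).
  move=> /[dup] xL /andP[x0 xL'].
  have key i : `|y i x| <= `|y i 0| + \int[mu]_(t in `[0, L]) `|h i t| +
      \sum_j \int[mu]_(t in `[0, x]) `|A i j t * y j t|.
    have [gi ->//] := yP i.
    apply: (le_trans (ler_normD _ _)); rewrite -addrA lerD2l.
    rewrite RintegralD//; last first.
    - exact: integrable_sub0 xL' (hi i).
    - by apply: integrable_sub0 xL' _; exact: integrable_big.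
    apply: (le_trans (ler_normD _ _)); rewrite [leLHS]addrC; apply: lerD.
      apply: (le_trans (le_normr_Rintegral _ _)) => //.
        exact: integrable_sub0 xL' (hi i).
      exact: ge0_Rintegral_sub0.
    rewrite Rintegral_big; last by move=> j; exact: integrable_sub0 xL' (Ayi i j).
    apply: (le_trans (ler_norm_sum _ _ _)); apply: ler_sum => j _.
    apply: le_normr_Rintegral => //.
    exact: integrable_sub0 xL' (Ayi i j).
  apply: (@le_trans _ _ (c + \sum_i \sum_j \int[mu]_(t in `[0, x]) `|A i j t * y j t|)).
    rewrite /c -!big_split/=; apply: ler_sum => i _; exact: key.
  rewrite lerD2l.
  have nAyi i j : mu.-integrable `[0, x] (EFin \o (fun t => `|A i j t * y j t|)).
    by apply: integrable_sub0 xL' _; exact: integrable_normr.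
  under eq_bigr do rewrite -Rintegral_big//.
  rewrite -Rintegral_big; last by move=> i; exact: integrable_big.
  apply: le_Rintegral => //.
  - apply: integrable_big => i; exact: integrable_big.
  - have [M' M'0 bm'] : exists2 M, 0 <= M & forall x, 0 <= x <= L -> 0 <= \sum_i `|y i x| <= M.
      case: bm => M' bm'; exists M' => //.
      have /andP[h1 h2] := bm' x xL; exact: le_trans h1 h2.
    apply: integrable_sub0 xL' _; apply: (@integrable_mul_bounded _ _ _ _ M' mm _ pi).
    by move=> t /bm' /andP[h1 h2]; rewrite ger0_norm.
  - move=> t _; rewrite exchange_big/= mulr_suml; apply: ler_sum => j _.
    under eq_bigr do rewrite normrM.
    by rewrite -mulr_suml mulrC; apply: ler_wpM2l.
move=> x /[dup] xL /andP[x0 xL'].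
apply: (le_trans (gronwall L0 Pp P0 p0_ge0 mm c0 bm mP xL)).
apply: ler_wpM2l; first by rewrite mulr_ge0.
rewrite ler_expR ler_pM2l// /P add0r.
exact: ge0_Rintegral_sub0.
Qed.

(** Picard iteration: by [exp_weight] the successive corrections [u n] decay geometrically, so
    their sum converges, and dominated convergence shows that it solves the integral equation. *)
Lemma system_solution (A : I -> I -> R -> R) (h : I -> R -> R) (a : I -> R) :
  (forall i j, mu.-integrable `[0, L] (EFin \o A i j)) ->
  (forall i, mu.-integrable `[0, L] (EFin \o h i)) ->
  exists y : I -> R -> R, (forall i, y i 0 = a i) /\
    forall i, primitive_on L (y i) (fun x => \sum_j A i j x * y j x + h i x).
Proof.
move=> Ai hi.
(* This dominates every row sum, and a single weight serves all components. *)
pose p x := \sum_i \sum_j `|A i j x|.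
have pi : mu.-integrable `[0, L] (EFin \o p).
  by apply: integrable_big => i; apply: integrable_big => j; exact: integrable_normr.
have p_ge0 x : 0 <= p x by apply: sumr_ge0 => i _; exact: sumr_ge0.
have Ap i x : \sum_j `|A i j x| <= p x.
  rewrite /p [leRHS](bigD1 i)//= lerDl.
  by apply: sumr_ge0 => i' _; exact: sumr_ge0.
have Pp := primitive_indef 0 pi; set P := (fun x => _) in Pp.
have P0 : P 0 = 0 by rewrite /P Rintegral_itv00 addr0.
have [EP E1 EI] := exp_weight L0 Pp P0 p_ge0.
set E := (fun x => expR (2 * P x)) in EP E1 EI.
have [Em Em0 EEm] := primitive_bounded EP.
pose fix u n : I -> R -> R := match n with
  | 0 => fun i x => a i + \int[mu]_(t in `[0, x]) h i t
  | n.+1 => fun i x => 0 + \int[mu]_(t in `[0, x]) (\sum_j A i j t * u n j t)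
  end.
have uP n i : primitive_on L (u n i)
    (if n is n'.+1 then fun t => \sum_j A i j t * u n' j t else h i).
  elim: n i => [|n ih] i; apply: primitive_indef => //.
  apply: integrable_big => j; have := integrable_mul_primitive (ih j) (Ai i j).
  by apply: eq_integrable => //= t _; rewrite mulrC.
have Aui n i j : mu.-integrable `[0, L] (EFin \o (fun t => A i j t * u n j t)).
  have := integrable_mul_primitive (uP n j) (Ai i j).
  by apply: eq_integrable => //= t _; rewrite mulrC.
have [C C0 u0C] : exists2 C, 0 <= C & forall i x, 0 <= x <= L -> `|u 0%N i x| <= C.
  have /choice[M yM] : forall i, exists M, forall x, 0 <= x <= L -> `|u 0%N i x| <= M.
    by move=> i; have [M] := primitive_bounded (uP 0%N i); exists M.
  have M0 i : 0 <= M i.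
    by apply: (le_trans (normr_ge0 _)) (yM i 0 _); rewrite lexx.
  exists (\sum_i M i) => [|i x xL]; first exact: sumr_ge0.
  apply: (le_trans (yM i x xL)); rewrite (bigD1 i)//= lerDl.
  exact: sumr_ge0.
have uC n i x : 0 <= x <= L -> `|u n i x| <= C * 2^-1 ^+ n * E x.
  elim: n i x => [|n ih] i x xL.
    rewrite expr0 mulr1; apply: (le_trans (u0C i x xL)).
    by rewrite ler_peMr// E1.
  have xL' : x <= L by case/andP: xL.
  rewrite /= add0r; apply: (le_trans (le_normr_Rintegral _ _)) => //.
    by apply: integrable_sub0 xL' _; exact: integrable_big.
  apply: (@le_trans _ _ (\int[mu]_(t in `[0, x]) (C * 2^-1 ^+ n * (E t * p t)))).
    apply: le_Rintegral => //.
    - apply: integrable_sub0 xL' _; apply: integrable_normr; exact: integrable_big.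
    - apply: (@integrableZl _ _ _ mu `[0, x] _ (C * 2^-1 ^+ n)
        (EFin \o (fun t => E t * p t))) => //.
      by apply: integrable_sub0 xL' _; exact: integrable_mul_primitive EP pi.
    - move=> t /=; rewrite in_itv/= => /andP[t0 tx].
      apply: (le_trans (ler_norm_sum _ _ _)).
      apply: (@le_trans _ _ (\sum_j `|A i j t| * (C * 2^-1 ^+ n * E t))).
        apply: ler_sum => j _; rewrite normrM; apply: ler_wpM2l => //.
        by apply: ih; rewrite t0 (le_trans tx).
      rewrite -mulr_suml; have := Ap i t; set Sg := \sum_j _ => SgP.
      rewrite [leLHS](_ : _ = C * 2^-1 ^+ n * (E t * Sg)); last by ring.
      apply: ler_wpM2l.
        by rewrite mulr_ge0// exprn_ge0// invr_ge0.
      by apply: ler_wpM2l => //; rewrite (le_trans ler01)// E1// t0 (le_trans tx).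
  rewrite RintegralZl//; last first.
    by apply: integrable_sub0 xL' _; exact: integrable_mul_primitive EP pi.
  rewrite EI// exprSr -!mulrA; apply: ler_wpM2l => //; apply: ler_wpM2l.
    by rewrite exprn_ge0// invr_ge0.
  by rewrite mulrC ler_wpM2l// ?invr_ge0// gerBl.
pose K := C * Em.
have K0 : 0 <= K by rewrite mulr_ge0.
have uK n i x : 0 <= x <= L -> `|u n i x| <= geometric K 2^-1 n.
  move=> xL; apply: (le_trans (uC n i x xL)); rewrite /geometric/= /K mulrAC.
  rewrite ler_wpM2r ?exprn_ge0 ?invr_ge0// ler_wpM2l//.
  by apply: le_trans (EEm x xL); exact: ler_norm.
have half1 : `|2^-1 : R| < 1 by rewrite ger0_norm ?invr_ge0// invf_lt1// ltr1n.
pose S N i x := series (fun n => u n i x) N.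
have S_cvg i x : 0 <= x <= L -> cvgn (fun N => S N i x).
  move=> xL; apply: normed_cvg.
  apply: (@series_le_cvg _ _ (geometric K 2^-1)).
  - by move=> n; exact: normr_ge0.
  - by move=> n; apply: geometric_ge0 => //; rewrite invr_ge0.
  - by move=> n; exact: uK.
  - exact: is_cvg_geometric_series.
have SK N i x : 0 <= x <= L -> `|S N i x| <= 2 * K.
  move=> xL; rewrite /S /series/=; apply: (le_trans (ler_norm_sum _ _ _)).
  apply: (@le_trans _ _ (series (geometric K 2^-1) N)).
    by apply: ler_sum => n _; exact: uK.
  rewrite geometric_seriesE ?lt_eqF//; last by apply: (le_lt_trans (ler_norm _)).
  rewrite /= [X in _ / X](_ : _ = 2^-1); last by field.
  rewrite invrK mulrC ler_wpM2l// ler_piMr// gerBl exprn_ge0// invr_ge0//.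
pose y i x := limn (fun N => S N i x).
have Sy i x : 0 <= x <= L -> S N i x @[N --> \oo] --> y i x by move=> /S_cvg.
have mS N i : measurable_fun `[0, L] (S N i).
  by apply: measurable_sum => n; exact: primitive_measurable (uP n i).
have my i : measurable_fun `[0, L] (y i).
  by apply: (measurable_fun_cvg (fun N => mS N i)) => x /=; rewrite in_itv/=; exact: Sy.
have yK i x : 0 <= x <= L -> `|y i x| <= 2 * K.
  move=> xL; have c : `|S N i x| @[N --> \oo] --> `|y i x| by apply: cvg_norm; exact: Sy.
  rewrite -(cvg_lim (@Rhausdorff R) c); apply: limr_le; first exact: cvgP c.
  by apply: nearW => N; exact: SK.
have Ayi i j : mu.-integrable `[0, L] (EFin \o (fun t => A i j t * y j t)).
  have := integrable_mul_bounded (my j) (yK j) (Ai i j).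
  by apply: eq_integrable => //= t _; rewrite mulrC.
have ASi N i j : mu.-integrable `[0, L] (EFin \o (fun t => A i j t * S N j t)).
  have := integrable_mul_bounded (mS N j) (SK N j) (Ai i j).
  by apply: eq_integrable => //= t _; rewrite mulrC.
have S_rec N i x : 0 <= x <= L -> S N.+1 i x =
    u 0%N i x + \int[mu]_(t in `[0, x]) (\sum_j A i j t * S N j t).
  move=> xL; have xL' : x <= L by case/andP: xL.
  elim: N => [|N ih].
    rewrite {1}/S /series/= big_nat1 -[LHS]addr0; congr (_ + _).
    rewrite -[LHS](@Rintegral_cst0 x); apply: eq_Rintegral => t _.
    by rewrite big1// => j _; rewrite /S /series/= big_geq// mulr0.
  rewrite {1}/S seriesSr -/(S N.+1 i x) ih -addrA; congr (_ + _).
  rewrite {1}/u -/u add0r -RintegralD//.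
  - apply: eq_Rintegral => t _; rewrite -big_split/=; apply: eq_bigr => j _.
    by rewrite {2}/S seriesSr -/(S N j t) mulrDr.
  - by apply: integrable_sub0 xL' _; exact: integrable_big.
  - by apply: integrable_sub0 xL' _; exact: integrable_big.
have y_eq i x : 0 <= x <= L ->
    y i x = u 0%N i x + \int[mu]_(t in `[0, x]) (\sum_j A i j t * y j t).
  move=> xL; have xL' : x <= L by case/andP: xL.
  have tL t : t \in `[0, x] -> 0 <= t <= L.
    by rewrite in_itv/= => /andP[-> tx]; exact: le_trans tx xL'.
  have [|||||_ _] := @dominated_convergence _ _ R mu `[0, x] (measurable_itv _)
    (fun N t => (\sum_j A i j t * S N j t)%:E) (fun t => (\sum_j A i j t * y j t)%:E)
    (fun t => (2 * K * p t)%:E).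
  - move=> N; apply: (measurable_int mu).
    by apply: integrable_sub0 xL' _; exact: integrable_big.
  - apply: (measurable_int mu).
    by apply: integrable_sub0 xL' _; exact: integrable_big.
  - apply/aeW => t /tL xtL; apply: cvg_EFin; first exact: nearW.
    apply: (@cvg_trans _ ((\sum_j A i j t * S N j t) @[N --> \oo])).
      exact: cvg_id.
    elim: (index_enum I) => [|j s ih].
      by rewrite big_nil; under eq_cvg do rewrite big_nil; exact: cvg_cst.
    rewrite big_cons; under eq_cvg do rewrite big_cons.
    by apply: cvgD => //; apply: cvgMr; exact: Sy.
  - apply: (@integrableZl _ _ _ mu `[0, x] _ (2 * K) (EFin \o p)) => //.
    exact: integrable_sub0 xL' pi.
  - apply/aeW => t N /tL xtL; rewrite /= lee_fin.
    apply: (le_trans (ler_norm_sum _ _ _)).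
    apply: (@le_trans _ _ (\sum_j `|A i j t| * (2 * K))).
      by apply: ler_sum => j _; rewrite normrM; apply: ler_wpM2l => //; exact: SK.
    by rewrite -mulr_suml mulrC ler_wpM2l// ?Ap// mulr_ge0.
  move=> Icvg.
  have RIcvg : (\int[mu]_(t in `[0, x]) (\sum_j A i j t * S N j t)) @[N --> \oo] -->
      \int[mu]_(t in `[0, x]) (\sum_j A i j t * y j t).
    apply: fine_cvg; rewrite /Rintegral fineK//; apply: integrable_fin_num => //.
    by apply: integrable_sub0 xL' _; exact: integrable_big.
  have Sy' : S N.+1 i x @[N --> \oo] --> y i x.
    by rewrite (cvg_shiftS (fun N => S N i x)); exact: Sy.
  rewrite -(cvg_lim (@Rhausdorff R) Sy'); apply: cvg_lim; first exact: Rhausdorff.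
  under eq_cvg do rewrite S_rec//.
  by apply: cvgD => //; exact: cvg_cst.
exists y; split=> [i|i].
  by rewrite y_eq ?lexx//= !Rintegral_itv00 !addr0.
split.
  apply: (@integrableD _ _ _ mu `[0, L] _ (fun x => (\sum_j A i j x * y j x)%:E)
    (fun x => (h i x)%:E)).
  - exact: measurable_itv.
  - exact: integrable_big.
  - exact: hi.
move=> x xL; have xL' : x <= L by case/andP: xL.
rewrite y_eq// y_eq ?lexx//= !Rintegral_itv00 !addr0 -addrA; congr (_ + _).
rewrite RintegralD// 1?addrC//.
- by apply: integrable_sub0 xL' _; exact: integrable_big.
- exact: integrable_sub0 xL' (hi i).
Unshelve. all: by end_near. Qed.

End System.

(** * The Schroedinger equation on an edge *)

Section OpenInterval.
Context {R : realType}.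
Local Notation mu := (@lebesgue_measure R).
Implicit Types (L x y : R) (F G f g : R -> R).

Lemma ae_neq (c : R) : {ae mu, forall x, x != c}.
Proof.
exists [set c]; split => //; first exact: lebesgue_measure_set1.
by move=> x /= /negP; rewrite negbK => /eqP.
Qed.

(** Clamping the variable to [eta, L - eta] produces functions that are absolutely continuous
    on the closed interval; the increments of [F] between interior points are therefore
    integrals of [w], and [G] extends [F] by its one-sided limits. *)
Lemma open_abs_cont_ftc L F w : 0 < L -> Rabs_cont `]0, L[ F ->
  mu.-integrable `[0, L] (EFin \o w) ->
  {ae mu, forall x, x \in `]0, L[ -> derive1 F x = w x} ->
  exists2 G, primitive_on L G w & forall x, 0 < x < L -> G x = F x.
Proof.
move=> L0 acF wi Fw.
have key x y : 0 < x -> x <= y -> y < L -> F y - F x = \int[mu]_(t in `[x, y]) w t.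
  move=> x0 xy yL.
  (* Any margin for which [x] and [y] are inside [eta, L - eta] will do. *)
  pose eta := Num.min x (L - y) / 2.
  have eta0 : 0 < eta by rewrite divr_gt0// lt_min x0 subr_gt0.
  have etax : eta < x.
    by rewrite ltr_pdivrMr// (@le_lt_trans _ _ x)// ?ge_min ?lexx// ltr_pMr// ltr1n.
  have etay : y < L - eta.
    rewrite ltrBrDr addrC -ltrBrDr ltr_pdivrMr//.
    rewrite (@le_lt_trans _ _ (L - y))// ?ge_min ?lexx ?orbT//.
    by rewrite ltr_pMr ?subr_gt0// ltr1n.
  pose c := clamp eta (L - eta).
  have etaL : eta < L - eta by apply: (lt_trans etax); exact: le_lt_trans xy etay.
  have c_id t : eta <= t <= L - eta -> c t = t by exact: clamp_id.
  have c_in t : t \in `[0, L] -> c t \in `]0, L[.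
    move=> _; have /andP[h1 h2] := clamp_in t (ltW etaL).
    rewrite in_itv/= (lt_le_trans eta0 h1) (le_lt_trans h2)//.
    by rewrite ltrBlDr ltrDl.
  pose w' t := if t \in `]eta, L - eta[ then w t else 0.
  have w'E : w' = w \_ `]eta, L - eta[.
    by apply/funext => t; rewrite patchE /w'; congr (if _ then _ else _); rewrite mem_setE.
  have w'i : mu.-integrable `[0, L] (EFin \o w').
    have eL : L - eta <= L by rewrite gerBl ltW.
    have wi' : mu.-integrable `]eta, L - eta[ (EFin \o w).
      by apply: (integrableS _ _ _ wi) => //; apply: subset_itv; rewrite bnd_simp ?(ltW eta0)//.
    have : mu.-integrable setT (EFin \o w').
      by rewrite w'E -restrict_EFin; apply: (integrable_mkcond _ _).1.
    by move=> h; apply: (integrableS _ _ _ h).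
  have /abs_cont_ftc : Rabs_cont `[0, L] (F \o c) by exact: (Rabs_cont_comp acF (@clamp_homo _ _ _) (@clamp_lip _ _ _) c_in).
  move=> /(_ w' (ltW L0) w'i) H.
  have {}H : primitive_on L (F \o c) w'.
    apply: H; have := ae_neq eta; have := ae_neq (L - eta); move: Fw.
    apply: filterS3; first exact: (ae_filter_ringOfSetsType mu).
    move=> t Ft t1 t2 tL; rewrite /w'; case: ifPn => teta.
      move: teta; rewrite in_itv/= => /andP[h1 h2].
      rewrite -Ft// !derive1E; apply: near_eq_derive; near=> u => /=; rewrite c_id//.
      apply/andP; split; apply: ltW.
        by near: u; exact: lt_nbhsr.
      by near: u; exact: lt_nbhsl.
    have [v cv] : exists v, \forall u \near t, c u = v.
      case: (ltP t eta) => h1.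
        exists eta; near=> u; rewrite /c /clamp max_l; last first.
          by apply: ltW; near: u; exact: lt_nbhsl.
        by rewrite min_l// ltW.
      exists (L - eta); near=> u; rewrite /c /clamp min_r// le_max; apply/orP; right.
      apply: ltW; near: u; apply: lt_nbhsr.
      move: teta; rewrite in_itv/= negb_and -!leNgt lt_neqAle eq_sym t1/=.
      by case/orP => // h2; case/eqP : t2; apply/eqP; rewrite eq_le h1 h2.
    rewrite derive1E (near_eq_derive (g := cst (F v))) ?derive_cst//.
    by apply: filterS cv => u /= ->.
  have := primitive_sub H (ltW x0) xy (ltW yL).
  rewrite /= !c_id ?(ltW etax) ?(ltW etay) ?(le_trans xy (ltW etay)) ?(le_trans (ltW etax) xy)//.
  move=> ->; apply: eq_Rintegral => t; rewrite inE/= in_itv/= => /andP[xt ty].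
  by rewrite /w' in_itv/= (lt_le_trans etax xt) (le_lt_trans ty etay).
pose m := L / 2; have m0 : 0 < m by rewrite divr_gt0.
have mL : m < L by rewrite ltr_pdivrMr// ltr_pMr// ltr1n.
exists (fun x => (F m - \int[mu]_(t in `[0, m]) w t) + \int[mu]_(t in `[0, x]) w t).
  exact: primitive_indef.
have P := primitive_indef 0 wi.
move=> x /andP[x0 xL]; case: (leP x m) => xm.
  have := primitive_sub P (ltW x0) xm (ltW mL); rewrite -key//; lra.
have := primitive_sub P (ltW m0) (ltW xm) (ltW xL); rewrite -key//; [lra|exact: ltW].
Unshelve. all: by end_near. Qed.

(** Since [f] is continuous the derivative exists everywhere, which is what the pointwise
    condition in [edge_AC2] asks for. *)
Lemma primitive_derive L F f x : primitive_on L F f ->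
  {within `[0, L], continuous f} -> 0 < x < L ->
  derivable F x 1 /\ derive1 F x = f x.
Proof.
move=> [fi Ff] cf /andP[x0 xL].
have L0 := lt_trans x0 xL.
have cfx : {for x, continuous f}.
  move/(continuous_within_itvP _ L0) : cf => [cf _ _].
  by apply: cf; rewrite in_itv/= x0.
have [] := @continuous_FTC1_closed R f 0 x L xL fi x0 cfx.
set G := (fun _ => _) => dG G'.
have FG : \forall y \near x, F y = F 0 + G y.
  near=> y.
  have y0 : 0 < y by near: y; exact: lt_nbhsr.
  have yL : y < L by near: y; exact: lt_nbhsl.
  by rewrite Ff ?ltW.
by have [dF ->] := derive1_add_cst dG FG.
Unshelve. all: by end_near. Qed.

Lemma primitive_cvg_start L F f : 0 < L -> primitive_on L F f -> F x @[x --> 0^'+] --> F 0.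
Proof.
by move=> L0 /primitive_continuous /(continuous_within_itvP _ L0)[].
Qed.

Lemma primitive_cvg_end L F f : 0 < L -> primitive_on L F f -> F x @[x --> L^'-] --> F L.
Proof.
by move=> L0 /primitive_continuous /(continuous_within_itvP _ L0)[].
Qed.

Lemma primitive_eq L F F' f f' : F =1 F' -> f =1 f' ->
  primitive_on L F f -> primitive_on L F' f'.
Proof. by move=> /funext -> /funext ->. Qed.

End OpenInterval.

Section ComplexEdge.
Context {R : realType}.
Local Notation mu := (@lebesgue_measure R).
Local Notation C := R[i].
Implicit Types (L x : R) (F G f g y p : R -> C) (q : R -> R) (z : C).

Definition cintegrable L f : Prop :=
  mu.-integrable `[0, L] (EFin \o (Re \o f)) /\
  mu.-integrable `[0, L] (EFin \o (Im \o f)).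

Definition cprimitive L F f : Prop :=
  primitive_on L (Re \o F) (Re \o f) /\ primitive_on L (Im \o F) (Im \o f).

Definition l1norm (z : C) : R := `|Re z| + `|Im z|.

(** The equation [- y'' + q y = z y + g] as a first-order system in integrated form, with [p =
    y']. *)
Definition edge_sol L q z g y p : Prop := cprimitive L y p /\
  cprimitive L p (fun x => (q x)%:C * y x - z * y x - g x).

Lemma integrable_lin4 L (f1 f2 f3 f4 : R -> R) (a b c d : R) :
  mu.-integrable `[0, L] (EFin \o f1) -> mu.-integrable `[0, L] (EFin \o f2) ->
  mu.-integrable `[0, L] (EFin \o f3) -> mu.-integrable `[0, L] (EFin \o f4) ->
  mu.-integrable `[0, L] (EFin \o (fun x => a * f1 x + b * f2 x + (c * f3 x + d * f4 x))).
Proof.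
move=> i1 i2 i3 i4.
have := integrable_lin 1 1 (integrable_lin a b i1 i2) (integrable_lin c d i3 i4).
by apply: eq_integrable => //= x _; rewrite !mul1r.
Qed.

Lemma cintegrable_lin L (a b : C) f g : cintegrable L f -> cintegrable L g ->
  cintegrable L (fun x => a * f x + b * g x).
Proof.
case: a b => [ar ai] [br bi] [fr fi] [gr gi]; split.
- have := integrable_lin4 ar (- ai) br (- bi) fr fi gr gi.
  apply: eq_integrable => //= x _; congr EFin.
  by case: (f x) (g x) => [? ?] [? ?] /=; ring.
- have := integrable_lin4 ar ai br bi fi fr gi gr.
  apply: eq_integrable => //= x _; congr EFin.
  by case: (f x) (g x) => [? ?] [? ?] /=; ring.
Qed.

Lemma cprimitive_lin L (a b : C) F G f g : cprimitive L F f -> cprimitive L G g ->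
  cprimitive L (fun x => a * F x + b * G x) (fun x => a * f x + b * g x).
Proof.
case: a b => [ar ai] [br bi] [fr fi] [gr gi]; split.
- have := primitive_lin 1 1 (primitive_lin ar (- ai) fr fi) (primitive_lin br (- bi) gr gi).
  by apply: primitive_eq => x /=; [case: (F x) (G x) => [? ?] [? ?]|
    case: (f x) (g x) => [? ?] [? ?]] => /=; ring.
- have := primitive_lin 1 1 (primitive_lin ar ai fi fr) (primitive_lin br bi gi gr).
  by apply: primitive_eq => x /=; [case: (F x) (G x) => [? ?] [? ?]|
    case: (f x) (g x) => [? ?] [? ?]] => /=; ring.
Qed.

Lemma cprimitive_eq L F F' f f' : F =1 F' -> f =1 f' ->
  cprimitive L F f -> cprimitive L F' f'.
Proof. by move=> /funext -> /funext ->. Qed.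

Lemma cprimitive_cintegrable L F f : cprimitive L F f -> cintegrable L F.
Proof.
move=> [/primitive_continuous Fr /primitive_continuous Fi].
by split; apply: continuous_compact_integrable => //; exact: segment_compact.
Qed.

Lemma edge_sol_lin L q z (a b : C) g1 y1 p1 g2 y2 p2 :
  edge_sol L q z g1 y1 p1 -> edge_sol L q z g2 y2 p2 ->
  edge_sol L q z (fun x => a * g1 x + b * g2 x) (fun x => a * y1 x + b * y2 x)
    (fun x => a * p1 x + b * p2 x).
Proof.
move=> [h1 k1] [h2 k2]; split; first exact: cprimitive_lin.
by apply: cprimitive_eq (cprimitive_lin a b k1 k2) => // x; ring.
Qed.

Lemma edge_sol_shift L q z w g y p : edge_sol L q w g y p ->
  edge_sol L q z (fun x => g x - (z - w) * y x) y p.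
Proof.
by move=> [h k]; split => //; apply: cprimitive_eq k => // x; ring.
Qed.

Lemma sum_bool2 (f : bool * bool -> R) :
  \sum_i f i = f (false, false) + f (false, true) + (f (true, false) + f (true, true)).
Proof.
rewrite (eq_bigr (fun i => f (i.1, i.2))) => [|[]//].
rewrite -(pair_bigA _ (fun a b => f (a, b))) /= !big_bool/=.
by rewrite addrC [X in X + _]addrC [X in _ + X]addrC.
Qed.

Section Matrix.
Variables (q : R -> R) (z : C).

(** The companion matrix of the equation, acting on the real and imaginary parts of the
    function ([(false, _)]) and of its derivative ([(true, _)]). *)
Definition companion (i j : bool * bool) (x : R) : R :=
  match i, j with
  | (false, c), (true, c') => (c == c')%:R
  | (true, false), (false, false) => q x - Re z
  | (true, false), (false, true) => Im z
  | (true, true), (false, true) => q x - Re z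
  | (true, true), (false, false) => - Im z
  | _, _ => 0
  end.

Definition components (y p : R -> C) (i : bool * bool) (x : R) : R :=
  match i with
  | (false, false) => Re (y x)
  | (false, true) => Im (y x)
  | (true, false) => Re (p x)
  | (true, true) => Im (p x)
  end.

Lemma edge_solE L (g y p : R -> C) : edge_sol L q z g y p <->
  forall i, primitive_on L (components y p i)
    (fun x => \sum_j companion i j x * components y p j x + components (fun=> 0) (\- g) i x).
Proof.
split.
- move=> [[h1 h2] [h3 h4]] [[] []].
  + apply: primitive_eq h4 => // x; rewrite sum_bool2/=.
    by case: (y x) (g x) => [? ?] [? ?]; case: z => ? ? /=; ring.
  + apply: primitive_eq h3 => // x; rewrite sum_bool2/=.
    by case: (y x) (g x) => [? ?] [? ?]; case: z => ? ? /=; ring.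
  + by apply: primitive_eq h2 => // x; rewrite sum_bool2/=; ring.
  + by apply: primitive_eq h1 => // x; rewrite sum_bool2/=; ring.
- move=> H; split; split.
  + by apply: primitive_eq (H (false, false)) => // x; rewrite sum_bool2/=; ring.
  + by apply: primitive_eq (H (false, true)) => // x; rewrite sum_bool2/=; ring.
  + apply: primitive_eq (H (true, false)) => // x; rewrite sum_bool2/=.
    by case: (y x) (g x) => [? ?] [? ?]; case: z => ? ? /=; ring.
  + apply: primitive_eq (H (true, true)) => // x; rewrite sum_bool2/=.
    by case: (y x) (g x) => [? ?] [? ?]; case: z => ? ? /=; ring.
Qed.

End Matrix.

Section Solve.
Variables (L : R) (q : R -> R).
Hypotheses (L0 : 0 <= L) (qi : mu.-integrable `[0, L] (EFin \o q)).

Lemma integrable_cst1 (c : R) : mu.-integrable `[0, L] (EFin \o (fun=> c)).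
Proof.
apply: continuous_compact_integrable; first exact: segment_compact.
by apply: continuous_subspaceT => x; exact: cst_continuous.
Qed.

Lemma companion_integrable z i j : mu.-integrable `[0, L] (EFin \o companion q z i j).
Proof.
have h (c : R) : mu.-integrable `[0, L] (EFin \o (fun x => q x - c)).
  have := integrable_lin 1 (-1) qi (integrable_cst1 c).
  by apply: eq_integrable => //= x _; rewrite mul1r mulN1r.
by move: i j => [[] []] [[] []]; rewrite /companion; first [exact: integrable_cst1 | exact: h].
Qed.

Lemma components_integrable g i : cintegrable L g ->
  mu.-integrable `[0, L] (EFin \o components (fun=> 0) (\- g) i).
Proof.
move=> [gr gi]; case: i => [[] []] /=; try exact: integrable_cst1.
- have := integrable_lin (-1) 0 gi gi; apply: eq_integrable => //= x _.
  by congr EFin; case: (g x) => ? ? /=; ring.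
- have := integrable_lin (-1) 0 gr gr; apply: eq_integrable => //= x _.
  by congr EFin; case: (g x) => ? ? /=; ring.
Qed.

Lemma edge_sol_exists z (a b : C) g : cintegrable L g ->
  exists y p, [/\ edge_sol L q z g y p, y 0 = a & p 0 = b].
Proof.
move=> gi.
have [Y [Y0 YP]] := system_solution L0 (components (fun=> a) (fun=> b) ^~ 0)
  (companion_integrable z) (fun i => components_integrable i gi).
pose y x := Y (false, false) x +i* Y (false, true) x.
pose p x := Y (true, false) x +i* Y (true, true) x.
have YE i : Y i = components y p i by case: i => [[] []].
exists y, p; split.
- by apply/edge_solE => i; have := YP i; rewrite !YE; apply: primitive_eq => // x;
  under eq_bigr do rewrite YE.
- by rewrite /y !Y0/=; case: (a).
- by rewrite /p !Y0/=; case: (b).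
Qed.

Definition growth (rho : R) : R := 2 * expR (2 * \int[mu]_(t in `[0, L]) (1 + `|q t| + 2 * rho)).

(** The bound is uniform for [z] in bounded sets and linear in the data: it yields uniqueness,
    analyticity in [z] and the boundedness of the resolvent. *)
Lemma edge_sol_bound (rho : R) z g y p : cintegrable L g -> l1norm z <= rho ->
  edge_sol L q z g y p -> forall x, 0 <= x <= L ->
  l1norm (y x) + l1norm (p x) <= growth rho *
    (l1norm (y 0) + l1norm (p 0) + \int[mu]_(t in `[0, L]) l1norm (g t)).
Proof.
move=> gi zr /edge_solE H x xL.
have rho0 : 0 <= rho by apply: le_trans zr; rewrite addr_ge0.
have nqi := integrable_normr qi.
have p0i : mu.-integrable `[0, L] (EFin \o (fun t => 1 + `|q t| + 2 * rho)).
  have := integrable_lin 1 1 (integrable_cst1 (1 + 2 * rho)) nqi.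
  by apply: eq_integrable => //= t _; congr EFin; ring.
have p0_ge0 t : 0 <= 1 + `|q t| + 2 * rho by have := normr_ge0 (q t); lra.
have col j t : \sum_i `|companion q z i j t| <= 1 + `|q t| + 2 * rho.
  have := normr_ge0 (q t); have := ler_normB (q t) (Re z); move: zr; rewrite /l1norm.
  have := normr_ge0 (Re z); have := normr_ge0 (Im z).
  by move: j => [[] []]; rewrite sum_bool2/= ?normr0 ?normr1 ?normrN; lra.
have := system_bound L0 p0i p0_ge0 (companion_integrable z)
  (fun i => components_integrable i gi) col H xL.
rewrite !sum_bool2/= -!/(l1norm _) mulrAC => h; apply: (le_trans h).
have -> : \int[mu]_(t in `[0, L]) l1norm (g t) =
    \int[mu]_(t in `[0, L]) `|Re (- g t)| + \int[mu]_(t in `[0, L]) `|Im (- g t)|.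
  have [gr gim] := gi.
  rewrite [LHS](_ : _ = \int[mu]_(t in `[0, L]) (`|Re (g t)| + `|Im (g t)|))//.
  rewrite RintegralD//; [|exact: integrable_normr..].
  by congr (_ + _); apply: eq_Rintegral => t _; case: (g t) => ? ? /=; rewrite normrN.
by rewrite normr0 !Rintegral_cst0 addr0 add0r.
Qed.

End Solve.
End ComplexEdge.

Section Bridge.
Context {R : realType}.
Local Notation mu := (@lebesgue_measure R).
Local Notation C := R[i].
Variables (L : R) (q : R -> R).
Hypotheses (L0 : 0 < L) (qi : mu.-integrable `[0, L] (EFin \o q)).
Implicit Types (x : R) (F G f g y p : R -> C) (z : C).

Lemma cintegrable_mul F f : cprimitive L F f ->
  cintegrable L (fun x => (q x)%:C * F x).
Proof.
move=> [Fr Fi]; split.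
- have := integrable_mul_primitive Fr qi; apply: eq_integrable => //= x _.
  by congr EFin; case: (F x) => ? ? /=; ring.
- have := integrable_mul_primitive Fi qi; apply: eq_integrable => //= x _.
  by congr EFin; case: (F x) => ? ? /=; ring.
Qed.

Lemma cintegrable_rhs F f g z : cprimitive L F f -> cintegrable L g ->
  cintegrable L (fun x => (q x)%:C * F x - z * F x - g x).
Proof.
move=> Ff gi; have h := cintegrable_mul Ff; have h2 := cprimitive_cintegrable Ff.
have := cintegrable_lin 1 (-1) (cintegrable_lin 1 (- z) h h2) gi.
by congr (cintegrable _ _); apply/funext => x; ring.
Qed.

Lemma near_start_open : \forall x \near (0:R)^'+, 0 < x < L.
Proof.
near=> x; apply/andP; split; near: x; first exact: nbhs_right_gt.
by apply: nbhs_right_lt.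
Unshelve. all: by end_near. Qed.

Lemma near_end_open : \forall x \near L^'-, 0 < x < L.
Proof.
near=> x; apply/andP; split; near: x; last exact: nbhs_left_lt.
by apply: nbhs_left_gt.
Unshelve. all: by end_near. Qed.

Lemma lim_start_eq (F G f : R -> R) : primitive_on L G f ->
  (forall x, 0 < x < L -> G x = F x) -> lim (F x @[x --> 0^'+]) = G 0.
Proof.
move=> /(primitive_cvg_start L0) cG GF; apply: cvg_lim; first exact: Rhausdorff.
apply: cvg_trans cG; apply: near_eq_cvg.
by apply: filterS near_start_open => x /GF.
Qed.

Lemma lim_end_eq (F G f : R -> R) : primitive_on L G f ->
  (forall x, 0 < x < L -> G x = F x) -> lim (F x @[x --> L^'-]) = G L.
Proof.
move=> /(primitive_cvg_end L0) cG GF; apply: cvg_lim; first exact: Rhausdorff.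
apply: cvg_trans cG; apply: near_eq_cvg.
by apply: filterS near_end_open => x /GF.
Qed.

(** The function [f'] is absolutely continuous on the open interval with almost everywhere the
    integrable derivative [(q - z) f - g]; so it is a primitive, whose values at the endpoints
    are the one-sided limits of [f']. *)
Lemma edge_AC2_sol f g z : edge_AC2 L f -> cintegrable L g ->
  edge_eq L (edge_expr q f) (fun x => z * f x + g x) ->
  exists p, [/\ edge_sol L q z g f p, p 0 = cderiv_start f & p L = cderiv_end L f].
Proof.
move=> [[fr fi] _ [dr di]] gi fE.
have [ur Ur] := abs_cont_primitive (ltW L0) fr.
have [ui Ui] := abs_cont_primitive (ltW L0) fi.
have U : cprimitive L f (fun x => ur x +i* ui x) by split.
pose w x := (q x)%:C * f x - z * f x - g x.
have [wr wi] : cintegrable L w := cintegrable_rhs z U gi.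
have key : {ae mu, forall x, x \in `]0, L[ -> cderiv (cderiv f) x = w x}.
  have {}fE : {ae mu, forall x, x \in `[0, L] ->
      edge_expr q f x = z * f x + g x} by exact: fE.
  move: fE; apply: filterS; first exact: (ae_filter_ringOfSetsType mu).
  move=> x H; rewrite in_itv/= => /andP[x0 xL].
  have : x \in `[0, L] by rewrite in_itv/= !ltW.
  move=> /H; rewrite /edge_expr /w => E.
  by rewrite -addrA -opprD -E; ring.
have [G1 G1P G1E] : exists2 G, primitive_on L G (Re \o w) &
    forall x, 0 < x < L -> G x = Re (cderiv f x).
  apply: open_abs_cont_ftc => //.
  move: key; apply: filterS; first exact: (ae_filter_ringOfSetsType mu).
  by move=> x H /H E; rewrite -[RHS]/(Re (w x)) -E.
have [G2 G2P G2E] : exists2 G, primitive_on L G (Im \o w) &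
    forall x, 0 < x < L -> G x = Im (cderiv f x).
  apply: open_abs_cont_ftc => //.
  move: key; apply: filterS; first exact: (ae_filter_ringOfSetsType mu).
  by move=> x H /H E; rewrite -[RHS]/(Im (w x)) -E.
exists (fun x => G1 x +i* G2 x); split; last 2 first.
- by rewrite /cderiv_start /clim (lim_start_eq G1P)// (lim_start_eq G2P).
- by rewrite /cderiv_end /clim (lim_end_eq G1P)// (lim_end_eq G2P).
have [ir ii] : cintegrable L (fun x => G1 x +i* G2 x).
  by apply: (@cprimitive_cintegrable _ _ _ w); split.
split; last by split.
split; apply: abs_cont_ftc => //; rewrite ?ltW//.
- by apply/aeW => x; rewrite in_itv/= => /G1E ->.
- by apply/aeW => x; rewrite in_itv/= => /G2E ->.
Qed.

Lemma edge_L2_cprimitive F f : cprimitive L F f -> edge_L2 L F.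
Proof.
move=> [Fr Fi]; split.
- exact: primitive_measurable Fr.
- exact: primitive_measurable Fi.
have [ir ii] : cintegrable L F by apply: (@cprimitive_cintegrable _ _ _ f).
have := integrable_lin 1 1 (integrable_mul_primitive Fr ir) (integrable_mul_primitive Fi ii).
move=> /integrableP[_]; rewrite [X in (X < _)%E -> _](_ : _ = edge_sqnorm L F)//.
apply: eq_integral => x _ /=.
by rewrite !mul1r -!expr2 ger0_norm// addr_ge0// sqr_ge0.
Qed.

Lemma edge_sol_AC2 z g y p : cintegrable L g -> edge_sol L q z g y p ->
  [/\ edge_AC2 L y, edge_eq L (edge_expr q y) (fun x => z * y x + g x),
    cderiv_start y = p 0 & cderiv_end L y = p L].
Proof.
move=> gi [[yr yi] [pr pi]].
have dr x : 0 < x < L -> derivable (Re \o y) x 1 /\ derive1 (Re \o y) x = Re (p x).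
  by move=> xL; apply: (primitive_derive yr) => //; exact: primitive_continuous pr.
have di x : 0 < x < L -> derivable (Im \o y) x 1 /\ derive1 (Im \o y) x = Im (p x).
  by move=> xL; apply: (primitive_derive yi) => //; exact: primitive_continuous pi.
have dE x : 0 < x < L -> cderiv y x = p x.
  by move=> xL; rewrite /cderiv (dr _ xL).2 (di _ xL).2; case: (p x).
have ac_open (F G f : R -> R) : primitive_on L G f ->
    (forall x, 0 < x < L -> F x = G x) -> Rabs_cont `]0, L[ F.
  move=> /primitive_abs_cont acG FG e e0; have [d d0 H] := acG e e0.
  exists d => // n a b ab tI sd.
  have ab' k : [/\ a k \in `[0, L], b k \in `[0, L] & a k <= b k].
    have [+ + ->] := ab k; rewrite !in_itv/=.
    by move=> /andP[/ltW -> /ltW ->] /andP[/ltW -> /ltW ->].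
  apply: le_lt_trans (H n a b ab' tI sd); apply: ler_sum => k _.
  by have [+ + _] := ab k; rewrite !in_itv/= => /FG -> /FG ->.
split.
- split.
  + by split; apply: primitive_abs_cont; [exact: yr|exact: yi].
  + by move=> x; rewrite in_itv/= => xL; split; [exact: (dr _ xL).1|exact: (di _ xL).1].
  + by split; [apply: (ac_open _ _ _ pr)|apply: (ac_open _ _ _ pi)] => x /dE ->.
- have A : {ae mu, forall x, x \in `]0, L[ -> edge_expr q y x = z * y x + g x}.
    move: (primitive_ae_derive pr) (primitive_ae_derive pi).
    apply: filterS2; first exact: (ae_filter_ringOfSetsType mu).
    move=> x hr hi xL; have [_ Dr] := hr xL; have [_ Di] := hi xL.
    have xL' : 0 < x < L by move: xL; rewrite in_itv.
    have near_p : \forall t \near x, cderiv y t = p t.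
      case/andP: xL' => x0 x1; near=> t; apply: dE; apply/andP; split; near: t.
        exact: lt_nbhsr.
      exact: lt_nbhsl.
    have E : cderiv (cderiv y) x = (q x)%:C * y x - z * y x - g x.
      rewrite /cderiv.
      rewrite (_ : derive1 (fun t => Re (cderiv y t)) x = derive1 (Re \o p) x).
        rewrite (_ : derive1 (fun t => Im (cderiv y t)) x = derive1 (Im \o p) x).
          by rewrite Dr Di /=; case: (_ - _ - _).
        by rewrite !derive1E; apply: near_eq_derive; apply: filterS near_p => t /(congr1 (@complex.Im R)).
      by rewrite !derive1E; apply: near_eq_derive; apply: filterS near_p => t /(congr1 (@complex.Re R)).
    by rewrite /edge_expr E; ring.
  move: A (@ae_neq R 0) (@ae_neq R L).
  apply: filterS3; first exact: (ae_filter_ringOfSetsType mu).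
  move=> x h x0 xL; rewrite /= in_itv/= => /andP[x0' xL']; apply: h.
  by rewrite in_itv/= !lt_neqAle eq_sym x0 x0' xL xL'.
- rewrite /cderiv_start /clim (lim_start_eq pr); last by move=> x /dE ->.
  by rewrite (lim_start_eq pi) => [|x /dE ->//] /=; case: (p 0).
- rewrite /cderiv_end /clim (lim_end_eq pr); last by move=> x /dE ->.
  by rewrite (lim_end_eq pi) => [|x /dE ->//] /=; case: (p L).
Unshelve. all: by end_near. Qed.

(** The difference solves the homogeneous equation with zero initial data, and
    [edge_sol_bound] applies to it. *)
Lemma edge_sol_unique z g y p y' p' : cintegrable L g ->
  edge_sol L q z g y p -> edge_sol L q z g y' p' -> y 0 = y' 0 -> p 0 = p' 0 ->
  forall x, 0 <= x <= L -> y x = y' x /\ p x = p' x.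
Proof.
move=> gi S S' y0 p0 x xL.
have D := edge_sol_lin 1 (-1) S S'.
have gi' : cintegrable L (fun x => 1 * g x + -1 * g x) by exact: cintegrable_lin.
have := edge_sol_bound (ltW L0) qi gi' (lexx _) D xL.
rewrite !mul1r !mulN1r y0 p0 !subrr.
have -> : \int[mu]_(t in `[0, L]) l1norm (1 * g t + -1 * g t) = 0.
  rewrite -[RHS](Rintegral_cst0 L); apply: eq_Rintegral => t _.
  by rewrite mul1r mulN1r subrr /l1norm /= normr0 addr0.
rewrite /l1norm /= normr0 !addr0 mulr0 => H.
have h1 := normr_ge0 (Re (y x - y' x)); have h2 := normr_ge0 (Im (y x - y' x)).
have h3 := normr_ge0 (Re (p x - p' x)); have h4 := normr_ge0 (Im (p x - p' x)).
have c0 (c : C) : `|Re c| <= 0 -> `|Im c| <= 0 -> c = 0.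
  by case: c => a b /=; rewrite !normr_le0 => /eqP -> /eqP ->.
by split; apply/eqP; rewrite -subr_eq0; apply/eqP; apply: c0; lra.
Qed.

End Bridge.

(** * The characteristic matrix of a graph *)

Section L1norm.
Context {R : realType}.
Implicit Types a b : R[i].

Lemma l1norm_ge0 a : 0 <= l1norm a. Proof. exact: addr_ge0. Qed.

Lemma l1norm0 : l1norm (0 : R[i]) = 0. Proof. by rewrite /l1norm /= normr0 addr0. Qed.

Lemma l1normD a b : l1norm (a + b) <= l1norm a + l1norm b.
Proof.
case: a b => [a1 a2] [b1 b2]; rewrite /l1norm /=.
have := ler_normD a1 b1; have := ler_normD a2 b2; lra.
Qed.

Lemma l1normN a : l1norm (- a) = l1norm a.
Proof. by case: a => a1 a2; rewrite /l1norm /= !normrN. Qed.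

Lemma l1normB a b : l1norm (a - b) <= l1norm a + l1norm b.
Proof. by rewrite -(l1normN b) l1normD. Qed.

Lemma l1norm_sum (I : Type) (s : seq I) (P : pred I) (f : I -> R[i]) :
  l1norm (\sum_(i <- s | P i) f i) <= \sum_(i <- s | P i) l1norm (f i).
Proof.
apply: (big_ind2 (fun x y => l1norm x <= y)) => //; first by rewrite l1norm0.
by move=> a x b y ax yb; apply: (le_trans (l1normD _ _)); exact: lerD.
Qed.

Lemma l1normM a b : l1norm (a * b) <= l1norm a * l1norm b.
Proof.
case: a b => [a1 a2] [b1 b2]; rewrite /l1norm /=.
have := ler_normB (a1 * b1) (a2 * b2); have := ler_normD (a1 * b2) (a2 * b1).
rewrite !normrM mulrDl !mulrDr; lra.
Qed.

End L1norm.

Section MatrixOf.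
Variables (K : fieldType) (n : nat).

Definition mxof (f : 'rV[K]_n -> 'rV[K]_n) : 'M[K]_n :=
  \matrix_(i, j) f (delta_mx 0 i) 0 j.

Lemma mul_mxof f : (forall a x y, f (a *: x + y) = a *: f x + f y) ->
  forall x, x *m mxof f = f x.
Proof.
move=> fL x.
have f0 : f 0 = 0 by have := fL (-1) 0 0; rewrite !scaler0 addr0 scaleN1r addNr.
have fD a b : f (a + b) = f a + f b by have := fL 1 a b; rewrite !scale1r.
have fZ a b : f (a *: b) = a *: f b by have := fL a b 0; rewrite !addr0 f0 addr0.
rewrite [in RHS](row_sum_delta x).
have -> : f (\sum_j x 0 j *: delta_mx 0 j) = \sum_j x 0 j *: f (delta_mx 0 j).
  apply: (big_ind2 (fun a b => f a = b)) => //.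
  by move=> a b c d <- <-.
apply/rowP => j; rewrite !mxE summxE; apply: eq_bigr => i _.
by rewrite !mxE.
Qed.

End MatrixOf.

Section GraphSolutions.
Context {R : realType} {G : metric_graph R}.
Local Notation mu := (@lebesgue_measure R).
Local Notation C := R[i].
Variables (q : edge G -> R -> R) (alpha : vertex G -> R).
Hypothesis qi : forall j, mu.-integrable `[0, len j] (EFin \o q j).

(** Unknowns and equations are indexed alike: the unknowns are the initial value [inl (j,
    false)] and the initial slope [inl (j, true)] on the edge [j] and the vertex value [inr
    v]; the equations are the continuity at an endpoint and the delta condition at a vertex. *)
Definition unknown : finType := (endpoint G + vertex G)%type.

Local Notation V := 'rV[C]_#|unknown|.
Implicit Types (z w : C) (g h : gfun (G := G)) (x : V).

Definition coord x (i : unknown) : C := x 0 (enum_rank i).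

Lemma coordP x y : (forall i, coord x i = coord y i) -> x = y.
Proof.
by move=> xy; apply/rowP => k; have := xy (enum_val k); rewrite /coord enum_valK.
Qed.

Lemma coordL a x y i : coord (a *: x + y) i = a * coord x i + coord y i.
Proof. by rewrite /coord !mxE. Qed.

Lemma coord0 i : coord 0 i = 0. Proof. by rewrite /coord mxE. Qed.

Lemma coord_row (f : unknown -> C) i : coord (\row_k f (enum_val k)) i = f i.
Proof. by rewrite /coord mxE enum_rankK. Qed.

Definition gintegrable g := forall j, cintegrable (len j) (g j).

Definition solution_pair z g x (j : edge G) : (R -> C) * (R -> C) :=
  xget (fun=> 0, fun=> 0) [set yp | [/\ edge_sol (len j) (q j) z (g j) yp.1 yp.2,
    yp.1 0 = coord x (inl (j, false)) & yp.2 0 = coord x (inl (j, true))]].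

Definition sol z g x : gfun := fun j => (solution_pair z g x j).1.
Definition slope z g x : gfun := fun j => (solution_pair z g x j).2.

Lemma solP z g x j : gintegrable g ->
  [/\ edge_sol (len j) (q j) z (g j) (sol z g x j) (slope z g x j),
    sol z g x j 0 = coord x (inl (j, false)) &
    slope z g x j 0 = coord x (inl (j, true))].
Proof.
move=> gi; rewrite /sol /slope /solution_pair; case: xgetP => [yp _ []//|H].
have [y [p yp]] := edge_sol_exists (ltW (len_gt0 j)) (qi j) z
  (coord x (inl (j, false))) (coord x (inl (j, true))) (gi j).
by case: (H (y, p)).
Qed.

Lemma sol_unique z g x j y p : gintegrable g ->
  edge_sol (len j) (q j) z (g j) y p -> y 0 = coord x (inl (j, false)) ->
  p 0 = coord x (inl (j, true)) ->
  forall t, 0 <= t <= len j -> sol z g x j t = y t /\ slope z g x j t = p t.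
Proof.
move=> gi S y0 p0 t tj; have [S' y0' p0'] := solP z x j gi.
by apply: (edge_sol_unique (len_gt0 j) (qi j) (gi j) S' S) => //;
  rewrite ?y0' ?p0' ?y0 ?p0.
Qed.

Lemma sol_gintegrable z g x : gintegrable g -> gintegrable (sol z g x).
Proof.
by move=> gi j; have [[S _] _ _] := solP z x j gi; exact: cprimitive_cintegrable S.
Qed.

Lemma gintegrable_lin a g h : gintegrable g -> gintegrable h ->
  gintegrable (fun j t => a * g j t + h j t).
Proof.
move=> gi hi j; have := cintegrable_lin a 1 (gi j) (hi j).
by congr cintegrable; apply/funext => t; rewrite mul1r.
Qed.

Lemma sol_lin z a g h x y j t : gintegrable g -> gintegrable h -> 0 <= t <= len j ->
  sol z (fun j t => a * g j t + h j t) (a *: x + y) j t =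
    a * sol z g x j t + sol z h y j t /\
  slope z (fun j t => a * g j t + h j t) (a *: x + y) j t =
    a * slope z g x j t + slope z h y j t.
Proof.
move=> gi hi tj.
have [Sg g0 g1] := solP z x j gi; have [Sh h0 h1] := solP z y j hi.
have := edge_sol_lin a 1 Sg Sh => S.
have S' : edge_sol (len j) (q j) z (fun t => a * g j t + h j t)
    (fun t => a * sol z g x j t + sol z h y j t)
    (fun t => a * slope z g x j t + slope z h y j t).
  by move: S; congr edge_sol; apply/funext => s; rewrite mul1r.
apply: (sol_unique (gintegrable_lin a gi hi) S' _ _ tj).
- by rewrite coordL g0 h0.
- by rewrite coordL g1 h1.
Qed.

Lemma sol_ext z g h x j t : gintegrable g -> gintegrable h ->
  (forall j t, 0 <= t <= len j -> g j t = h j t) -> 0 <= t <= len j ->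
  sol z g x j t = sol z h x j t /\ slope z g x j t = slope z h x j t.
Proof.
move=> gi hi gh tj; have [[P1 [P2r P2i]] y0 p0] := solP z x j hi.
have S : edge_sol (len j) (q j) z (g j) (sol z h x j) (slope z h x j).
  have [rr ri] := cintegrable_rhs (qi j) z P1 (gi j).
  split => //; split.
  - apply: primitive_ae_eq P2r rr _; apply: aeW => s; rewrite in_itv/= => /andP[s0 sL].
    by rewrite gh// !ltW.
  - apply: primitive_ae_eq P2i ri _; apply: aeW => s; rewrite in_itv/= => /andP[s0 sL].
    by rewrite gh// !ltW.
exact: sol_unique S y0 p0 t tj.
Qed.

Lemma gintegrable0 : gintegrable (fun=> fun=> 0).
Proof. by move=> j; split; exact: integrable0. Qed.

(** The left-hand sides of the continuity and delta conditions. The vertex values are unknowns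
    of their own, so that the conditions at a vertex stay linear and local. *)
Definition conditions (y p : gfun (G := G)) x : V :=
  \row_k match enum_val k : unknown with
    | inl e => endpoint_value y e - coord x (inr (vtx e))
    | inr v => \sum_(j | vtx (j, true) == v) p j (len j) -
        \sum_(j | vtx (j, false) == v) p j 0 - (alpha v)%:C * coord x (inr v)
    end.

Lemma conditionsL (y1 p1 y2 p2 : gfun (G := G)) a x1 x2 (y p : gfun (G := G)) :
  (forall j t, 0 <= t <= len j -> y j t = a * y1 j t + y2 j t) ->
  (forall j t, 0 <= t <= len j -> p j t = a * p1 j t + p2 j t) ->
  conditions y p (a *: x1 + x2) = a *: conditions y1 p1 x1 + conditions y2 p2 x2.
Proof.
have h0 (j : edge G) : (0 : R) <= 0 <= len j by rewrite lexx ltW// len_gt0.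
have hL (j : edge G) : 0 <= len j <= len j by rewrite lexx ltW// len_gt0.
move=> yE pE; apply/rowP => k; rewrite !mxE; case: (enum_val k) => [[j b]|v].
  rewrite coordL /endpoint_value/=; case: b; rewrite yE//; ring.
rewrite coordL.
under eq_bigr do rewrite pE//.
under [X in _ - X - _]eq_bigr do rewrite pE//.
rewrite !big_split/= -!mulr_sumr; ring.
Qed.

Definition residual z g x : V := conditions (sol z g x) (slope z g x) x.

Lemma residualL z a g h x y : gintegrable g -> gintegrable h ->
  residual z (fun j t => a * g j t + h j t) (a *: x + y) =
  a *: residual z g x + residual z h y.
Proof.
move=> gi hi.
by apply: conditionsL => j t tj; have [] := sol_lin z a x y gi hi tj.
Qed.

Lemma residual_ext z g h x : gintegrable g -> gintegrable h ->
  (forall j t, 0 <= t <= len j -> g j t = h j t) -> residual z g x = residual z h x.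
Proof.
move=> gi hi gh.
have : conditions (sol z g x) (slope z g x) (0 *: 0 + x) =
    0 *: conditions (sol z h x) (slope z h x) 0 + conditions (sol z h x) (slope z h x) x.
  by apply: conditionsL => j t tj; rewrite mul0r add0r;
    have [] := sol_ext z x gi hi gh tj.
by rewrite !scale0r !add0r.
Qed.

Lemma lin_fun0 (a : C) : (fun (_ : edge G) (_ : R) => a * 0 + 0) = (fun=> fun=> 0 : C).
Proof. by rewrite mulr0 addr0. Qed.

(** The matrix of the homogeneous boundary value problem, acting on row vectors: [x *m charmx
    z = 0] says that the solution with data [x] satisfies all conditions. *)
Definition charmx z : 'M[C]_#|unknown| := mxof (residual z (fun=> fun=> 0)).

(** What a right-hand side [g] contributes to the conditions when the data vanish. *)
Definition source z g : V := residual z g 0.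

Lemma residual_charmx z x : residual z (fun=> fun=> 0) x = x *m charmx z.
Proof.
rewrite mul_mxof// => a u v.
have := residualL z a u v gintegrable0 gintegrable0.
by rewrite lin_fun0.
Qed.

Lemma residualE z g x : gintegrable g -> residual z g x = x *m charmx z + source z g.
Proof.
move=> gi; have := residualL z 1 x 0 gintegrable0 gi.
rewrite !scale1r addr0 residual_charmx => <-; congr (residual z _ x).
by apply/funext => j; apply/funext => t; rewrite mulr0 add0r.
Qed.

Lemma sourceL z a g h : gintegrable g -> gintegrable h ->
  source z (fun j t => a * g j t + h j t) = a *: source z g + source z h.
Proof. by move=> gi hi; have := residualL z a 0 0 gi hi; rewrite scaler0 addr0. Qed.

(** Changing the spectral parameter: the difference of the solutions for [z] and [w] is [z -
    w] times the solution for [z], with zero initial data, of the inhomogeneous equation whose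
    right-hand side is the solution for [w]. *)
Lemma residual_shift z w g x : gintegrable g ->
  residual z g x = residual w g x + (z - w) *: source z (sol w g x).
Proof.
move=> gi; have si := sol_gintegrable w x gi.
rewrite addrC -[LHS]/(conditions _ _ _) /source /residual -[X in conditions _ _ X](_ : (z - w) *: 0 + x = x); last first.
  by rewrite scaler0 add0r.
suff K j t : 0 <= t <= len j ->
    sol z g x j t = (z - w) * sol z (sol w g x) 0 j t + sol w g x j t /\
    slope z g x j t = (z - w) * slope z (sol w g x) 0 j t + slope w g x j t.
  by apply: conditionsL => j t tj; have [] := K j t tj.
have [S1 a1 b1] := solP w x j gi; have [S2 a2 b2] := solP z 0 j si.
have S3 := edge_sol_shift z S1; have S := edge_sol_lin (z - w) 1 S2 S3 => tj.
have S' : edge_sol (len j) (q j) z (g j)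
    (fun t => (z - w) * sol z (sol w g x) 0 j t + sol w g x j t)
    (fun t => (z - w) * slope z (sol w g x) 0 j t + slope w g x j t).
  by move: S; congr edge_sol; apply/funext => s; ring.
apply: (sol_unique gi S' _ _ tj).
- by rewrite a1 a2 coord0 mulr0 add0r.
- by rewrite b1 b2 coord0 mulr0 add0r.
Qed.

Lemma source_shift z w g : gintegrable g ->
  source z g = source w g + (z - w) *: source z (sol w g 0).
Proof. exact: residual_shift. Qed.

Lemma residual_inl z g x e : coord (residual z g x) (inl e) =
  endpoint_value (sol z g x) e - coord x (inr (vtx e)).
Proof. exact: (coord_row (fun i => match i with inl e => _ | inr v => _ end)). Qed.

Lemma residual_inr z g x v : coord (residual z g x) (inr v) =
  \sum_(j | vtx (j, true) == v) slope z g x j (len j) -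
  \sum_(j | vtx (j, false) == v) slope z g x j 0 - (alpha v)%:C * coord x (inr v).
Proof. exact: (coord_row (fun i => match i with inl e => _ | inr v => _ end)). Qed.

(** Taylor's formula of second order for the characteristic matrix, from two changes of the
    spectral parameter. *)
Lemma charmx_expand z w x : x *m charmx z = x *m charmx w +
  (z - w) *: source w (sol w (fun=> fun=> 0) x) +
  (z - w) ^+ 2 *: source z (sol w (sol w (fun=> fun=> 0) x) 0).
Proof.
have i1 := sol_gintegrable w x gintegrable0.
have e1 := residual_charmx z x; have e2 := residual_charmx w x.
have e3 := residual_shift z w x gintegrable0.
apply: (etrans (etrans (esym e1) e3)).
apply: (etrans (congr2 (fun a b => a + (z - w) *: b) e2 (source_shift z w i1))).
move: (x *m charmx w) (source w _) (source z _) => a b c.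
by rewrite scalerDr scalerA addrA.
Qed.

Definition mass g : R := \sum_j \int[mu]_(t in `[0, len j]) l1norm (g j t).

Lemma mass_ge0 g : 0 <= mass g.
Proof. by apply: sumr_ge0 => j _; apply: Rintegral_ge0 => t _; exact: l1norm_ge0. Qed.

Lemma sol_bound (rho : R) : exists2 K, 0 <= K & forall z g x, l1norm z <= rho ->
  gintegrable g -> forall j t, 0 <= t <= len j ->
  l1norm (sol z g x j t) + l1norm (slope z g x j t) <=
    K * (l1norm (coord x (inl (j, false))) + l1norm (coord x (inl (j, true))) +
      \int[mu]_(t in `[0, len j]) l1norm (g j t)).
Proof.
have gr0 j : 0 <= growth (len j) (q j) rho by rewrite mulr_ge0// expR_ge0.
exists (\sum_j growth (len j) (q j) rho); first by apply: sumr_ge0 => j _.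
move=> z g x zr gi j t tj; have [S y0 p0] := solP z x j gi.
apply: (le_trans (edge_sol_bound (ltW (len_gt0 j)) (qi j) (gi j) zr S tj)).
rewrite y0 p0; apply: ler_wpM2r.
  by rewrite !addr_ge0// ?l1norm_ge0//; apply: Rintegral_ge0 => s _; exact: l1norm_ge0.
by rewrite (bigD1 j)//= lerDl; apply: sumr_ge0 => i _.
Qed.

Lemma source_bound (rho : R) : exists2 K, 0 <= K & forall z g k, l1norm z <= rho ->
  gintegrable g -> l1norm (source z g 0 k) <= K * mass g.
Proof.
have [K K0 H] := sol_bound rho; exists (2 * K); first by rewrite mulr_ge0.
move=> z g k zr gi.
have h0 (j : edge G) : (0 : R) <= 0 <= len j by rewrite lexx ltW// len_gt0.
have hL (j : edge G) : 0 <= len j <= len j by rewrite lexx ltW// len_gt0.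
have b j t : 0 <= t <= len j -> l1norm (sol z g 0 j t) + l1norm (slope z g 0 j t) <=
    K * \int[mu]_(t in `[0, len j]) l1norm (g j t).
  by move=> tj; have := H z g 0 zr gi j t tj; rewrite !coord0 !l1norm0 !add0r.
have I0 j : 0 <= \int[mu]_(t in `[0, len j]) l1norm (g j t).
  by apply: Rintegral_ge0 => s _; exact: l1norm_ge0.
have Im j : K * \int[mu]_(t in `[0, len j]) l1norm (g j t) <= K * mass g.
  apply: ler_wpM2l => //; rewrite /mass (bigD1 j)//= lerDl.
  by apply: sumr_ge0 => i _.
have m0 := mass_ge0 g.
rewrite -[k]enum_valK -/(coord _ _) /source; case: (enum_val k) => [[j c]|v].
  rewrite residual_inl coord0 subr0 /endpoint_value/=.
  have bj : forall t, 0 <= t <= len j -> l1norm (sol z g 0 j t) <= 2 * K * mass g.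
    move=> t tj; have := b j t tj; have := Im j; have := l1norm_ge0 (slope z g 0 j t).
    have : 0 <= K * mass g by exact: mulr_ge0.
    lra.
  by case: c; exact: bj.
rewrite residual_inr coord0 mulr0 subr0; apply: (le_trans (l1normB _ _)).
have bs (P : pred (edge G)) (t : edge G -> R) : (forall j, 0 <= t j <= len j) ->
    l1norm (\sum_(j | P j) slope z g 0 j (t j)) <= K * mass g.
  move=> tj; apply: (le_trans (l1norm_sum _ _ _)).
  apply: (@le_trans _ _ (\sum_j l1norm (slope z g 0 j (t j)))).
    rewrite big_mkcond/=; apply: ler_sum => j _; case: ifP => // _; exact: l1norm_ge0.
  rewrite /mass mulr_sumr; apply: ler_sum => j _; apply: le_trans (b j _ (tj j)).
  by rewrite lerDr l1norm_ge0.
have := bs (fun j => vtx (j, true) == v) (fun j => len j) hL.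
have := bs (fun j => vtx (j, false) == v) (fun j => 0) h0.
lra.
Qed.

End GraphSolutions.

(** * Inverses of analytic matrix functions near a simple pole *)

Section ComplexDerivable.
Context {R : realType}.
Local Notation C := (R[i]).
Implicit Types (f g : C^o -> C^o) (z w : C^o).

Lemma derivable_big_sum (I : Type) (s : seq I) (P : pred I) (f : I -> C^o -> C^o) z :
  (forall i, derivable (f i) z 1) ->
  derivable (fun w => \sum_(i <- s | P i) f i w : C^o) z 1.
Proof.
move=> df; elim: s => [|i s ih].
  by under eq_fun do rewrite big_nil; exact: derivable_cst.
under eq_fun do rewrite big_cons; case: (P i); last exact: ih.
exact: derivableD (df i) ih.
Qed.

Lemma derivable_big_prod (I : Type) (s : seq I) (P : pred I) (f : I -> C^o -> C^o) z :
  (forall i, derivable (f i) z 1) ->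
  derivable (fun w => \prod_(i <- s | P i) f i w : C^o) z 1.
Proof.
move=> df; elim: s => [|i s ih].
  by under eq_fun do rewrite big_nil; exact: derivable_cst.
under eq_fun do rewrite big_cons; case: (P i); last exact: ih.
exact: derivableM (df i) ih.
Qed.

Lemma derivable_continuous f z : derivable f z 1 -> {for z, continuous f}.
Proof. by move=> /derivable1_diffP; exact: differentiable_continuous. Qed.

Variable n : nat.
Implicit Types (A B : C -> 'M[C]_n).

Lemma cdiff_cst (M : 'M[C]_n) z : complex_differentiable (fun=> M) z.
Proof. by move=> k l; exact: derivable_cst. Qed.

Lemma cdiffD A B z : complex_differentiable A z -> complex_differentiable B z ->
  complex_differentiable (fun w => A w + B w) z.
Proof.
move=> dA dB k l; under eq_fun do rewrite mxE.
exact: derivableD (dA k l) (dB k l).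
Qed.

Lemma cdiffN A z : complex_differentiable A z ->
  complex_differentiable (fun w => - A w) z.
Proof. by move=> dA k l; under eq_fun do rewrite mxE; exact: derivableN (dA k l). Qed.

Lemma cdiffM A B z : complex_differentiable A z -> complex_differentiable B z ->
  complex_differentiable (fun w => A w *m B w) z.
Proof.
move=> dA dB k l; under eq_fun do rewrite mxE.
by apply: derivable_big_sum => i; exact: derivableM (dA k i) (dB i l).
Qed.

Lemma cdiffZ f A z : derivable f z 1 -> complex_differentiable A z ->
  complex_differentiable (fun w => f w *: A w) z.
Proof.
move=> df dA k l; under eq_fun do rewrite mxE.
exact: derivableM df (dA k l).
Qed.

Lemma derivable_subr (c : C) z : derivable (fun w : C^o => w - c : C^o) z 1.
Proof. by apply: derivableB => //; exact: derivable_cst. Qed.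

Lemma derivable_det A z : complex_differentiable A z ->
  derivable (fun w : C^o => \det (A w) : C^o) z 1.
Proof.
move=> dA; rewrite /determinant; apply: derivable_big_sum => s.
by apply: derivableM; [exact: derivable_cst | apply: derivable_big_prod => i].
Qed.

End ComplexDerivable.

Lemma derivable_adj {R : realType} n (A : R[i] -> 'M[R[i]]_n) (z : R[i]) :
  complex_differentiable A z -> complex_differentiable (fun w => \adj (A w)) z.
Proof.
move=> dA k l; under eq_fun do rewrite mxE /cofactor.
apply: derivableM; first exact: derivable_cst.
apply: derivable_det => i j; under eq_fun do rewrite !mxE.
exact: dA.
Qed.

(** Inverting a matrix polynomial [T0 + c T1 + c^2 T2] for small [c], over any field. In bases
    that make [T0] the projection [P1], multiplying the rows of the complementary projection
    [P2] by [c^-1] leaves a matrix [S c] whose value [S0] at [c = 0] is invertible because no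
    nonzero kernel vector of [T0] is mapped by [T1] into the range of [T0]. *)
Section PoleAlgebra.
Variables (F : fieldType) (n : nat) (T0 T1 : 'M[F]_n).
Hypothesis no_jordan : forall x y : 'rV[F]_n, x *m T0 = 0 -> x *m T1 = y *m T0 -> x = 0.

Definition pole_P1 : 'M[F]_n := pid_mx (\rank T0).
Definition pole_P2 : 'M[F]_n := copid_mx (\rank T0).
Definition pole_conj (M : 'M[F]_n) := invmx (col_ebase T0) *m M *m invmx (row_ebase T0).
Definition pole_S0 := pole_P1 + pole_P2 *m pole_conj T1.
Definition pole_W (T2 : 'M[F]_n) c := pole_P1 *m pole_conj T1 + pole_P2 *m pole_conj T2 +
  c *: (pole_P1 *m pole_conj T2).
Definition pole_S T2 c := pole_S0 + c *: pole_W T2 c.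
Definition pole_residue :=
  invmx (row_ebase T0) *m invmx pole_S0 *m pole_P2 *m invmx (col_ebase T0).
Definition pole_complement := invmx (row_ebase T0) *m invmx pole_S0 *m invmx (col_ebase T0).
Definition pole_regular (Si T2 : 'M[F]_n) c :=
  invmx (row_ebase T0) *m (Si *m pole_P1 - Si *m pole_W T2 c *m invmx pole_S0 *m pole_P2)
    *m invmx (col_ebase T0).

Local Notation P := (col_ebase T0).
Local Notation Q := (row_ebase T0).
Local Notation P1 := pole_P1.
Local Notation P2 := pole_P2.
Let uP : P \in unitmx. Proof. exact: col_ebase_unit. Qed.
Let uQ : Q \in unitmx. Proof. exact: row_ebase_unit. Qed.
Let T0E : P *m P1 *m Q = T0. Proof. exact: mulmx_ebase. Qed.
Let P11 : P1 *m P1 = P1. Proof. by apply: pid_mx_id; exact: rank_leq_row. Qed.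
Let P22 : P2 *m P2 = P2. Proof. by apply: copid_mx_id; exact: rank_leq_row. Qed.
Let P12 : P1 *m P2 = 0. Proof. by apply: mul_pid_mx_copid; exact: rank_leq_row. Qed.
Let P21 : P2 *m P1 = 0. Proof. by apply: mul_copid_mx_pid; exact: rank_leq_row. Qed.
Let P1D2 : P1 + P2 = 1%:M. Proof. by rewrite /P2 /copid_mx addrC subrK. Qed.

Let mulPT0 m (M : 'M[F]_(m, n)) : M *m invmx P *m T0 = M *m P1 *m Q.
Proof. by rewrite -[X in _ *m X = _]T0E !mulmxA mulmxKV. Qed.

Lemma pole_conjK M : P *m pole_conj M *m Q = M.
Proof. by rewrite /pole_conj !mulmxA mulmxV// mul1mx mulmxKV. Qed.

Lemma pole_factor T2 c : P1 + c *: pole_conj T1 + c ^+ 2 *: pole_conj T2 =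
  (P1 + c *: P2) *m pole_S T2 c.
Proof.
rewrite /pole_S /pole_W /pole_S0; move: (pole_conj T1) (pole_conj T2) => U1 U2.
move: (P1) (P2) P11 P12 P21 P22 P1D2 => p1 p2 p11 p12 p21 p22 p1D2.
rewrite -{1}[U1]mul1mx -{1}[U2]mul1mx -p1D2.
rewrite [RHS]mulmxDl -!scalemxAl !mulmxDr -!scalemxAr !mulmxDr -!scalemxAr !mulmxA.
rewrite p11 p12 p22 p21 !mul0mx !scaler0 !addr0 !add0r !mulmxDl !scalerDr !scalerA -!expr2.
by rewrite -!addrA; congr (_ + (_ + _)); rewrite addrCA.
Qed.

Lemma pole_TE T2 c : T0 + c *: T1 + c ^+ 2 *: T2 =
  P *m ((P1 + c *: P2) *m pole_S T2 c) *m Q.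
Proof.
rewrite -pole_factor !mulmxDr !mulmxDl -!scalemxAr -!scalemxAl T0E.
by rewrite !pole_conjK.
Qed.

(** A left kernel vector [x] of [S0] has [x P2 T1 = - x P1] in the adapted bases: this is a
    Jordan chain starting from [x P2]. *)
Lemma pole_S0_unit : pole_S0 \in unitmx.
Proof.
rewrite -row_free_unit -kermx_eq0; apply/eqP/row_matrixP => i; rewrite row0.
set x := row i _.
have xS0 : x *m pole_S0 = 0 by apply/sub_kermxP; exact: row_sub.
pose m := x *m P2 *m invmx P.
have m0 : m = 0.
  apply: (@no_jordan _ (- (x *m invmx P))).
    by rewrite mulPT0 -(mulmxA x) P21 mulmx0 mul0mx.
  have : x *m P2 *m pole_conj T1 = - (x *m P1).
    by apply/eqP; rewrite -addr_eq0 addrC -mulmxA -mulmxDr xS0.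
  rewrite /pole_conj !mulmxA => /(congr1 (mulmx^~ Q)); rewrite mulmxKV// => ->.
  by rewrite !mulNmx mulPT0.
have xP2 : x *m P2 = 0 by have := congr1 (mulmx^~ P) m0; rewrite mulmxKV// mul0mx.
move: xS0; rewrite mulmxDr mulmxA xP2 mul0mx addr0 => xP1.
by rewrite -[x]mulmx1 -P1D2 mulmxDr xP2 xP1 addr0.
Qed.

Lemma pole_residue_ker : pole_residue *m T0 = 0.
Proof.
by rewrite /pole_residue mulPT0 -(mulmxA _ P2) P21 mulmx0 mul0mx.
Qed.

Lemma pole_residue_compl : pole_residue *m T1 + pole_complement *m T0 = 1%:M.
Proof.
have e1 : pole_residue *m T1 = invmx Q *m invmx pole_S0 *m (P2 *m pole_conj T1) *m Q.
  rewrite -[X in _ *m X = _]pole_conjK /pole_residue.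
  by move: (pole_conj T1) => U; rewrite !mulmxA mulmxKV.
have e2 : pole_complement *m T0 = invmx Q *m invmx pole_S0 *m P1 *m Q.
  by rewrite /pole_complement mulPT0.
rewrite e1 e2 -mulmxDl -mulmxDr [_ + P1]addrC -/pole_S0.
by rewrite mulmxKV ?pole_S0_unit// mulVmx.
Qed.

Lemma pole_inverse T2 Si c : c != 0 -> pole_S T2 c *m Si = 1%:M ->
  Si *m pole_S T2 c = 1%:M ->
  let T := T0 + c *: T1 + c ^+ 2 *: T2 in
  T \in unitmx /\ invmx T = c^-1 *: pole_residue + pole_regular Si T2 c.
Proof.
move=> c0 SSi SiS T.
pose X := invmx Q *m (Si *m (P1 + c^-1 *: P2)) *m invmx P.
have DD : (P1 + c *: P2) *m (P1 + c^-1 *: P2) = 1%:M.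
  rewrite mulmxDl !mulmxDr -!scalemxAl -!scalemxAr P11 P12 P21 P22 !scaler0.
  by rewrite scalerA mulfV// scale1r addr0 add0r.
have TX : T *m X = 1%:M.
  rewrite /T pole_TE /X !mulmxA mulmxK// -(mulmxA _ (pole_S T2 c)) SSi mulmx1.
  by rewrite -(mulmxA P) DD mulmx1 mulmxV.
have [uT _] := mulmx1_unit TX; split => //.
have -> : invmx T = X by rewrite -[invmx T]mulmx1 -TX mulmxA mulVmx// mul1mx.
have SiE : Si = invmx pole_S0 - c *: (Si *m pole_W T2 c *m invmx pole_S0).
  have : Si *m pole_S T2 c *m invmx pole_S0 = invmx pole_S0 by rewrite SiS mul1mx.
  rewrite /pole_S mulmxDr mulmxDl mulmxK ?pole_S0_unit// -scalemxAr -scalemxAl.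
  by move=> {1}<-; rewrite addrK.
rewrite /X /pole_residue /pole_regular mulmxDr -scalemxAr {2}SiE mulmxBl -scalemxAl.
rewrite scalerBr scalerA mulVf// scale1r.
rewrite addrCA mulmxDr mulmxDl; congr (_ + _).
by rewrite -scalemxAr -scalemxAl !mulmxA.
Qed.

End PoleAlgebra.

Lemma near_dnbhs {R : realType} (lam : R[i]) (A : R[i] -> Prop) :
  (\forall w \near (lam : R[i]^o), A w) -> \forall w \near (lam : R[i]^o)^', A w.
Proof. exact: nbhs_dnbhs. Qed.

(** The determinant of [S] is continuous and does not vanish at [lam], so near [lam] the only
    singular factor of the inverse is the [c^-1] on the rows of [P2]. The equations for [Rs]
    and [K] are the first two coefficients of [T^-1 T = 1]. *)
Lemma simple_pole_inverse {R : realType} n (lam : R[i]) (T0 T1 : 'M[R[i]]_n)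
    (T2 : R[i] -> 'M[R[i]]_n) :
  (forall z, complex_differentiable T2 z) ->
  (forall x y : 'rV[R[i]]_n, x *m T0 = 0 -> x *m T1 = y *m T0 -> x = 0) ->
  exists (Rs K : 'M[R[i]]_n) (H : R[i] -> 'M[R[i]]_n),
  [/\ Rs *m T0 = 0, Rs *m T1 + K *m T0 = 1%:M, analytic_at H lam &
    \forall z \near (lam : R[i]^o)^',
      T0 + (z - lam) *: T1 + (z - lam) ^+ 2 *: T2 z \in unitmx /\
      invmx (T0 + (z - lam) *: T1 + (z - lam) ^+ 2 *: T2 z) =
        (z - lam)^-1 *: Rs + H z].
Proof.
move=> dT2 nj.
pose S z := pole_S T0 T1 (T2 z) (z - lam).
pose Si z := (\det (S z))^-1 *: \adj (S z).
have dW z : complex_differentiable (fun z => pole_W T0 T1 (T2 z) (z - lam)) z.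
  have dU : complex_differentiable (fun z => pole_conj T0 (T2 z)) z.
    by apply: cdiffM; [apply: cdiffM; [exact: cdiff_cst|exact: dT2]|exact: cdiff_cst].
  apply: cdiffD; first apply: cdiffD.
  - exact: cdiff_cst.
  - by apply: cdiffM dU; exact: cdiff_cst.
  - apply: cdiffZ; first exact: derivable_subr.
    by apply: cdiffM dU; exact: cdiff_cst.
have dS z : complex_differentiable S z.
  apply: cdiffD; first exact: cdiff_cst.
  by apply: cdiffZ (dW z); exact: derivable_subr.
have dSi z : \det (S z) != 0 -> complex_differentiable Si z.
  move=> d0; apply: cdiffZ; last exact: derivable_adj.
  by apply: derivableV => //; exact: derivable_det.
have near0 : \forall z \near (lam : R[i]^o), \det (S z) != 0.
  have c := derivable_continuous (derivable_det (dS lam)).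
  have : \det (S lam) != 0.
    by rewrite /S subrr /pole_S scale0r addr0 -unitfE -unitmxE pole_S0_unit.
  exact: (cvgr_neq0 _ c).
have SSi z : \det (S z) != 0 -> S z *m Si z = 1%:M /\ Si z *m S z = 1%:M.
  move=> d0; rewrite /Si -scalemxAr -scalemxAl mul_mx_adj mul_adj_mx.
  by rewrite scale_scalar_mx mulVf.
exists (pole_residue T0 T1), (pole_complement T0 T1),
  (fun z => pole_regular T0 T1 (Si z) (T2 z) (z - lam)).
split.
- exact: pole_residue_ker.
- exact: pole_residue_compl.
- apply: filterS near0 => z d0.
  apply: cdiffM; last exact: cdiff_cst.
  apply: cdiffM; first exact: cdiff_cst.
  apply: cdiffD; first by apply: cdiffM; [exact: dSi|exact: cdiff_cst].
  apply: cdiffN.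
  apply: cdiffM; last exact: cdiff_cst.
  apply: cdiffM; last exact: cdiff_cst.
  by apply: cdiffM; [exact: dSi|exact: dW].
- have near1 := near_dnbhs near0; have near2 := @nbhs_dnbhs_neq _ (lam : R[i]^o).
  near=> z.
  have zl : z != lam by near: z.
  have d0 : \det (S z) != 0 by near: z.
  have [h1 h2] := SSi z d0.
  by apply: (pole_inverse nj _ h1 h2); rewrite subr_eq0.
Unshelve. all: by end_near. Qed.

(** * Wronskians *)

Section EdgeFacts.
Context {R : realType}.
Local Notation mu := (@lebesgue_measure R).
Local Notation C := R[i].
Variables (L : R).
Hypotheses (L0 : 0 < L).
Implicit Types (F G f g y p : R -> C) (z : C).

Lemma cprimitive_mul F G f g : cprimitive L F f -> cprimitive L G g ->
  cprimitive L (fun x => F x * G x) (fun x => F x * g x + G x * f x).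
Proof.
have L0' := ltW L0.
move=> [Fr Fi] [Gr Gi]; split.
- have := primitive_lin 1 (-1) (primitive_mul L0' Fr Gr) (primitive_mul L0' Fi Gi).
  by apply: primitive_eq => x /=; case: (F x) (G x) => ? ? [? ?] /=;
    [|case: (f x) (g x) => ? ? [? ?] /=]; ring.
- have := primitive_lin 1 1 (primitive_mul L0' Fr Gi) (primitive_mul L0' Fi Gr).
  by apply: primitive_eq => x /=; case: (F x) (G x) => ? ? [? ?] /=;
    [|case: (f x) (g x) => ? ? [? ?] /=]; ring.
Qed.

Lemma cprimitive_conj F f : cprimitive L F f ->
  cprimitive L (fun x => conjc (F x)) (fun x => conjc (f x)).
Proof.
move=> [Fr Fi]; split.
- by apply: primitive_eq Fr => x /=; [case: (F x)|case: (f x)].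
- have := primitive_lin (-1) 0 Fi Fi.
  by apply: primitive_eq => x /=; [case: (F x)|case: (f x)] => ? ? /=; ring.
Qed.

Lemma edge_sol_conj q (lam : R) g y p : edge_sol L q lam%:C g y p ->
  edge_sol L q lam%:C (fun x => conjc (g x)) (fun x => conjc (y x)) (fun x => conjc (p x)).
Proof.
move=> [h k]; split; first exact: cprimitive_conj.
apply: cprimitive_eq (cprimitive_conj k) => // x.
by case: (y x) (g x) => ? ? [? ?]; apply/eqP; rewrite eq_complex /=; apply/andP; split; apply/eqP; ring.
Qed.

(** Lagrange's identity: the terms with [(q - z) y y'] cancel. *)
Lemma wronskian q z g y p y' p' : edge_sol L q z g y p ->
  edge_sol L q z (fun=> 0) y' p' ->
  cprimitive L (fun x => y x * p' x - p x * y' x) (fun x => g x * y' x).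
Proof.
move=> [y1 p1] [y2 p2].
have := cprimitive_lin 1 (-1) (cprimitive_mul y1 p2) (cprimitive_mul p1 y2).
by apply: cprimitive_eq => x; ring.
Qed.

Lemma cprimitive_const F : cprimitive L F (fun=> 0) -> F L = F 0.
Proof.
have h : (0 : R) <= L <= L by rewrite ltW ?lexx.
move=> [[_ /(_ L h) hr] [_ /(_ L h) hi]]; move: hr hi.
rewrite /= !Rintegral_cst0 !addr0; case: (F L) (F 0) => ? ? [? ?] /= hr hi.
by apply/eqP; rewrite eq_complex /= hr hi !eqxx.
Qed.

(** The Wronskian with a solution having arbitrary initial data is constant and vanishes at
    [L]. *)
Lemma edge_sol_end_unique q z y p : mu.-integrable `[0, L] (EFin \o q) ->
  edge_sol L q z (fun=> 0) y p -> y L = 0 -> p L = 0 -> y 0 = 0 /\ p 0 = 0.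
Proof.
move=> qi S yL pL.
have i0 : cintegrable L (fun=> 0 : C) by split; exact: integrable0.
have key a b : y 0 * b - p 0 * a = 0.
  have [y' [p' [S' y0 p0]]] := edge_sol_exists (ltW L0) qi z a b i0.
  have := wronskian S S'; under [X in cprimitive _ _ X]eq_fun do rewrite mul0r.
  by move/cprimitive_const; rewrite yL pL !mul0r subrr y0 p0.
split.
- by have := key 0 1; rewrite mulr1 mulr0 subr0.
- by have /eqP := key 1 0; rewrite mulr1 mulr0 sub0r oppr_eq0 => /eqP.
Qed.

Lemma primitive_ae0 (F f : R -> R) : primitive_on L F f ->
  {ae mu, forall x, x \in `[0, L] -> F x = 0} ->
  (forall x, 0 < x < L -> F x = 0) /\ F 0 = 0.
Proof.
move=> Ff F0.
have Fi : mu.-integrable `[0, L] (EFin \o F).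
  by apply: continuous_compact_integrable; [exact: segment_compact|exact: primitive_continuous Ff].
have P := primitive_indef 0 Fi.
have PE x : x <= L -> 0 + \int[mu]_(t in `[0, x]) F t = 0.
  move=> xL; rewrite add0r -[RHS](Rintegral_cst0 x) /Rintegral; congr fine.
  apply: ae_eq_integral => //.
  - by apply: measurable_funS (measurable_int _ Fi) => //; apply: subset_itvl; rewrite bnd_simp.
  - move: F0; apply: filterS; first exact: (ae_filter_ringOfSetsType mu).
    move=> t h; rewrite /= in_itv/= => /andP[t0 tx].
    by rewrite h// in_itv/= t0 (le_trans tx).
have open0 x : 0 < x < L -> F x = 0.
  move=> /[dup] xL /andP[x0 xL'].
  have [_ <-] := primitive_derive P (primitive_continuous Ff) xL.
  rewrite derive1E (near_eq_derive (g := cst 0)) ?derive_cst//.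
  near=> y; apply: PE; apply: ltW; near: y; exact: lt_nbhsl.
split => //; have cF := primitive_cvg_start L0 Ff.
rewrite -(cvg_lim (@Rhausdorff R) cF) (lim_start_eq L0 P)/= ?Rintegral_itv00 ?addr0//.
by move=> x /[dup] /open0 -> /andP[_ /ltW /PE].
Unshelve. all: by end_near. Qed.

(** A continuous function that vanishes almost everywhere vanishes, and so does its
    derivative. *)
Lemma cprimitive_ae0 y p w : cprimitive L y p -> cprimitive L p w ->
  edge_eq L y (fun=> 0) -> y 0 = 0 /\ p 0 = 0.
Proof.
move=> [yr yi] [pr pi] y0.
have {}y0 : {ae mu, forall x, x \in `[0, L] -> y x = 0} by exact: y0.
have [yr0 yr00] : (forall x, 0 < x < L -> Re (y x) = 0) /\ Re (y 0) = 0.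
  apply: primitive_ae0 yr _; move: y0.
  by apply: filterS; [exact: (ae_filter_ringOfSetsType mu)|move=> x h /h /= ->].
have [yi0 yi00] : (forall x, 0 < x < L -> Im (y x) = 0) /\ Im (y 0) = 0.
  apply: primitive_ae0 yi _; move: y0.
  by apply: filterS; [exact: (ae_filter_ringOfSetsType mu)|move=> x h /h /= ->].
have d0 (F f f' : R -> R) : primitive_on L F f -> primitive_on L f f' ->
    (forall x, 0 < x < L -> F x = 0) -> f 0 = 0.
  move=> Ff ff' F0.
  have f0 x : 0 < x < L -> f x = 0.
    move=> /[dup] xL /andP[x0 xL'].
    have [_ <-] := primitive_derive Ff (primitive_continuous ff') xL.
    rewrite derive1E (near_eq_derive (g := cst 0)) ?derive_cst//.
    near=> t; apply: F0; apply/andP; split; near: t; [exact: lt_nbhsr|exact: lt_nbhsl].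
  have P := primitive_cst L (0 : R).
  by have := primitive_cvg_start L0 ff' => c; rewrite -(cvg_lim (@Rhausdorff R) c)
    (lim_start_eq L0 P)// => x /f0 ->.
have := d0 _ _ _ yr pr yr0; have := d0 _ _ _ yi pi yi0.
move: yr00 yi00 => /=; case: (y 0) (p 0) => ? ? [? ?] /=.
by move=> -> -> -> ->.
Unshelve. all: by end_near. Qed.

End EdgeFacts.

(** * Data vectors, functions on the graph, and unique continuation *)

Section GraphFunctions.
Context {R : realType} {G : metric_graph R}.
Local Notation mu := (@lebesgue_measure R).
Local Notation C := R[i].
Variables (q : edge G -> R -> R) (alpha : vertex G -> R).
Hypothesis qi : forall j, mu.-integrable `[0, len j] (EFin \o q j).
Local Notation sol := (sol q).
Local Notation slope := (slope q).
Local Notation residual := (residual q alpha).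
Local Notation charmx := (charmx q alpha).
Local Notation V := 'rV[C]_#|unknown (G := G)|.
Implicit Types (z w : C) (g h f : gfun (G := G)) (x : V).

Let len0 (j : edge G) : (0 : R) <= 0 <= len j. Proof. by rewrite lexx ltW// len_gt0. Qed.
Let lenL (j : edge G) : 0 <= len j <= len j. Proof. by rewrite lexx ltW// len_gt0. Qed.

(** With [gfun_residual] this translates between data vectors and functions on the graph: the
    [inl] coordinates of the residual vanish exactly for functions that are continuous at the
    vertices, and its [inr] coordinates are their defects in the delta conditions. *)
Lemma residual_gfun z g x (f := sol z g x) : gintegrable g ->
  (forall e, coord (residual z g x) (inl e) = 0) ->
  [/\ L2 f /\ AC2 f, continuous_on_graph f,
    geq (diff_expr q f) (fun j t => z * f j t + g j t),
    forall v, vertex_value f v = coord x (inr v) &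
    forall v, delta_defect alpha f v = coord (residual z g x) (inr v)].
Proof.
move=> gi r0; have S j := solP qi z x j gi.
have ev e : endpoint_value f e = coord x (inr (vtx e)).
  by apply/eqP; rewrite -subr_eq0; have := r0 e; rewrite residual_inl => ->.
have T j := edge_sol_AC2 (len_gt0 j) (gi j) (let: And3 h _ _ := S j in h).
have vv v : vertex_value f v = coord x (inr v).
  by rewrite /vertex_value ev (eqP (xchooseP (vtx_surj v))).
split => //.
- split=> j; last by have [] := T j.
  by have [[h _] _ _] := S j; exact: edge_L2_cprimitive h.
- split=> [j|e e' ee]; last by rewrite !ev ee.
  by have [[[hr hi] _] _ _] := S j; split; [exact: primitive_continuous hr|exact: primitive_continuous hi].
- by move=> j; have [] := T j.
- move=> v; rewrite residual_inr /delta_defect vv; congr (_ - _ - _); apply: eq_bigr => j _.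
  + by have [_ _ _ ->] := T j.
  + by have [_ _ -> _] := T j.
Qed.

Lemma gfun_residual z g f : gintegrable g -> AC2 f -> continuous_on_graph f ->
  geq (diff_expr q f) (fun j t => z * f j t + g j t) ->
  exists x, [/\ forall j t, 0 <= t <= len j -> f j t = sol z g x j t,
    forall v, coord x (inr v) = vertex_value f v,
    forall e, coord (residual z g x) (inl e) = 0 &
    forall v, coord (residual z g x) (inr v) = delta_defect alpha f v].
Proof.
move=> gi fAC [_ fv] fE.
have H j := edge_AC2_sol (len_gt0 j) (qi j) (fAC j) (gi j) (fE j).
pose x : V := \row_k match enum_val k : unknown with
  | inl (j, b) => if b then cderiv_start (f j) else f j 0
  | inr v => vertex_value f v end.
have x1 j : coord x (inl (j, false)) = f j 0.
  exact: (coord_row (fun i => match i with inl (j, b) => _ | inr v => _ end)).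
have x2 j : coord x (inl (j, true)) = cderiv_start (f j).
  exact: (coord_row (fun i => match i with inl (j, b) => _ | inr v => _ end)).
have x3 v : coord x (inr v) = vertex_value f v.
  exact: (coord_row (fun i => match i with inl (j, b) => _ | inr v => _ end)).
have E j t : 0 <= t <= len j -> sol z g x j t = f j t.
  have [p [S p0 pL]] := H j => tj.
  by have [||-> _] := sol_unique qi (x := x) gi S _ _ tj; rewrite ?x1 ?x2.
have E0 j : slope z g x j 0 = cderiv_start (f j).
  have [p [S p0 pL]] := H j.
  by have [||_ ->] := sol_unique qi (x := x) gi S _ _ (len0 j); rewrite ?x1 ?x2.
have EL j : slope z g x j (len j) = cderiv_end (len j) (f j).
  have [p [S p0 pL]] := H j.
  by have [||_ ->] := sol_unique qi (x := x) gi S _ _ (lenL j); rewrite ?x1 ?x2.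
have fvv e : endpoint_value f e = vertex_value f (vtx e).
  by apply: fv; rewrite (eqP (xchooseP (vtx_surj (vtx e)))).
exists x; split => //.
- by move=> j t tj; rewrite E.
- move=> e; rewrite residual_inl x3 -fvv /endpoint_value; case: e => j [] /=; rewrite E ?subrr//.
- move=> v; rewrite residual_inr x3 /delta_defect /normal_derivative.
  by congr (_ - _ - _); apply: eq_bigr => j _; rewrite ?E0 ?EL.
Qed.

Lemma charmx_ker z x e : x *m charmx z = 0 ->
  endpoint_value (sol z (fun=> fun=> 0) x) e = coord x (inr (vtx e)).
Proof.
move=> x0; have := residual_inl q alpha z (fun=> fun=> 0) x e.
by rewrite residual_charmx// x0 coord0 => /esym/eqP; rewrite subr_eq0 => /eqP.
Qed.

Lemma sol_geq0 z x : x *m charmx z = 0 -> geq (sol z (fun=> fun=> 0) x) (fun=> fun=> 0) ->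
  x = 0.
Proof.
move=> x0 s0.
have c0 j b : coord x (inl (j, b)) = 0.
  have [[S1 S2] y0 p0] := solP qi z x j (gintegrable0 (G := G)).
  by have [h1 h2] := cprimitive_ae0 (len_gt0 j) S1 S2 (s0 j); case: b; rewrite -?y0 -?p0.
have sol0 j t : 0 <= t <= len j -> sol z (fun=> fun=> 0) x j t = 0.
  have S : edge_sol (len j) (q j) z (fun=> 0) (fun=> 0 : C) (fun=> 0 : C).
    have P : cprimitive (len j) (fun=> 0 : C) (fun=> 0 : C).
      by split; exact: primitive_cst.
    by split => //; apply: cprimitive_eq P => // s; rewrite !mulr0 !subr0.
  by move=> tj; have [||-> _] := sol_unique qi (x := x) (gintegrable0 (G := G)) S _ _ tj; rewrite ?c0.
apply: coordP => -[[j b]|v]; rewrite coord0 ?c0//.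
have /eqP <- := xchooseP (vtx_surj v); rewrite -(charmx_ker _ x0) /endpoint_value.
by case: (xchoose _) => j [] /=; rewrite sol0.
Qed.


(** Let [E] be the set of edges on which the kernel function [s] is not zero. Where a single
    edge of [E] ends, [s] vanishes: either the vertex is a boundary vertex, or an edge on
    which [s] is zero ends there too; the vertex condition then makes the derivative vanish as
    well, and [s] is zero on the edge. So [E] has no vertex of degree one and lies in the
    core, and [s] vanishes at all vertices: at proper core vertices by assumption, at the
    others because an edge outside [E] ends there. A cycle in [E] would thus make [lam] a
    resonance. *)
Lemma unique_continuation (B : {set vertex G}) (lam : R) x :
  (forall v, boundary_vertex v -> v \in B) -> (forall v, proper_core_vertex v -> v \in B) ->
  ~ resonance q lam -> x *m charmx lam%:C = 0 ->
  (forall v, v \in B -> coord x (inr v) = 0) -> x = 0.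
Proof.
move=> Bb Bc nres x0 xB; set z := lam%:C in x0.
pose s := sol z (fun=> fun=> 0) x; pose p := slope z (fun=> fun=> 0) x.
have S j : edge_sol (len j) (q j) z (fun=> 0) (s j) (p j).
  by have [] := solP qi z x j (gintegrable0 (G := G)).
have ev e : endpoint_value s e = coord x (inr (vtx e)) by exact: charmx_ker.
pose E : {set edge G} := finset.finset (fun j => ~~ ((s j 0 == 0) && (p j 0 == 0))).
have EE j : (j \in E) = ~~ ((s j 0 == 0) && (p j 0 == 0)) by rewrite inE.
clearbody E.
have notE j b : s j (if b then len j else 0) = 0 -> p j (if b then len j else 0) = 0 ->
    j \notin E.
  move=> sj pj; rewrite EE negbK; case: b sj pj => sj pj; last by rewrite sj pj !eqxx.
  by have [-> ->] := edge_sol_end_unique (len_gt0 j) (qi j) (S j) sj pj; rewrite !eqxx.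
have zeroE j : j \notin E -> forall t, 0 <= t <= len j -> s j t = 0 /\ p j t = 0.
  rewrite EE negbK => /andP[/eqP s0 /eqP p0] t tj.
  have P : cprimitive (len j) (fun=> 0 : C) (fun=> 0 : C).
    by split; exact: primitive_cst.
  have S' : edge_sol (len j) (q j) z (fun=> 0) (fun=> 0 : C) (fun=> 0 : C).
    by split => //; apply: cprimitive_eq P => // u; rewrite !mulr0 !subr0.
  exact: (edge_sol_unique (len_gt0 j) (qi j) (gintegrable0 j) (S j) S').
have off e : e.1 \notin E -> coord x (inr (vtx e)) = 0.
  case: e => j b /= jE; rewrite -ev /endpoint_value.
  by case: b => /=; [have [] := zeroE j jE _ (lenL j)|have [] := zeroE j jE _ (len0 j)].
have nd1 : no_degree_one E.
  apply/forallP => v; apply/negP => /eqP deg1.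
  have /eqP/cards1P[e0 e0P] : #|finset.finset (fun e : endpoint G => (e.1 \in E) && (vtx e == v))| = 1%N.
    by rewrite -[RHS]deg1; apply: eq_card => e; apply/idP/idP; rewrite !inE.
  have [e0E /eqP e0v] : e0.1 \in E /\ vtx e0 == v.
    by apply/andP; have := finset.set11 e0; rewrite -e0P inE.
  have only e : vtx e = v -> e != e0 -> e.1 \notin E.
    move=> ve; apply: contra => eE.
    have : e \in finset.finset (fun e : endpoint G => (e.1 \in E) && (vtx e == v)).
      by rewrite inE eE ve eqxx.
    by rewrite e0P finset.in_set1.
  have xv : coord x (inr v) = 0.
    case: (boolP [exists e : endpoint G, (vtx e == v) && (e.1 \notin E)]) => [|all].
      by case/existsP => e /andP[/eqP <- /off].
    apply/xB/Bb; rewrite /boundary_vertex -deg1; apply/eqP/eq_card => e.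
    apply/idP/idP; rewrite !inE; first last.
      by move=> /= /andP[_ ->]; rewrite finset.in_setT.
    move=> /= /andP[_ ve]; rewrite ve andbT; move: all; rewrite negb_exists => /forallP/(_ e).
    by rewrite ve negbK.
  have := residual_inr q alpha z (fun=> fun=> 0) x v.
  rewrite residual_charmx// x0 coord0 xv mulr0 subr0 -/p.
  have p0 j b : vtx (j, b) == v -> (j, b) != e0 -> p j (if b then len j else 0) = 0.
    move=> /eqP jv je; have jE := only (j, b) jv je.
    by case: b jv je jE => jv je jE; [have [] := zeroE j jE _ (lenL j)|have [] := zeroE j jE _ (len0 j)].
  move: e0 e0E e0v {e0P only} p0 => [j0 b0] /= j0E e0v p0.
  have ev0 : s j0 (if b0 then len j0 else 0) = 0 by rewrite -xv -e0v -ev.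
  case: b0 e0v p0 ev0 => e0v p0 ev0.
  - rewrite [X in _ - X]big1 ?subr0; last first.
      by move=> j jv; apply: (p0 j false) => //; apply/eqP => -[].
    rewrite (bigD1 j0) ?e0v//= big1 ?addr0; last first.
      by move=> j /andP[jv jj]; apply: (p0 j true) => //; apply: contra jj => /eqP[->].
    by move=> /esym pj; have := notE j0 true ev0 pj; rewrite j0E.
  - rewrite [X in X - _]big1 ?sub0r; last first.
      by move=> j jv; apply: (p0 j true) => //; apply/eqP => -[].
    rewrite (bigD1 j0) ?e0v//= big1 ?addr0; last first.
      by move=> j /andP[jv jj]; apply: (p0 j false) => //; apply: contra jj => /eqP[->].
    by move=> /esym/eqP; rewrite oppr_eq0 => /eqP pj; have := notE j0 false ev0 pj; rewrite j0E.
have Ecore : E \subset core G := sub_core nd1.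
have val0 v : coord x (inr v) = 0.
  case: (boolP (proper_core_vertex v)) => [/Bc/xB//|].
  rewrite negb_forall => /existsP[e]; rewrite negb_imply => /andP[/eqP <- ec].
  by apply: off; apply: contra ec; exact: (fintype.subsetP Ecore).
have E0 : E = finset.set0.
  apply/eqP; apply: contrapT => /negP En0.
  have [c cyc cE] := exists_cycle nd1 En0; apply: nres; exists c => // d dc.
  exists (s d.1); have [a1 a2 _ _] := edge_sol_AC2 (len_gt0 d.1) (gintegrable0 d.1) (S d.1).
  have [P1 P2] := S d.1; split => //.
  - exact: edge_L2_cprimitive P1.
  - by split; have := ev (d.1, false); have := ev (d.1, true); rewrite !val0.
  - by move: a2; congr edge_eq; apply/funext => t; rewrite addr0.
  - move=> /(cprimitive_ae0 (len_gt0 d.1) P1 P2)[s0 p0].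
    by have := cE d dc; rewrite EE s0 p0 !eqxx.
apply: (sol_geq0 x0) => j; apply: aeW => t /=; rewrite in_itv/= => tj.
have jE : j \notin E by rewrite E0 inE.
by have [] := zeroE j jE t tj.
Qed.

End GraphFunctions.

(** * Green's formula *)

Section Green.
Context {R : realType} {G : metric_graph R}.
Local Notation mu := (@lebesgue_measure R).
Local Notation C := R[i].
Variables (q : edge G -> R -> R) (alpha : vertex G -> R).
Hypothesis qi : forall j, mu.-integrable `[0, len j] (EFin \o q j).
Local Notation sol := (sol q).
Local Notation slope := (slope q).
Local Notation residual := (residual q alpha).
Local Notation source := (source q alpha).
Local Notation charmx := (charmx q alpha).
Local Notation V := 'rV[C]_#|unknown (G := G)|.
Implicit Types (z w : C) (g h f : gfun (G := G)) (x y : V) (lam : R).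

Lemma sum_by_vertex (c : vertex G -> C) (b : bool) (F : edge G -> C) :
  \sum_j c (vtx (j, b)) * F j = \sum_v c v * \sum_(j | vtx (j, b) == v) F j.
Proof.
rewrite (partition_big (fun j => vtx (j, b)) xpredT)//=; apply: eq_bigr => v _.
by rewrite mulr_sumr; apply: eq_bigr => j /eqP ->.
Qed.

Definition bracket lam g x y (j : edge G) (t : R) : C :=
  sol lam%:C g y j t * conjc (slope lam%:C (fun=> fun=> 0) x j t) -
  slope lam%:C g y j t * conjc (sol lam%:C (fun=> fun=> 0) x j t).

Lemma bracket_primitive lam g x y j : gintegrable g ->
  cprimitive (len j) (bracket lam g x y j)
    (fun t => g j t * conjc (sol lam%:C (fun=> fun=> 0) x j t)).
Proof.
move=> gi; have [S _ _] := solP qi lam%:C y j gi.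
have [S' _ _] := solP qi lam%:C x j (gintegrable0 (G := G)).
apply: (wronskian (len_gt0 j) S); have := edge_sol_conj S'.
by congr edge_sol; apply/funext => t; rewrite rmorph0.
Qed.

(** Integrate Lagrange's identity over each edge and collect the boundary terms at the
    vertices: the conditions satisfied by [x] cancel everything except the defects of [y]. *)
Lemma green lam g x y : gintegrable g -> x *m charmx lam%:C = 0 ->
  (forall e, coord (residual lam%:C g y) (inl e) = 0) ->
  \sum_j (bracket lam g x y j (len j) - bracket lam g x y j 0) =
  - \sum_v coord (residual lam%:C g y) (inr v) * conjc (coord x (inr v)).
Proof.
move=> gi x0 y0.
have xe e : endpoint_value (sol lam%:C (fun=> fun=> 0) x) e = coord x (inr (vtx e)).
  have := charmx_ker qi e x0.
  exact.
have ye e : endpoint_value (sol lam%:C g y) e = coord y (inr (vtx e)).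
  by apply/eqP; rewrite -subr_eq0; have := y0 e; rewrite residual_inl => ->.
have xv v := residual_inr q alpha lam%:C (fun=> fun=> 0) x v.
have yv v := residual_inr q alpha lam%:C g y v.
rewrite residual_charmx// x0 in xv.
rewrite sumrB /bracket !sumrB.
transitivity (\sum_v coord y (inr v) * conjc (\sum_(j | vtx (j, true) == v) slope lam%:C (fun=> fun=> 0) x j (len j))
  - \sum_v conjc (coord x (inr v)) * (\sum_(j | vtx (j, true) == v) slope lam%:C g y j (len j))
  - (\sum_v coord y (inr v) * conjc (\sum_(j | vtx (j, false) == v) slope lam%:C (fun=> fun=> 0) x j 0)
  - \sum_v conjc (coord x (inr v)) * (\sum_(j | vtx (j, false) == v) slope lam%:C g y j 0))).
  have -> : forall b (t : edge G -> R), \sum_v coord y (inr v) * conjc (\sum_(j | vtx (j, b) == v) slope lam%:C (fun=> fun=> 0) x j (t j)) = \sum_v coord y (inr v) * (\sum_(j | vtx (j, b) == v) conjc (slope lam%:C (fun=> fun=> 0) x j (t j))).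
    by move=> b t; apply: eq_bigr => v _; rewrite rmorph_sum.
  have -> : \sum_v coord y (inr v) * conjc (\sum_(j | vtx (j, false) == v) slope lam%:C (fun=> fun=> 0) x j 0) = \sum_v coord y (inr v) * (\sum_(j | vtx (j, false) == v) conjc (slope lam%:C (fun=> fun=> 0) x j 0)).
    by apply: eq_bigr => v _; rewrite rmorph_sum.
  rewrite -!sum_by_vertex; congr (_ - _ - (_ - _)); apply: eq_bigr => j _.
  - by rewrite -(ye (j, true)).
  - by rewrite -(xe (j, true)) mulrC.
  - by rewrite -(ye (j, false)).
  - by rewrite -(xe (j, false)) mulrC.
rewrite -!sumrB -sumrN; apply: eq_bigr => v _.
have := xv v; have := yv v; rewrite coord0 => -> /(congr1 conjc).
rewrite rmorph0 !rmorphB rmorphM /= oppr0 -[alpha v +i* 0]/((alpha v)%:C).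
move: (conjc (coord x _)) (conjc (\sum_(_ | _) _)) (conjc (\sum_(_ | _) _)) => a b c.
move: (coord y _) (\sum_(_ | _) _) (\sum_(_ | _) _) ((alpha v)%:C) => u d e k h.
have -> : c = b + k * a by apply/eqP; rewrite -subr_eq0 opprD addrA -h.
ring.
Qed.

Lemma green_homogeneous lam x y : x *m charmx lam%:C = 0 ->
  (forall e, coord (y *m charmx lam%:C) (inl e) = 0) ->
  \sum_v coord (y *m charmx lam%:C) (inr v) * conjc (coord x (inr v)) = 0.
Proof.
move=> x0; rewrite -residual_charmx// => y0.
have := green (gintegrable0 (G := G)) x0 y0.
rewrite big1 => [/esym/eqP|j _]; first by rewrite oppr_eq0 => /eqP.
have := bracket_primitive lam x y j (gintegrable0 (G := G)).
under [X in cprimitive _ _ X]eq_fun do rewrite mul0r.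
by move/(cprimitive_const (len_gt0 j)) => ->; rewrite subrr.
Qed.

(** If a kernel function [f] were in the range, Green's formula for [f] and a preimage would
    give the integral of [|f|^2] the value zero. *)
Lemma no_jordan_chain lam x y : x *m charmx lam%:C = 0 ->
  source lam%:C (sol lam%:C (fun=> fun=> 0) x) = y *m charmx lam%:C -> x = 0.
Proof.
move=> x0 h; set f := sol lam%:C (fun=> fun=> 0) x in h.
have fi : gintegrable f := sol_gintegrable qi lam%:C x (gintegrable0 (G := G)).
have r0 : residual lam%:C f (- y) = 0 by rewrite residualE// h mulNmx addNr.
have sum0 : \sum_j (bracket lam f x (- y) j (len j) - bracket lam f x (- y) j 0) = 0.
  rewrite green//; last by move=> e; rewrite r0 coord0.
  by rewrite r0 big1 ?oppr0// => v _; rewrite coord0 mul0r.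
have B j := bracket_primitive lam x (- y) j fi.
pose I j := \int[mu]_(t in `[0, len j]) complex.Re (f j t * conjc (f j t)).
have hL (j : edge G) : (0 : R) <= len j <= len j by rewrite lexx ltW// len_gt0.
have ReE j : complex.Re (bracket lam f x (- y) j (len j) - bracket lam f x (- y) j 0) = I j.
  have [[_ /(_ _ (hL j)) BE] _] := B j; move: BE => /=.
  move: (bracket _ _ _ _ _ _) (bracket _ _ _ _ _ _) => [a b] [c d] /= ->.
  by rewrite addrC addKr.
have ReS (s : edge G -> C) : complex.Re (\sum_j s j) = \sum_j complex.Re (s j).
  by rewrite (big_morph (@complex.Re R) (id1 := 0) (op1 := +%R))//; case=> a b [c d].
move: sum0 => /(congr1 (@complex.Re R)); rewrite ReS (eq_bigr _ (fun j _ => ReE j)) /=.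
have nn (c : C) : complex.Re (c * conjc c) = complex.Re c ^+ 2 + complex.Im c ^+ 2.
  by case: c => a b /=; ring.
have nn0 (c : C) : 0 <= complex.Re (c * conjc c) by rewrite nn addr_ge0// sqr_ge0.
move=> /eqP; rewrite psumr_eq0 => [/allP I0|j _]; last by apply: Rintegral_ge0.
apply: (sol_geq0 qi x0) => j; have /eqP Ij := I0 j (mem_index_enum _).
have [[ri _] _] := B j.
have : (\int[mu]_(t in `[0%R, len j]) `|(complex.Re (f j t * conjc (f j t)))%:E| = 0)%E.
  under eq_integral do rewrite gee0_abs ?lee_fin//.
  have F := integrable_fin_num _ ri => //; have {}F := F (measurable_itv _).
  by rewrite -[LHS](fineK F); congr EFin; exact: Ij.
move=> /(proj1 (ae_eq_integral_abs mu (measurable_itv _) (measurable_int mu ri))).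
move=> H; have {}H : {ae mu, forall t, t \in `[0, len j] -> complex.Re (f j t * conjc (f j t)) = 0}.
  by apply: filterS H => t ht tj; have /(congr1 fine) := ht tj.
suff : {ae mu, forall t, t \in `[0, len j] -> f j t = 0} by [].
apply: filterS H; first exact: (ae_filter_ringOfSetsType mu).
move=> t ht tj; have /eqP := ht tj; rewrite nn.
rewrite paddr_eq0 ?sqr_ge0// !sqrf_eq0; case: (f j t) => a b /= /andP[/eqP -> /eqP ->].
by [].
Qed.

End Green.

(** * The resolvent *)

Section SquareIntegrable.
Context {R : realType}.
Local Notation mu := (@lebesgue_measure R).
Local Notation C := R[i].
Variables (L : R).
Hypotheses (L0 : 0 <= L).
Implicit Types (f g : R -> C).

Definition sqabs (a : C) : R := Re a ^+ 2 + Im a ^+ 2.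

Lemma sqabs_ge0 a : 0 <= sqabs a. Proof. by rewrite addr_ge0// sqr_ge0. Qed.

Lemma edge_L2P f : edge_L2 L f <->
  [/\ measurable_fun `[0, L] (Re \o f), measurable_fun `[0, L] (Im \o f) &
    mu.-integrable `[0, L] (EFin \o (sqabs \o f))].
Proof.
have sqE : (\int[mu]_(x in `[0%R, L]) `|(EFin \o (sqabs \o f)) x| = edge_sqnorm L f)%E.
  by apply: eq_integral => x _ /=; rewrite ger0_norm// sqabs_ge0.
split=> [[mr mi fo]|[mr mi /integrableP[_ fo]]].
- split => //; apply/integrableP; split; last by rewrite sqE.
  apply/measurable_EFinP; rewrite /sqabs /comp/=.
  by apply: measurable_funD; apply: measurable_funX.
- by split => //; rewrite -sqE.
Qed.

Lemma edge_sqnormE f : edge_L2 L f ->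
  edge_sqnorm L f = (\int[mu]_(x in `[0, L]) sqabs (f x))%:E.
Proof.
by move=> /edge_L2P[_ _ fi]; rewrite /Rintegral fineK//; exact: integrable_fin_num fi.
Qed.

Lemma edge_L2_cintegrable f : edge_L2 L f -> cintegrable L f.
Proof.
move=> /edge_L2P[mr mi fi].
have gi : mu.-integrable `[0, L] (EFin \o (fun x => 1 * 1 + 1 * sqabs (f x))).
  exact: (integrable_lin 1 1 (integrable_cst1 L 1) fi).
have h (a b : R) : `|a| <= 1 + (a ^+ 2 + b ^+ 2).
  rewrite -real_normK ?num_real//; have := sqr_ge0 (`|a| - 1); have := sqr_ge0 b; nra.
split; apply: le_integrable gi => //; try exact/measurable_EFinP.
- move=> x _ /=; rewrite lee_fin !mul1r [leRHS]ger0_norm ?addr_ge0 ?sqr_ge0//.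
  exact: h.
- move=> x _ /=; rewrite lee_fin !mul1r [leRHS]ger0_norm ?addr_ge0 ?sqr_ge0//.
  by rewrite /sqabs [X in 1 + X]addrC; exact: h.
Qed.

Lemma edge_L2_lin a f g : edge_L2 L f -> edge_L2 L g -> edge_L2 L (fun x => a * f x + g x).
Proof.
move=> /edge_L2P[fr fi f2] /edge_L2P[gr gi g2]; apply/edge_L2P; case: a => ar ai.
have mr : measurable_fun `[0, L] (Re \o (fun x => (ar +i* ai) * f x + g x)).
  rewrite [X in measurable_fun _ X](_ : _ =
      (fun x => ar * (Re \o f) x - ai * (Im \o f) x + (Re \o g) x)); last first.
    by apply/funext => x /=; case: (f x) (g x) => ? ? [? ?].
  by apply: measurable_funD => //; apply: measurable_funB; apply: measurable_funM => //;
    exact: measurable_cst.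
have mi : measurable_fun `[0, L] (Im \o (fun x => (ar +i* ai) * f x + g x)).
  rewrite [X in measurable_fun _ X](_ : _ =
      (fun x => ar * (Im \o f) x + ai * (Re \o f) x + (Im \o g) x)); last first.
    by apply/funext => x /=; case: (f x) (g x) => ? ? [? ?].
  by apply: measurable_funD => //; apply: measurable_funD; apply: measurable_funM => //;
    exact: measurable_cst.
split=> //.
apply: (@le_integrable _ _ _ mu _ _ _
  (EFin \o (fun x => 2 * (ar ^+ 2 + ai ^+ 2) * sqabs (f x) + 2 * sqabs (g x)))) => //; last first.
  exact: integrable_lin.
  move=> x _ /=; rewrite lee_fin ger0_norm ?sqabs_ge0// ger0_norm; last first.
    by rewrite addr_ge0// !mulr_ge0 ?sqabs_ge0// addr_ge0// sqr_ge0.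
  rewrite /sqabs; case: (f x) (g x) => a b [c d] /=.
  have := sqr_ge0 (ar * a - ai * b - c); have := sqr_ge0 (ar * b + ai * a - d); nra.
by apply/measurable_EFinP; apply: measurable_funD; apply: measurable_funX.
Qed.

Lemma Rintegral_cst_itv (c : R) : \int[mu]_(x in `[0, L]) c = c * L.
Proof.
move: L0; rewrite le_eqVlt => /predU1P[<-|L0']; first by rewrite Rintegral_itv00 mulr0.
by rewrite Rintegral_cst//= lebesgue_measure_itv/= lte_fin L0' sube0.
Qed.

Lemma edge_sqnorm_le f (K : R) : edge_L2 L f ->
  (forall t, 0 <= t <= L -> sqabs (f t) <= K) -> (edge_sqnorm L f <= (K * L)%:E)%E.
Proof.
move=> f2 fK; rewrite edge_sqnormE// lee_fin -Rintegral_cst_itv.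
apply: le_Rintegral => //; first by have /edge_L2P[] := f2.
- exact: integrable_cst1.
Qed.

(** Sum of the bounds [|c| <= t / 2 + c^2 / (2 t)] for the real and the imaginary part. *)
Lemma integral_l1norm_le f t : edge_L2 L f -> 0 < t ->
  \int[mu]_(x in `[0, L]) l1norm (f x) <=
    t * L + (\int[mu]_(x in `[0, L]) sqabs (f x)) / (2 * t).
Proof.
move=> f2 t0; have [fr fi] := edge_L2_cintegrable f2; have /edge_L2P[_ _ fs] := f2.
have -> : t * L + (\int[mu]_(x in `[0, L]) sqabs (f x)) / (2 * t) =
    \int[mu]_(x in `[0, L]) (t + (2 * t)^-1 * sqabs (f x)).
  rewrite (@RintegralD _ _ _ mu `[0, L] (fun=> t) (fun x => (2 * t)^-1 * sqabs (f x)))//.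
  - by rewrite Rintegral_cst_itv RintegralZl// [X in _ + X]mulrC.
  - exact: integrable_cst1.
  - have := integrable_lin (2 * t)^-1 0 fs fs; apply: eq_integrable => // x _ /=.
    by rewrite mul0r addr0.
apply: le_Rintegral => //.
- have := integrable_lin 1 1 (integrable_normr fr) (integrable_normr fi).
  by apply: eq_integrable => // x _ /=; rewrite !mul1r.
- have := integrable_lin 1 (2 * t)^-1 (integrable_cst1 L t) fs.
  by apply: eq_integrable => // x _ /=; rewrite !mul1r.
move=> x _; rewrite /l1norm /sqabs; case: (f x) => a b /=.
have h (c : R) : `|c| <= t / 2 + (2 * t)^-1 * c ^+ 2.
  rewrite -subr_ge0 -real_normK ?num_real//.
  have -> : t / 2 + (2 * t)^-1 * `|c| ^+ 2 - `|c| = (2 * t)^-1 * (t - `|c|) ^+ 2.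
    by field; rewrite gt_eqF.
  by rewrite mulr_ge0 ?sqr_ge0// invr_ge0 mulr_ge0// ltW.
have := h a; have := h b; rewrite mulrDr; lra.
Qed.

End SquareIntegrable.

Section Resolvent.
Context {R : realType} {G : metric_graph R}.
Local Notation mu := (@lebesgue_measure R).
Local Notation C := R[i].
Variables (q : edge G -> R -> R) (alpha : vertex G -> R).
Hypothesis qi : forall j, mu.-integrable `[0, len j] (EFin \o q j).
Local Notation sol := (sol q).
Local Notation residual := (residual q alpha).
Local Notation source := (source q alpha).
Local Notation charmx := (charmx q alpha).
Local Notation V := 'rV[C]_#|unknown (G := G)|.
Implicit Types (z w : C) (g h f : gfun (G := G)) (x y : V).

Let len0 (j : edge G) : 0 <= len j. Proof. by rewrite ltW// len_gt0. Qed.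

Lemma L2_gintegrable h : L2 h -> gintegrable h.
Proof. by move=> h2 j; exact: edge_L2_cintegrable (h2 j). Qed.

Lemma L2_lin a f g : L2 f -> L2 g -> L2 (fun j t => a * f j t + g j t).
Proof. by move=> f2 g2 j; exact: edge_L2_lin. Qed.

Definition sqmass h : R := \sum_j \int[mu]_(t in `[0, len j]) sqabs (h j t).

Lemma sqnormE h : L2 h -> sqnorm h = (sqmass h)%:E.
Proof.
by move=> h2; rewrite /sqnorm /sqmass -sumEFin; apply: eq_bigr => j _; rewrite edge_sqnormE.
Qed.

(** The inequality of Cauchy and Schwarz, from the bound of [integral_l1norm_le] with a
    suitable parameter. *)
Lemma mass_sqr h : L2 h -> mass h ^+ 2 <= 2 * (\sum_(j : edge G) len j) * sqmass h.
Proof.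
move=> h2; set l := \sum_(j : edge G) len j.
have l0 : 0 < l.
  rewrite /l (bigD1 (Ordinal (nedges_gt0 G)))//= ltr_pwDl ?len_gt0//.
  by apply: sumr_ge0 => j _.
have H t : 0 < t -> mass h <= t * l + sqmass h / (2 * t).
  move=> t0; rewrite /mass /sqmass /l mulr_sumr mulr_suml -big_split/=.
  by apply: ler_sum => j _; exact: integral_l1norm_le.
have s0 : 0 <= sqmass h.
  by apply: sumr_ge0 => j _; apply: Rintegral_ge0 => t _; exact: sqabs_ge0.
have := mass_ge0 h; rewrite le_eqVlt => /predU1P[<-|m0].
  by rewrite expr0n/= mulr_ge0// mulr_ge0// ltW.
(* For this parameter the first summand of the bound is half of the mass. *)
have := H (mass h / (2 * l)) (divr_gt0 m0 (mulr_gt0 (ltr0Sn _ 1) l0)).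
have -> : mass h / (2 * l) * l + sqmass h / (2 * (mass h / (2 * l))) =
    mass h / 2 + l * sqmass h / mass h by field; rewrite !gt_eqF.
rewrite -(ler_pM2r m0) mulrDl divfK ?gt_eqF// expr2; nra.
Qed.

Lemma sqabs_le (a : C) (K : R) : l1norm a <= K -> sqabs a <= K ^+ 2.
Proof.
move=> aK; apply: (@le_trans _ _ (l1norm a ^+ 2)).
  rewrite /l1norm /sqabs; case: a {aK} => u v /=.
  rewrite -(real_normK (num_real u)) -(real_normK (num_real v)).
  have := normr_ge0 u; have := normr_ge0 v; nra.
by rewrite lerXn2r// ?nnegrE ?l1norm_ge0// (le_trans (l1norm_ge0 a)).
Qed.

(** Solving [(A - z) f = h] amounts to choosing the data [x] so that the residual vanishes,
    which is a linear system with the matrix [charmx z]; the data and then the solution are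
    bounded by the mass of [h], hence by its norm. *)
Lemma unit_resolvent z : charmx z \in unitmx -> resolvent_set q alpha z.
Proof.
move=> uz; split.
- move=> h h2; have hi := L2_gintegrable h2.
  pose x := - source z h *m invmx (charmx z).
  have r0 : residual z h x = 0.
    by rewrite residualE// /x mulmxKV// addNr.
  have r00 e : coord (residual z h x) (inl e) = 0 by rewrite r0 coord0.
  have [[f2 fAC] fc fE _ fd] := residual_gfun qi hi r00.
  exists (sol z h x), (fun j t => z * sol z h x j t + h j t); split.
    split => //; first exact: L2_lin.
    by move=> v; rewrite fd r0 coord0.
  by move=> j; apply: aeW => t _; ring.
- have [K0 K00 H0] := source_bound alpha qi (l1norm z).
  have [K1 K10 H1] := sol_bound qi (l1norm z).
  pose Kx := K0 * \sum_k \sum_i l1norm (invmx (charmx z) k i).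
  pose l := \sum_(j : edge G) len j.
  exists ((K1 * (2 * Kx + 1)) ^+ 2 * l * (2 * l)) => f g [[f2 fAC] g2 fE fc fd].
  pose h' : gfun := fun j t => - z * f j t + g j t.
  rewrite (_ : (fun j t => g j t - z * f j t) = h'); last first.
    by apply/funext => j; apply/funext => t; rewrite /h'; ring.
  (* The data of [f] are recovered from [h'] by inverting the linear system. *)
  have h2 : L2 h' by exact: L2_lin.
  have hi := L2_gintegrable h2.
  have [|x [fx _ r1 r2]] := gfun_residual alpha qi (z := z) hi fAC fc.
    by move=> j; move: (fE j); congr edge_eq; apply/funext => t; rewrite /h'; ring.
  have r0 : residual z h' x = 0 by apply: coordP => -[e|v]; rewrite coord0 ?r1 ?r2.
  have xE : x = - source z h' *m invmx (charmx z).
    by rewrite -[LHS](mulmxK uz); congr (_ *m _); apply/eqP;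
      rewrite -subr_eq0 opprK -residualE ?r0.
  have m0 := mass_ge0 h'.
  have xb i : l1norm (coord x i) <= Kx * mass h'.
    rewrite /coord xE mxE; apply: (le_trans (l1norm_sum _ _ _)).
    rewrite /Kx mulrAC mulr_sumr; apply: ler_sum => k _.
    apply: (le_trans (l1normM _ _)); rewrite mxE l1normN.
    apply: ler_pM; rewrite ?l1norm_ge0//; first exact: H0.
    rewrite (bigD1 (enum_rank i))//= lerDl; apply: sumr_ge0 => ? _; exact: l1norm_ge0.
  have Ij j : \int[mu]_(t in `[0, len j]) l1norm (h' j t) <= mass h'.
    rewrite /mass (bigD1 j)//= lerDl; apply: sumr_ge0 => ? _.
    by apply: Rintegral_ge0 => t _; exact: l1norm_ge0.
  have fb j t : 0 <= t <= len j -> l1norm (f j t) <= K1 * (2 * Kx + 1) * mass h'.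
    move=> tj; rewrite fx//; have := H1 z h' x (lexx _) hi j t tj.
    move=> H; apply: le_trans (le_trans _ H) _; first by rewrite lerDl l1norm_ge0.
    rewrite -mulrA; apply: ler_wpM2l => //.
    have := xb (inl (j, false)); have := xb (inl (j, true)); have := Ij j; lra.
  rewrite (sqnormE h2); apply: (@le_trans _ _ (\sum_j ((K1 * (2 * Kx + 1) * mass h') ^+ 2 * len j)%:E)%E).
    apply: lee_sum => j _; apply: edge_sqnorm_le => // t tj; apply: sqabs_le; exact: fb.
  rewrite sumEFin -EFinM lee_fin -mulr_sumr -/l exprMn.
  have := mass_sqr h2; rewrite -/l => H.
  have A0 : 0 <= (K1 * (2 * Kx + 1)) ^+ 2 * l.
    by rewrite mulr_ge0 ?sqr_ge0//; apply: sumr_ge0 => j _.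
  have := ler_wpM2l A0 H; move: (_ ^+ 2) (mass h' ^+ 2) => A m; lra.
Qed.

End Resolvent.

(** * Analyticity of the characteristic matrix and the Titchmarsh--Weyl matrix *)

Section ComplexNorm.
Context {R : realType}.
Local Notation C := R[i].

Lemma norm_le_l1norm (a : C) : `|a| <= (l1norm a)%:C.
Proof.
rewrite normc_def lecR -(ger0_norm (l1norm_ge0 a)) -sqrtr_sqr; apply: ler_wsqrtr.
rewrite /l1norm; case: a => u v /=.
rewrite -(real_normK (num_real u)) -(real_normK (num_real v)).
have := normr_ge0 u; have := normr_ge0 v; nra.
Qed.

Lemma l1norm_le_norm (a : C) : (l1norm a)%:C <= 2 * `|a|.
Proof.
rewrite normc_def -[2]/((1 + 1) : C) mulrDl !mul1r -rmorphD/= lecR; apply: lerD.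
- by rewrite -sqrtr_sqr; apply: ler_wsqrtr; rewrite lerDl sqr_ge0.
- by rewrite -sqrtr_sqr; apply: ler_wsqrtr; rewrite lerDr sqr_ge0.
Qed.

(** The difference quotient at [z] is [b + (w - z) r w], and [r] is bounded near [z]. *)
Lemma derivable_expansion (f : C^o -> C^o) (z a b : C) (r : C -> C) (K : R) :
  (forall w, f w = a + (w - z) * b + (w - z) ^+ 2 * r w) ->
  (forall w, l1norm (w - z) <= 1 -> l1norm (r w) <= K) ->
  derivable f z 1.
Proof.
move=> fE rK; have K0 : 0 <= K.
  by apply: le_trans (rK z _); rewrite ?l1norm_ge0// subrr l1norm0.
have K1 : (0 : C) < K%:C + 1.
  by rewrite ltr_wpDl// -[0]/(0%:C) lecR.
apply/cvg_ex; exists b; apply/(@cvgrPdist_le _ _ _ _ (dnbhs_filter _)) => e e0.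
have h2 : (0 : C) < 2^-1 by rewrite invr_gt0.
near=> h.
have hn0 : h != 0 by near: h; exact: nbhs_dnbhs_neq.
have -> : h^-1 *: ((f \o shift (z : C^o)) (h *: 1) - f z) = b + h * r (h + z).
  rewrite /= /shift/= !fE subrr expr0n/= !mul0r !addr0 /GRing.scale/= mulr1 addrK.
  by field.
rewrite opprD addrA subrr add0r normrN normrM.
have hd : `|h| <= 2^-1 by near: h; exact: dnbhs0_le.
have he : `|h| <= e / (K%:C + 1).
  by near: h; apply: dnbhs0_le; rewrite divr_gt0.
have rh : `|r (h + z)| <= K%:C + 1.
  apply: (le_trans (norm_le_l1norm _)); apply: (@le_trans _ _ K%:C); last by rewrite lerDl.
  rewrite lecR; apply: rK; rewrite addrK -lecR; apply: (le_trans (l1norm_le_norm h)).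
  by rewrite -(@ler_pM2l _ 2^-1)// mulKf// mulr1.
apply: (le_trans (ler_pM (normr_ge0 _) (normr_ge0 _) he rh)).
by rewrite divfK// gt_eqF.
Unshelve. all: by end_near. Qed.

End ComplexNorm.

Section Weyl.
Context {R : realType} {G : metric_graph R}.
Local Notation mu := (@lebesgue_measure R).
Local Notation C := R[i].
Variables (q : edge G -> R -> R) (alpha : vertex G -> R).
Hypothesis qi : forall j, mu.-integrable `[0, len j] (EFin \o q j).
Local Notation sol := (sol q).
Local Notation residual := (residual q alpha).
Local Notation source := (source q alpha).
Local Notation charmx := (charmx q alpha).
Local Notation V := 'rV[C]_#|unknown (G := G)|.
Local Notation zero := (fun=> fun=> 0 : C) (only parsing).
Implicit Types (z w : C) (g h f : gfun (G := G)) (x y : V).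

(** Two changes of the spectral parameter give an expansion whose remainder is bounded by
    [source_bound]. *)
Lemma derivable_source g k z : gintegrable g ->
  derivable (fun w : C^o => source w g 0 k : C^o) z 1.
Proof.
move=> gi; have g1 := sol_gintegrable qi z 0 gi; have g2 := sol_gintegrable qi z 0 g1.
have [K K0 H] := source_bound alpha qi (l1norm z + 1).
apply: (@derivable_expansion _ _ z (source z g 0 k) (source z (sol z g 0) 0 k)
  (fun w => source w (sol z (sol z g 0) 0) 0 k) (K * mass (sol z (sol z g 0) 0))).
- move=> w; rewrite (source_shift alpha qi w z gi) (source_shift alpha qi w z g1).
  move: (source z g) (source z _) (source w _) => a b c.
  by rewrite !mxE; ring.
- move=> w wz; apply: H => //; rewrite -[w](subrKC z) (le_trans (l1normD _ _))//.
  by rewrite lerD2l.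
Qed.

Lemma derivable_mxof_source (g : V -> gfun) z : (forall x, gintegrable (g x)) ->
  complex_differentiable (fun w => mxof (fun x => source w (g x))) z.
Proof.
by move=> gi k l; under eq_fun do rewrite mxE; exact: derivable_source.
Qed.

(** The Weyl solution for the vertex [v] is the solution whose residual is the unit vector of
    [inr v], so its data are a row of the inverse characteristic matrix. *)
Lemma titchmarsh_weyl_unit (B : {set vertex G}) z k l : charmx z \in unitmx ->
  titchmarsh_weyl q alpha B z k l = invmx (charmx z)
    (enum_rank (inr (enum_val l) : unknown)) (enum_rank (inr (enum_val k) : unknown)).
Proof.
move=> uz; rewrite mxE.
pose e : V := delta_mx 0 (enum_rank (inr (enum_val l) : unknown)).
have eE i : coord e i = (i == inr (enum_val l))%:R.
  by rewrite /coord mxE eqxx (inj_eq enum_rank_inj).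
pose x := e *m invmx (charmx z).
have xE : residual z zero x = e by rewrite residual_charmx// mulmxKV.
have r0 d : coord (residual z zero x) (inl d) = 0 by rewrite xE eE.
have ex : weyl_solution q alpha z (enum_val l) (sol z zero x).
  have [[f2 fAC] fc fE _ fd] := residual_gfun qi (gintegrable0 (G := G)) r0.
  split => //; last by move=> v; rewrite fd xE eE.
  by move=> j; move: (fE j); congr edge_eq; apply/funext => t; rewrite addr0.
case: xgetP => [f _ [[f2 fAC] fc fE fd]|/(_ (sol z zero x))//].
have [|y [_ yv r1 r2]] := gfun_residual alpha qi (z := z) (gintegrable0 (G := G)) fAC fc.
  by move=> j; move: (fE j); congr edge_eq; apply/funext => t; rewrite addr0.
have : residual z zero y = e.
  apply: coordP => -[d|v]; rewrite eE ?r1 ?r2 ?fd//.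
rewrite residual_charmx// => ye; have {}ye : y = x by rewrite -[y](mulmxK uz) ye.
by rewrite -yv ye /coord /x /e -rowE mxE.
Qed.

End Weyl.

(** * Rank of the residue *)

Section RankCompression.
Variables (F : fieldType) (conj : {rmorphism F -> F}) (N m : nat).
Variables (T0 T1 Rs K : 'M[F]_N) (S : 'M[F]_(m, N)).

(** Let [b] annihilate [S Rs S^T]. The vector [b S Rs] is in the kernel of [T0] and vanishes
    under [S^T], so it is zero, and the second equation puts [b S] into the range of [T0]. By
    the orthogonality assumption, a form of the Fredholm alternative, [b] then annihilates the
    conjugates of the vectors [x S^T] with [x] in the kernel, which span a space of dimension
    [\rank (kermx T0)]. *)
Lemma rank_compression : Rs *m T0 = 0 -> Rs *m T1 + K *m T0 = 1%:M ->
  (forall x : 'rV_N, x *m T0 = 0 -> x *m S^T = 0 -> x = 0) ->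
  (forall (x y : 'rV_N) (b : 'rV_m), x *m T0 = 0 -> y *m T0 = b *m S ->
    b *m (map_mx conj (x *m S^T))^T = 0) ->
  \rank (S *m Rs *m S^T) = \rank (kermx T0).
Proof.
move=> RT RTK inj orth; apply/eqP; rewrite eqn_leq; apply/andP; split.
  apply: (leq_trans (mxrankM_maxl _ _)); apply: (leq_trans (mxrankM_maxr _ _)).
  by apply: mxrankS; apply/sub_kermxP.
have injK : \rank (kermx T0 *m S^T) = \rank (kermx T0).
  rewrite -[RHS](mxrank_mul_ker _ S^T) [X in (_ + X)%N](_ : _ = 0%N) ?addn0//.
  apply/eqP; rewrite mxrank_eq0; apply/eqP/row_matrixP => i; rewrite row0.
  have := row_sub i (kermx T0 :&: kermx S^T)%MS.
  by rewrite sub_capmx => /andP[/sub_kermxP h1 /sub_kermxP h2]; exact: inj.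
pose Q := (map_mx conj (kermx T0 *m S^T))^T.
have rQ : \rank Q = \rank (kermx T0) by rewrite mxrank_tr mxrank_map injK.
have kerQ : (kermx (S *m Rs *m S^T) <= kermx Q)%MS.
  apply/row_subP => i; set b := row i _.
  have bS : b *m (S *m Rs *m S^T) = 0 by apply/sub_kermxP; exact: row_sub.
  have n0 : b *m S *m Rs = 0.
    by apply: inj; rewrite -!mulmxA; [rewrite RT !mulmx0|rewrite mulmxA in bS; rewrite -bS !mulmxA].
  have y0 : (b *m S *m K) *m T0 = b *m S.
    by rewrite -[RHS]mulmx1 -RTK mulmxDr (mulmxA _ Rs) n0 mul0mx add0r mulmxA.
  apply/sub_kermxP/rowP => k; rewrite mxE.
  have k0 : row k (kermx T0) *m T0 = 0 by apply/sub_kermxP; exact: row_sub.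
  have := orth _ _ _ k0 y0; move=> /matrixP/(_ 0 0); rewrite !mxE => h.
  rewrite -[RHS]h; apply: eq_bigr => l _; rewrite /Q !mxE; congr (_ * conj _).
  by apply: eq_bigr => j _; rewrite [in RHS]mxE.
rewrite -rQ; move: (mxrankS kerQ); rewrite !mxrank_ker.
have := rank_leq_row Q; have := rank_leq_row (S *m Rs *m S^T); lia.
Qed.

End RankCompression.

Section SimplePole.
Context {R : realType} {m : nat}.
Local Notation C := R[i].
Implicit Types (D : set C) (F H : C -> 'M[C]_m) (z : C) (Res : 'M[C]_m).

Lemma dnbhs_open z (A : C -> Prop) : (\forall w \near (z : C^o)^', A w) ->
  \forall w \near (z : C^o)^', \forall u \near (w : C^o), A u.
Proof.
rewrite !near_withinE => /near_join; apply: filterS => w h wz.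
have : \forall u \near (w : C^o), u - z != 0.
  have c := derivable_continuous (@derivable_subr _ z w).
  by apply: (cvgr_neq0 _ c); rewrite subr_eq0.
by apply: filterS2 h => u h uz; apply: h; rewrite /= -subr_eq0.
Qed.

(** If [F] extended analytically to [z] then [(w - z) F w] would tend to zero, but it tends to
    [Res]. *)
Lemma pole_simple D F H z Res : analytic_at H z ->
  (\forall w \near (z : C^o)^', D w /\ F w = (w - z)^-1 *: Res + H w) ->
  pole D F z <-> Res != 0.
Proof.
move=> Ha nF; split.
- case=> _ nr; apply/eqP => r0; apply: nr; exists H => //.
  by apply: filterS nF => w [Dw ->]; rewrite r0 scaler0 add0r.
move=> Rn0; split.
- have nF2 := dnbhs_open nF; have n3 := near_dnbhs Ha.
  have n4 := @nbhs_dnbhs_neq _ (z : C^o).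
  near=> w; have wz : w != z by near: w.
  split; first by have [] : D w /\ F w = (w - z)^-1 *: Res + H w by near: w.
  move=> k l.
  have dG : complex_differentiable (fun u => (u - z)^-1 *: Res + H u) w.
    have dH : complex_differentiable H w by near: w.
    apply: cdiffD dH; apply: cdiffZ; last exact: cdiff_cst.
    by apply: derivableV; [rewrite subr_eq0|exact: derivable_subr].
  apply: near_eq_derivable (dG k l).
  have : \forall u \near (w : C^o), D u /\ F u = (u - z)^-1 *: Res + H u by near: w.
  by apply: filterS => u [_ ->].
- case=> H' H'a nF'.
  apply/negP: Rn0; rewrite negbK; apply/eqP/matrixP => k l; rewrite mxE.
  have dH : derivable (fun u : C^o => H u k l : C^o) z 1 := nbhs_singleton Ha k l.
  have dH' : derivable (fun u : C^o => H' u k l : C^o) z 1 := nbhs_singleton H'a k l.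
  have c : {for (z : C^o), continuous (fun u : C^o => (u - z) * (H' u k l - H u k l) : C^o)}.
    apply: derivable_continuous; apply: derivableM; first exact: derivable_subr.
    exact: (derivableB dH' dH).
  have c0 : (fun u : C^o => (u - z) * (H' u k l - H u k l) : C^o) u @[u --> (z : C^o)^'] --> (0 : C^o).
    have z0 : (0 : C^o) = (z - z) * (H' z k l - H z k l) by rewrite subrr mul0r.
    by rewrite [X in _ --> X]z0; apply: cvg_within_filter; exact: c.
  apply: (cvg_unique (@norm_hausdorff _ C^o) _ c0).
  apply: cvg_near_cst; near=> u.
  have uz : u != z by near: u; exact: nbhs_dnbhs_neq.
  have [_ e1] : D u /\ F u = (u - z)^-1 *: Res + H u by near: u.
  have [_ e2] : D u /\ F u = H' u by near: u.
  have := e1; rewrite e2 => /matrixP/(_ k l); rewrite !mxE => ->.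
  by rewrite addrK mulVKf// subr_eq0.
Unshelve. all: by end_near. Qed.

End SimplePole.

(** * The eigenspace *)

Section Spectral.
Context {R : realType} {G : metric_graph R}.
Local Notation mu := (@lebesgue_measure R).
Local Notation C := R[i].
Variables (q : edge G -> R -> R) (alpha : vertex G -> R).
Hypothesis qi : forall j, mu.-integrable `[0, len j] (EFin \o q j).
Local Notation sol := (sol q).
Local Notation residual := (residual q alpha).
Local Notation source := (source q alpha).
Local Notation charmx := (charmx q alpha).
Local Notation N := #|unknown (G := G)|.
Local Notation V := 'rV[C]_N.
Local Notation zero := (fun=> fun=> 0 : C).
Implicit Types (z w a : C) (g h f : gfun (G := G)) (x y : V) (lam : R).

Let i0 : gintegrable (G := G) zero := gintegrable0 (G := G).

Lemma sol_zero_lin z a x y j t : 0 <= t <= len j ->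
  sol z zero (a *: x + y) j t = a * sol z zero x j t + sol z zero y j t.
Proof. by move=> tj; have [] := sol_lin qi z a x y i0 i0 tj; rewrite lin_fun0. Qed.

Lemma sol_zero_mulmx (n : nat) z (c : 'rV[C]_n) (A : 'M[C]_(n, N)) j t : 0 <= t <= len j ->
  sol z zero (c *m A) j t = \sum_i c 0 i * sol z zero (row i A) j t.
Proof.
move=> tj; pose L x := sol z zero x j t.
have LL a x y : L (a *: x + y) = a * L x + L y by exact: sol_zero_lin.
have L0 : L 0 = 0.
  by have := LL (-1) 0 0; rewrite scaler0 addr0 mulN1r addNr.
rewrite -/(L _) mulmx_sum_row; apply: (big_ind2 (fun x b => L x = b)) => //.
- by move=> x b y b' <- <-; have := LL 1 x y; rewrite scale1r mul1r.
- by move=> i _; have := LL (c 0 i) (row i A) 0; rewrite !addr0 L0 addr0.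
Qed.

Section LinearCombination.
Variables (a : C) (g1 g2 g3 : gfun (G := G)).
Hypotheses (gi1 : gintegrable g1) (gi2 : gintegrable g2) (gi3 : gintegrable g3).
Hypothesis gE : forall j t, 0 <= t <= len j -> g1 j t = a * g2 j t + g3 j t.

Lemma source_comb z : source z g1 = a *: source z g2 + source z g3.
Proof.
have <- := sourceL alpha qi z a gi2 gi3.
exact: (residual_ext alpha qi z 0 gi1 (gintegrable_lin a gi2 gi3) gE).
Qed.

Lemma sol_comb z j t : 0 <= t <= len j ->
  sol z g1 0 j t = a * sol z g2 0 j t + sol z g3 0 j t.
Proof.
move=> tj; have [+ _] := sol_lin qi z a 0 0 gi2 gi3 tj; rewrite scaler0 addr0 => <-.
by have [] := sol_ext qi z 0 gi1 (gintegrable_lin a gi2 gi3) gE tj.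
Qed.

End LinearCombination.

(** The derivative of [charmx] at [z]. *)
Definition char_deriv z : 'M[C]_N := mxof (fun x => source z (sol z zero x)).

Definition char_remainder w z : 'M[C]_N :=
  mxof (fun x => source z (sol w (sol w zero x) 0)).

Lemma mul_char_deriv z x : x *m char_deriv z = source z (sol z zero x).
Proof.
rewrite mul_mxof// => a u v; apply: source_comb; try exact: sol_gintegrable.
by move=> j t tj; exact: sol_zero_lin.
Qed.

Lemma mul_char_remainder w z x :
  x *m char_remainder w z = source z (sol w (sol w zero x) 0).
Proof.
rewrite mul_mxof// => a u v.
apply: source_comb; try by do 2 apply: sol_gintegrable => //.
move=> j t tj; apply: sol_comb => //; try exact: sol_gintegrable.
by move=> k s sk; exact: sol_zero_lin.
Qed.

Lemma charmx_taylor w z :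
  charmx z = charmx w + (z - w) *: char_deriv w + (z - w) ^+ 2 *: char_remainder w z.
Proof.
have e1 x := mul_char_deriv w x; have e2 x := mul_char_remainder w z x.
have e3 x := charmx_expand alpha qi z w x.
move: (charmx z) (charmx w) (char_deriv w) (char_remainder w z) e1 e2 e3 => A B D E e1 e2 e3.
apply/row_matrixP => i; rewrite !rowE; apply: (etrans (e3 _)).
by rewrite -e1 -e2 !mulmxDr -!scalemxAr.
Qed.

Lemma kernelP z x : x *m charmx z = 0 -> kernel q alpha z (sol z zero x).
Proof.
move=> x0; have r0 : residual z zero x = 0 by rewrite residual_charmx.
have r00 e : coord (residual z zero x) (inl e) = 0 by rewrite r0 coord0.
have [[f2 fAC] fc fE _ fd] := residual_gfun qi i0 r00.
split => //.
- rewrite [X in L2 X](_ : _ = fun j t => (z - 1) * sol z zero x j t + sol z zero x j t).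
    exact: L2_lin.
  by apply/funext => j; apply/funext => t; ring.
- by move=> j; move: (fE j); congr edge_eq; apply/funext => t; rewrite addr0.
- by move=> v; rewrite fd r0 coord0.
Qed.

Lemma kernel_sol z f : kernel q alpha z f -> exists2 x, x *m charmx z = 0 &
  forall j t, 0 <= t <= len j -> f j t = sol z zero x j t.
Proof.
move=> [[f2 fAC] _ fE fc fd].
have [|x [fx _ r1 r2]] := gfun_residual alpha qi (z := z) i0 fAC fc.
  by move=> j; move: (fE j); congr edge_eq; apply/funext => t; rewrite addr0.
exists x => //; rewrite -residual_charmx//.
by apply: coordP => -[e|v]; rewrite coord0 ?r1 ?r2.
Qed.

Lemma geq_on f g : (forall j t, 0 <= t <= len j -> f j t = g j t) -> geq f g.
Proof. by move=> fg j; apply: aeW => t /=; rewrite in_itv/=; exact: fg. Qed.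

Lemma geq_trans f g h : geq f g -> geq g h -> geq f h.
Proof. by move=> fg gh j; exact: ae_eq_trans (fg j) (gh j). Qed.

(** A function of the eigenspace is determined by its data, which form the left kernel of the
    characteristic matrix. *)
Lemma kernel_dimension z : has_dimension (kernel q alpha z) (\rank (kermx (charmx z))).
Proof.
set A := row_base (kermx (charmx z)).
have A0 (c : 'rV_(\rank (kermx (charmx z)))) : c *m A *m charmx z = 0.
  by apply/sub_kermxP; apply: submx_trans (submxMl _ _) _; rewrite eq_row_base.
exists (fun i => sol z zero (row i A)); split.
- by move=> i; apply: kernelP; rewrite rowE A0.
- move=> c c0 i; pose cv := \row_k c k.
  have : cv *m A = 0.
    apply: (sol_geq0 qi (A0 cv)); apply: geq_trans c0; apply: geq_on => j t tj.
    by rewrite sol_zero_mulmx//; apply: eq_bigr => k _; rewrite mxE.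
  move=> cv0; have : cv = 0.
    have rf : row_free A by rewrite row_base_free.
    by apply: (row_free_inj rf); rewrite cv0 mul0mx.
  by move=> /rowP/(_ i); rewrite !mxE.
- move=> f /kernel_sol[x x0 fx].
  have /submxP[c xE] : (x <= A)%MS by rewrite eq_row_base; apply/sub_kermxP.
  exists (fun i => c 0 i); apply: geq_on => j t tj.
  by rewrite fx// xE sol_zero_mulmx.
Qed.

Lemma eigenvalue_dimension z n : has_dimension (kernel q alpha z) n ->
  eigenvalue q alpha z <-> n != 0%N.
Proof.
move=> [b [bV bfree bspan]]; split=> [[f fV f0]|n0].
  apply/negP => /eqP n0; subst n; have [c fc] := bspan f fV; apply: f0.
  by apply: geq_trans fc _; apply: geq_on => j t _; rewrite big_ord0.
case: n n0 b bV bfree bspan => // n _ b bV bfree _; exists (b ord0) => // b0.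
suff /(_ ord0)/eqP : forall i : 'I_n.+1, (i == ord0)%:R = 0 :> C by rewrite eqxx oner_eq0.
apply: bfree; apply: geq_trans b0; apply: geq_on => j t _.
rewrite (bigD1 ord0)//= mul1r big1 ?addr0// => i /negPf ->.
by rewrite mul0r.
Qed.

End Spectral.

(** * Restriction to the vertices in B *)

Section Compression.
Context {R : realType} {G : metric_graph R}.
Local Notation mu := (@lebesgue_measure R).
Local Notation C := R[i].
Variables (q : edge G -> R -> R) (alpha : vertex G -> R).
Hypothesis qi : forall j, mu.-integrable `[0, len j] (EFin \o q j).
Variable B : {set vertex G}.
Local Notation charmx := (charmx q alpha).
Local Notation N := #|unknown (G := G)|.
Local Notation V := 'rV[C]_N.
Implicit Types (z w : C) (x y : V) (A : 'M[C]_N).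

Definition vertex_index (k : 'I_#|B|) : 'I_N := enum_rank (inr (enum_val k) : unknown).

(** The transpose of this matrix restricts a data vector to the values at the vertices in [B]. *)
Definition select : 'M[C]_(#|B|, N) := \matrix_(k, i) (i == vertex_index k)%:R.

Lemma mul_select n (A : 'M[C]_(n, N)) i k : (A *m select^T) i k = A i (vertex_index k).
Proof.
rewrite mxE (bigD1 (vertex_index k))//= !mxE eqxx mulr1 big1 ?addr0// => l lk.
by rewrite !mxE (negPf lk) mulr0.
Qed.

Lemma select_mul n (A : 'M[C]_(N, n)) k i : (select *m A) k i = A (vertex_index k) i.
Proof.
rewrite mxE (bigD1 (vertex_index k))//= !mxE eqxx mul1r big1 ?addr0// => l lk.
by rewrite !mxE (negPf lk) mul0r.
Qed.

Lemma coord_select (b : 'rV[C]_#|B|) i :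
  coord (b *m select) i = \sum_k b 0 k * (i == inr (enum_val k))%:R.
Proof.
by rewrite /coord mxE; apply: eq_bigr => k _; rewrite mxE /vertex_index (inj_eq enum_rank_inj).
Qed.

Lemma titchmarsh_weylE w : charmx w \in unitmx ->
  titchmarsh_weyl q alpha B w = (select *m invmx (charmx w) *m select^T)^T.
Proof.
move=> uw; apply/matrixP => k l; rewrite titchmarsh_weyl_unit//.
by rewrite mxE mul_select select_mul.
Qed.

(** Green's formula for two solutions of the homogeneous equation, one of them in the kernel,
    the other one having defects at the vertices in [B] only. *)
Lemma select_orthogonal lam x y (b : 'rV[C]_#|B|) : x *m charmx lam%:C = 0 ->
  y *m charmx lam%:C = b *m select ->
  b *m (map_mx conjc (x *m select^T))^T = 0.
Proof.
move=> x0 yb; apply/matrixP => i k; rewrite !ord1 [RHS]mxE.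
have e0 e : coord (y *m charmx lam%:C) (inl e) = 0.
  by rewrite yb coord_select big1// => l _; rewrite mulr0.
rewrite -[RHS](green_homogeneous qi x0 e0) yb.
under [RHS]eq_bigr do rewrite coord_select mulr_suml.
rewrite exchange_big/= mxE; apply: eq_bigr => l _.
rewrite (bigD1 (enum_val l))//= big1 ?addr0.
  by rewrite eqxx mulr1 mxE [X in _ * X]mxE mul_select.
by move=> v vl; rewrite (inj_eq (inr_inj)) (negPf vl) mulr0 mul0r.
Qed.

Lemma resolvent_spectrum w : charmx w \in unitmx -> (~` spectrum q alpha) w.
Proof. by move=> uw; rewrite /spectrum setCK; exact: unit_resolvent. Qed.

End Compression.

Theorem theorem4p5 (R : realType) (G : metric_graph R) (q : edge G -> R -> R)
    (q_L1 : forall j : edge G,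
      lebesgue_measure.-integrable `[0, len j] (fun x => (q j x)%:E))
    (B : {set vertex G})
    (B_boundary : forall v : vertex G, boundary_vertex v -> v \in B)
    (B_core : forall v : vertex G, proper_core_vertex v -> v \in B)
    (alpha : vertex G -> R) (lam : R) (lam_nonres : ~ resonance q lam) :
  (eigenvalue q alpha lam%:C <->
     pole (~` spectrum q alpha) (titchmarsh_weyl q alpha B) lam%:C) /\
  exists2 Res : 'M[R[i]]_#|B|,
    is_residue (~` spectrum q alpha) (titchmarsh_weyl q alpha B) lam%:C Res &
    has_dimension (kernel q alpha lam%:C) (\rank Res).
Proof.
set z := lam%:C; pose T0 := charmx q alpha z; pose T1 := char_deriv q alpha z.
pose T2 := char_remainder q alpha z; pose S := select B.
have qi : forall j, lebesgue_measure.-integrable `[0, len j] (EFin \o q j) by exact: q_L1.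
have dT2 w : complex_differentiable T2 w.
  apply: derivable_mxof_source => // x.
  do 2 apply: sol_gintegrable => //; exact: gintegrable0.
have nj (x y : 'rV_#|unknown (G := G)|) : x *m T0 = 0 -> x *m T1 = y *m T0 -> x = 0.
  move=> x0; rewrite mul_char_deriv// => h; exact: no_jordan_chain x0 h.
have [Rs [K [H [RT RTK Ha nH]]]] := simple_pole_inverse z dT2 nj.
pose Res := (S *m Rs *m S^T)^T; pose H' w := (S *m H w *m S^T)^T.
have rk : \rank Res = \rank (kermx T0).
  rewrite mxrank_tr; apply: (rank_compression (conj := conjc) RT RTK).
  - move=> x x0 xB; apply: (unique_continuation qi B_boundary B_core lam_nonres x0).
    move=> v vB; have /rowP/(_ (enum_rank_in vB v)) := xB.
    by rewrite mul_select mxE /vertex_index enum_rankK_in.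
  - by move=> x y b; exact: select_orthogonal.
have H'a : analytic_at H' z.
  apply: filterS Ha => w dH k l.
  under eq_fun do rewrite mxE mul_select select_mul.
  exact: dH.
have near_form : \forall w \near (z : R[i]^o)^', (~` spectrum q alpha) w /\
    titchmarsh_weyl q alpha B w = (w - z)^-1 *: Res + H' w.
  apply: filterS nH => w; rewrite -charmx_taylor// => -[uw wE].
  split; first exact: resolvent_spectrum.
  rewrite titchmarsh_weylE// wE mulmxDr mulmxDl -scalemxAr -scalemxAl.
  by rewrite linearD linearZ.
have dimK : has_dimension (kernel q alpha z) (\rank Res).
  by rewrite rk; exact: kernel_dimension.
split.
  rewrite (eigenvalue_dimension dimK) (pole_simple H'a near_form).
  by rewrite mxrank_eq0.
exists Res => //; exists 0%N, (fun=> Res), H'; split => //.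
apply: filterS near_form => w [Dw ->]; split => //.
by rewrite big_ord1 expr1.
Qed.
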